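(* Let $\mathfrak{G}=\{\mathcal{G}_1,\dots,\mathcal{G}_M\}$ be a group model on $[N]$ with budget $G\in[M]$, let $\mathbf{x}\in\mathbb{R}^N$ be a signal with weights $w_i=x_i^2$, and let a nice tree decomposition of the incidence graph $B(\mathfrak{G})$ of width $w_T$ on $t$ nodes be given. Then the dynamic programming algorithm for the group model projection problem defined by the explicit recursions in the context can be implemented to run in $O(w_T\,5^{w_T}\,G^2\,N\,t)$ time.
   Context: **Group models.** $[N]=\{1,\dots,N\}$. A group model is a collection $\mathfrak{G}=\{\mathcal{G}_1,\dots,\mathcal{G}_M\}$ of subsets (groups) of $[N]$ with $\bigcup_{i=1}^M\mathcal{G}_i=[N]$, together with a budget $G\in[M]$. The group model projection problem for $\mathbf{x}$ is equivalent to choosing at most $G$ groups whose union has maximum total weight, where $w_i=x_i^2$. For $\mathcal{S}\subseteq[N]$ write $w(\mathcal{S})=\sum_{i\in\mathcal{S}}w_i$, and $w(v)=w_v$ for $v\in[N]$. For a set $\mathcal{C}$ of groups, $\bigcup\mathcal{C}$ denotes their union. **Incidence graph.** $B(\mathfrak{G})$ is the bipartite graph with vertex set $[N]\cup\mathfrak{G}$ and an edge between $e\in[N]$ and $S\in\mathfrak{G}$ exactly when $e\in S$. $\Gamma(v)$ denotes the neighbourhood of $v$ in $B(\mathfrak{G})$. **Tree decompositions.** A tree decomposition of a graph $(V,E)$ is a tree $T$ in which each node $x$ has a bag $B_x\subseteq V$ such that the bags cover $V$; for every $v\in V$ the nodes whose bags contain $v$ form a connected subtree; and for every edge $vw\in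 E$ some bag contains both $v$ and $w$. Its width is $\max_x|B_x|-1$. A (rooted) tree decomposition is nice if every node $x$ is of one of the types: Leaf ($x$ has no children and $B_x=\emptyset$); Introduce ($x$ has one child $y$ and $B_x=B_y\cup\{v\}$ for a vertex $v\notin B_y$); Forget ($x$ has one child $y$ and $B_y=B_x\cup\{v\}$ for a vertex $v\notin B_x$); Join ($x$ has two children $y,z$ and $B_x=B_y=B_z$). **Colourings.** A colouring of $B_x$ is a map $c:B_x\to\{0,1,1_?\}$; $c|_S$ is its restriction to $S\subseteq B_x$. It is consistent if $\bigcup(\mathfrak{G}\cap c^{-1}(1))\subseteq[N]\cap c^{-1}(1)$. **The algorithm.** The nodes are processed bottom-up. For every node $x$, every $i$ with $0\le i\le G$ and every colouring $c$ of $B_x$, a value $\mathrm{OPT}(x,i,c)$ is computed from the values at the children of $x$ (a maximum over the empty set, and any value with a negative second argument, is read as $-\infty$). If $c$ is not consistent, $\mathrm{OPT}(x,i,c)=-\infty$. If $c$ is consistent: - Leaf: $\mathrm{OPT}(x,0,c)=0$ and $\mathrm{OPT}(x,i,c)=-\infty$ for all $i\in[G]$. - Introduce, with child $y$ and $B_x=B_y\cup\{v\}$, $v\in[N]$: $\mathrm{OPT}(x,i,c)$ equals $\mathrm{OPT}(y,i,c|_{B_y})$ if $c(v)=0$; $\mathrm{OPT}(y,i,c|_{B_y})+w(v)$ if $c(v)=1$ and $i>0$; $\mathrm{OPT}(y,i,c|_{B_y})+w(v)$ if $c(v)=1_?$; and $-\infty$ otherwise. - Introduce, with child $y$ and $B_x=B_y\cup\{v\}$,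 $v\in\mathfrak{G}$: $\mathrm{OPT}(x,i,c)$ equals $\mathrm{OPT}(y,i,c|_{B_y})$ if $c(v)=0$; $\max\{\mathrm{OPT}(y,i-1,c'):(y,c')\text{ is compatible to }(x,c)\}$ if $c(v)=1$ and $c^{-1}(1)\cap\Gamma(v)\ne\emptyset$; and $-\infty$ otherwise. Here $(y,c')$ is compatible to $(x,c)$ if $c':B_y\to\{0,1,1_?\}$ is a consistent colouring of $B_y$, $c^{-1}(0)=c'^{-1}(0)$, and $c^{-1}(1)=c'^{-1}(1)\cup(c'^{-1}(1_?)\cap\Gamma(v))$. - Forget, with child $y$ and $B_y=B_x\cup\{v\}$: $\mathrm{OPT}(x,i,c)=\max\{\mathrm{OPT}(y,i,c'):c':B_y\to\{0,1,1_?\},\ c=c'|_{B_x},\ c'(v)\ne1_?\}$. - Join, with children $y,z$: $$\mathrm{OPT}(x,i,c)=\max\Big\{\mathrm{OPT}(y,i_1,c')+\mathrm{OPT}(z,i_2,c'')-w\Big(\big((B_x\cap[N])\cup\bigcup(B_x\cap\mathfrak{G})\big)\setminus c^{-1}(0)\Big):\ i_1+i_2-|c'^{-1}(1)\cap c''^{-1}(1)\cap\mathfrak{G}|=i\Big\},$$ the maximum being taken over all consistent colourings $c',c'':B_x\to\{0,1,1_?\}$ with $c^{-1}(0)=c'^{-1}(0)=c''^{-1}(0)$ and $c^{-1}(1)=c'^{-1}(1)\cup c''^{-1}(1)$ (and over such $i_1,i_2\in\{0,\dots,G\}$). - Root $x$: after computing $\mathrm{OPT}(x,G,c)$ for all relevant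 $c$ according to the type of $x$, the algorithm terminates with output $\mathrm{OPT}=\max\{\mathrm{OPT}(x,G,c):c:B_x\to\{0,1,1_?\}\}$.
   Formalization: In ''compatible'', the equation for c^{-1}(1) is read inside B_y, i.e. c^{-1}(1)∩B_y = c'^{-1}(1) ∪ (c'^{-1}(1_?)∩Γ(v)): as printed it can never hold, since c(v)=1 but v∉B_y. Also N≥1 is assumed (for N=0 the bound would be 0). *)

(* Defs.v *)
(* MathComp world; the reals are an arbitrary [R : realType], and values in
   R u {-oo} live in [\bar R]. *)
From HB Require Import structures.
From mathcomp Require Import all_boot all_order all_algebra.
From mathcomp Require Import reals constructive_ereal.
Set Implicit Arguments. Unset Strict Implicit. Unset Printing Implicit Defensive.
Import Order.TTheory GRing.Theory Num.Theory.

Local Open Scope nat_scope.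

(** * Group models and the incidence graph *)

Definition group_model (N M : nat) (grp : 'I_M -> {set 'I_N}) : Prop :=
  injective grp /\ \bigcup_(S : 'I_M) grp S = [set: 'I_N].

(* [inl e] is the element e of [N], [inr S] is the group number S. *)
Definition vertex (N M : nat) : finType := ('I_N + 'I_M)%type.

Definition incidence (N M : nat) (grp : 'I_M -> {set 'I_N}) :
    rel (vertex N M) :=
  fun u v => match u, v with
  | inl e, inr g => e \in grp g
  | inr g, inl e => e \in grp g
  | _, _ => false
  end.

Definition nbh (V : finType) (E : rel V) (v : V) : {set V} := [set u | E v u].

Definition groups (N M : nat) : {set vertex N M} :=
  [set v | if v is inr _ then true else false].

(** * Rooted trees and nice tree decompositions *)

Definition rooted_tree (T : finType) (root : T) (par : T -> T) : Prop :=
  par root = root /\ forall x, fconnect par x root.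

Definition tree_adj (T : finType) (par : T -> T) : rel T :=
  fun x y => (x != y) && ((par x == y) || (par y == x)).

Definition children (T : finType) (root : T) (par : T -> T) (x : T) : {set T} :=
  [set y | (y != root) && (par y == x)].

Definition tree_decomposition (V : finType) (E : rel V)
    (T : finType) (root : T) (par : T -> T) (bag : T -> {set V}) : Prop :=
  [/\ rooted_tree root par,
      \bigcup_(x : T) bag x = [set: V],
      forall (v : V) (x y : T), v \in bag x -> v \in bag y ->
        connect [rel a b | [&& tree_adj par a b, v \in bag a & v \in bag b]] x y
    & forall u v : V, E u v -> exists x : T, (u \in bag x) && (v \in bag x)].

Definition width (V : finType) (T : finType) (bag : T -> {set V}) : nat :=
  (\max_(x : T) #|bag x|).-1.

Inductive node_type (V T : Type) : Type :=
  | Leaf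
  | Introduce of V & T
  | Forget of V & T
  | Join of T & T.
Arguments Leaf {V T}.

Definition nice_node (V T : finType) (root : T) (par : T -> T)
    (bag : T -> {set V}) (ty : T -> node_type V T) (x : T) : Prop :=
  match ty x with
  | Leaf => children root par x = set0 /\ bag x = set0
  | Introduce v y =>
      [/\ children root par x = [set y], v \notin bag y & bag x = v |: bag y]
  | Forget v y =>
      [/\ children root par x = [set y], v \notin bag x & bag y = v |: bag x]
  | Join y z =>
      [/\ y != z, children root par x = [set y; z],
          bag x = bag y & bag x = bag z]
  end.

Definition nice_tree_decomposition (V : finType) (E : rel V)
    (T : finType) (root : T) (par : T -> T) (bag : T -> {set V})
    (ty : T -> node_type V T) : Prop :=
  tree_decomposition E root par bag /\
  forall x, nice_node root par bag ty x.

(** * Colourings *)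

Definition colour : finType := 'I_3.
Definition c0 : colour := @Ordinal 3 0 isT.
Definition c1 : colour := @Ordinal 3 1 isT.
Definition cq : colour := @Ordinal 3 2 isT. (* the colour 1_? *)

(* A colouring of B is a partial map with domain exactly B. *)
Definition pcol (V : finType) := {ffun V -> option colour}.

Definition colouring (V : finType) (B : {set V}) (c : pcol V) : bool :=
  [forall v, isSome (c v) == (v \in B)].

Definition fiber (V : finType) (c : pcol V) (k : colour) : {set V} :=
  [set v | c v == Some k].

Definition restrict (V : finType) (S : {set V}) (c : pcol V) : pcol V :=
  [ffun v => if v \in S then c v else None].

(** * The recursion *)

Section Recursion.
Variables (R : realType) (N M : nat) (grp : 'I_M -> {set 'I_N}) (G : nat).
Variable (x_ : 'rV[R]_N).
Variables (T : finType) (root : T) (bag : T -> {set vertex N M}).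
Variable (ty : T -> node_type (vertex N M) T).

Local Notation V := (vertex N M).
Local Notation Gamma := (nbh (incidence grp)).

Definition weight (e : 'I_N) : R := (x_ 0%R e ^+ 2)%R.

Definition wset (A : {set 'I_N}) : R := (\sum_(e in A) weight e)%R.

Definition consistent (c : pcol V) : bool :=
  \bigcup_(S : 'I_M | inr S \in fiber c c1) grp S
    \subset [set e | inl e \in fiber c c1].

(* The last equation is between subsets of [By]: the introduced vertex v itself
   has c v = 1, but lies outside the domain of c'. *)
Definition compatible (v : V) (By : {set V}) (c c' : pcol V) : bool :=
  [&& colouring By c', consistent c', fiber c c0 == fiber c' c0
    & fiber c c1 :&: By == fiber c' c1 :|: (fiber c' cq :&: Gamma v)].

Definition join_correction (B : {set V}) (c : pcol V) : R :=
  wset (([set e | inl e \in B] :|: \bigcup_(S : 'I_M | inr S \in B) grp S)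
          :\: [set e | inl e \in fiber c c0]).

Definition dp_table := T -> nat -> pcol V -> \bar R.

Definition dp_step (f : dp_table) : dp_table := fun x i c =>
  if ~~ consistent c then -oo%E else
  match ty x with
  | Leaf => if i == 0 then 0%E else -oo%E
  | Introduce (inl e) y =>
      if c (inl e) == Some c0 then f y i (restrict (bag y) c)
      else if (c (inl e) == Some c1) && (0 < i) then
        (f y i (restrict (bag y) c) + (weight e)%:E)%E
      else if c (inl e) == Some cq then
        (f y i (restrict (bag y) c) + (weight e)%:E)%E
      else -oo%E
  | Introduce (inr g) y =>
      if c (inr g) == Some c0 then f y i (restrict (bag y) c)
      else if [&& c (inr g) == Some c1,
                  fiber c c1 :&: Gamma (inr g) != set0 & 0 < i] then
        \big[maxe/-oo%E]_(c' : pcol V | compatible (inr g) (bag y) c c')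
           f y i.-1 c'
      else -oo%E
  | Forget v y =>
      \big[maxe/-oo%E]_(c' : pcol V |
          [&& colouring (bag y) c', c == restrict (bag x) c'
            & c' v != Some cq])
         f y i c'
  | Join y z =>
      \big[maxe/-oo%E]_(c' : pcol V | colouring (bag x) c' && consistent c')
      \big[maxe/-oo%E]_(c'' : pcol V |
          [&& colouring (bag x) c'', consistent c'',
              fiber c c0 == fiber c' c0, fiber c c0 == fiber c'' c0
            & fiber c c1 == fiber c' c1 :|: fiber c'' c1])
      \big[maxe/-oo%E]_(i1 < G.+1)
      \big[maxe/-oo%E]_(i2 < G.+1 |
          i1 + i2 == i + #|fiber c' c1 :&: fiber c'' c1 :&: groups N M|)
         (f y i1 c' + f z i2 c'' - (join_correction (bag x) c)%:E)%E
  end.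

(* #|T| rounds reach the fixed point of the recursion: see [OPT_rec]. *)
Definition OPT : dp_table := iter #|T| dp_step (fun _ _ _ => -oo%E).

Definition OPT_root : \bar R :=
  \big[maxe/-oo%E]_(c : pcol V | colouring (bag root) c) OPT root G c.

Lemma eq_dp_step (f g : dp_table) (x : T) :
  match ty x with
  | Leaf => True
  | Introduce _ y | Forget _ y => forall i c, f y i c = g y i c
  | Join y z => (forall i c, f y i c = g y i c) /\
                (forall i c, f z i c = g z i c)
  end -> forall i c, dp_step f x i c = dp_step g x i c.
Proof.
rewrite /dp_step; case: (ty x) => [|[e|S] y|v y|y z] H i c; case: ifP => // _.
- by rewrite !H.
- by rewrite !H; do 2 case: ifP => // _; apply: eq_bigr.
- by apply: eq_bigr.
case: H => Hy Hz; apply: eq_bigr => c' _; apply: eq_bigr => c'' _.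
by apply: eq_bigr => i1 _; apply: eq_bigr => i2 _; rewrite Hy Hz.
Qed.

Lemma OPT_rec (par : T -> T) :
  nice_tree_decomposition (incidence grp) root par bag ty ->
  forall x i c, OPT x i c = dp_step OPT x i c.
Proof.
move=> [[[proot reach] _ _ _] nice].
pose d x := findex par x root.
have dlt x : d x < #|T|.
  by apply: leq_trans (findex_max (reach x)) _; apply: max_card.
have dchild x y : y \in children root par x -> d y = (d x).+1.
  rewrite inE => /andP[yr /eqP <-]; rewrite /d.
  by rewrite (fconnect_findex (reach y)) // eq_sym.
pose F n := iter n dp_step (fun _ _ _ => -oo%E).
suff stab n x : #|T| <= n + d x -> forall i c, F n x i c = F n.+1 x i c.
  by move=> x i c; rewrite /OPT -/(F _) (stab #|T| x) // leq_addr.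
elim: n x => [|n IHn] x le_n; first by have := dlt x; rewrite ltnNge le_n.
have IHc y : y \in children root par x -> forall i c, F n y i c = F n.+1 y i c.
  by move=> cy; apply: IHn; rewrite (dchild _ _ cy) addnS -addSn.
apply: eq_dp_step; have := nice x; rewrite /nice_node.
case: (ty x) => [//|v y|v y|y z].
- by case=> ch _ _; apply: IHc; rewrite ch set11.
- by case=> ch _ _; apply: IHc; rewrite ch set11.
by case=> _ ch _ _; split; apply: IHc; rewrite ch ?set21 ?set22.
Qed.

End Recursion.

(** * The machine model

   A unit-cost real RAM, programmed in a structured language. There are two
   families of unbounded arrays, named by natural numbers, one holding natural
   numbers and one holding extended reals; a program is a fixed finite
   piece of syntax, so it uses a fixed number of arrays. Natural numbers
   support only constants, addition, truncated subtraction and comparison: unit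
   cost for the multiplication of unbounded integers would be unrealistic.
   There is no conversion between the two kinds of data. Every syntax node that
   is evaluated (operation, memory access, constant, test) costs 1. *)

Inductive iexp :=
  | IConst of nat
  | IGet of nat & iexp        (* array name, index *)
  | IAdd of iexp & iexp
  | ISub of iexp & iexp.

Inductive rexp :=
  | RZero
  | RNinf
  | RGet of nat & iexp
  | RAdd of rexp & rexp
  | RSub of rexp & rexp
  | RMul of rexp & rexp.

Inductive bexp :=
  | ILe of iexp & iexp
  | RLe of rexp & rexp
  | BNot of bexp
  | BAnd of bexp & bexp.

Inductive cmd :=
  | Skip
  | ISet of nat & iexp & iexp (* array name, index, value *)
  | RSet of nat & iexp & rexp
  | Seq of cmd & cmd
  | If of bexp & cmd & cmd
  | While of bexp & cmd.

Fixpoint icost (e : iexp) : nat :=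
  match e with
  | IConst _ => 1
  | IGet _ e1 => (icost e1).+1
  | IAdd e1 e2 | ISub e1 e2 => (icost e1 + icost e2).+1
  end.

Fixpoint rcost (e : rexp) : nat :=
  match e with
  | RZero | RNinf => 1
  | RGet _ e1 => (icost e1).+1
  | RAdd e1 e2 | RSub e1 e2 | RMul e1 e2 => (rcost e1 + rcost e2).+1
  end.

Fixpoint bcost (b : bexp) : nat :=
  match b with
  | ILe e1 e2 => (icost e1 + icost e2).+1
  | RLe e1 e2 => (rcost e1 + rcost e2).+1
  | BNot b1 => (bcost b1).+1
  | BAnd b1 b2 => (bcost b1 + bcost b2).+1
  end.

Section Semantics.
Variable R : realType.

Record state := State {
  imem : nat -> nat -> nat;
  rmem : nat -> nat -> \bar R }.

Definition upd (A : Type) (m : nat -> nat -> A) (a j : nat) (u : A) :=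
  fun b k => if (b == a) && (k == j) then u else m b k.

Fixpoint ieval (s : state) (e : iexp) : nat :=
  match e with
  | IConst n => n
  | IGet a e1 => imem s a (ieval s e1)
  | IAdd e1 e2 => ieval s e1 + ieval s e2
  | ISub e1 e2 => ieval s e1 - ieval s e2
  end.

Fixpoint reval (s : state) (e : rexp) : \bar R :=
  match e with
  | RZero => 0%E
  | RNinf => -oo%E
  | RGet a e1 => rmem s a (ieval s e1)
  | RAdd e1 e2 => (reval s e1 + reval s e2)%E
  | RSub e1 e2 => (reval s e1 - reval s e2)%E
  | RMul e1 e2 => (reval s e1 * reval s e2)%E
  end.

Fixpoint beval (s : state) (b : bexp) : bool :=
  match b with
  | ILe e1 e2 => ieval s e1 <= ieval s e2
  | RLe e1 e2 => (reval s e1 <= reval s e2)%E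
  | BNot b1 => ~~ beval s b1
  | BAnd b1 b2 => beval s b1 && beval s b2
  end.

(* [exec p s s' k]: started in s, the program p halts in s' at total cost k. *)
Inductive exec : cmd -> state -> state -> nat -> Prop :=
  | ExecSkip s : exec Skip s s 1
  | ExecISet s a e1 e2 :
      exec (ISet a e1 e2) s
        (State (upd (imem s) a (ieval s e1) (ieval s e2)) (rmem s))
        (icost e1 + icost e2).+1
  | ExecRSet s a e1 e2 :
      exec (RSet a e1 e2) s
        (State (imem s) (upd (rmem s) a (ieval s e1) (reval s e2)))
        (icost e1 + rcost e2).+1
  | ExecSeq p q s s1 s2 k1 k2 :
      exec p s s1 k1 -> exec q s1 s2 k2 -> exec (Seq p q) s s2 (k1 + k2)
  | ExecIfTrue b p q s s1 k :
      beval s b -> exec p s s1 k -> exec (If b p q) s s1 (bcost b + k)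
  | ExecIfFalse b p q s s1 k :
      ~~ beval s b -> exec q s s1 k -> exec (If b p q) s s1 (bcost b + k)
  | ExecWhileFalse b p s :
      ~~ beval s b -> exec (While b p) s s (bcost b)
  | ExecWhileTrue b p s s1 s2 k1 k2 :
      beval s b -> exec p s s1 k1 -> exec (While b p) s1 s2 k2 ->
      exec (While b p) s s2 (bcost b + k1 + k2).

End Semantics.

(** * Input and output conventions *)

Section Encoding.
Variables (R : realType) (N M : nat) (grp : 'I_M -> {set 'I_N}) (G : nat).
Variable (x_ : 'rV[R]_N).
Variables (t : nat) (root : 'I_t) (bag : 'I_t -> {set vertex N M}).
Variable (ty : 'I_t -> node_type (vertex N M) 'I_t).

Local Notation V := (vertex N M).

Definition vcode (v : V) : nat :=
  match v with inl e => val e | inr g => N + g end.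

(* node type, vertex, first child, second child (0 where not applicable) *)
Definition node_code (n : node_type V 'I_t) : nat * nat * nat * nat :=
  match n with
  | Leaf => (0, 0, 0, 0)
  | Introduce v y => (1, vcode v, val y, 0)
  | Forget v y => (2, vcode v, val y, 0)
  | Join y z => (3, 0, val y, val z)
  end.

Definition input_nats (a : nat) : seq nat :=
  match a with
  | 0 => [:: N; M; G; t; val root]
  | 1 => (* M x N incidence matrix, row by row *)
         [seq nat_of_bool (e \in grp g) | g <- enum 'I_M, e <- enum 'I_N]
  | 2 => [seq (node_code (ty x)).1.1.1 | x <- enum 'I_t]
  | 3 => [seq (node_code (ty x)).1.1.2 | x <- enum 'I_t]
  | 4 => [seq (node_code (ty x)).1.2 | x <- enum 'I_t]
  | 5 => [seq (node_code (ty x)).2 | x <- enum 'I_t]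
  | 6 => (* start of each bag in array 7, and the total length of array 7 *)
         [seq \sum_(y < t | y < k) #|bag y| | k <- iota 0 t.+1]
  | 7 => (* the bags, each one in increasing order of [vcode] *)
         flatten [seq [seq vcode v | v <- enum (bag x)] | x <- enum 'I_t]
  | _ => [::]
  end.

(* All cells that do not carry input are initially 0. *)
Definition input_state : state R :=
  State (fun a j => nth 0 (input_nats a) j)
        (fun a j => if a == 0
                    then nth 0%E [seq (x_ 0%R e)%:E | e <- enum 'I_N] j
                    else 0%E).

Definition digit (o : option colour) : nat := if o is Some k then val k else 0.

(* The colours of the vertices of B, listed in increasing order, read as the
   base 3 digits of a number, least significant first. *)
Definition ccode (B : {set V}) (c : pcol V) : nat :=
  \sum_(j < #|B|) digit (c (enum_val j)) * 3 ^ j.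

Definition opt_cell (x : 'I_t) (i : nat) (c : pcol V) : nat :=
  \sum_(y < t | y < x) 3 ^ #|bag y| * G.+1 + ccode (bag x) c * G.+1 + i.

(* The dynamic programming table is in the extended real array 1, the output
   value in cell 0 of the extended real array 2. *)
Definition dp_output (s : state R) : Prop :=
  (forall (x : 'I_t) (i : nat) (c : pcol V),
      i <= G -> colouring (bag x) c ->
      rmem s 1 (opt_cell x i c) = OPT grp G x_ bag ty x i c) /\
  rmem s 2 0 = OPT_root grp G x_ root bag ty.

End Encoding.

(* Main.v *)
Require Import Defs.
From mathcomp Require Import all_boot all_order all_algebra.
From mathcomp Require Import reals constructive_ereal zify.
From Stdlib Require Import FunctionalExtensionality.
Set Implicit Arguments. Unset Strict Implicit. Unset Printing Implicit Defensive.
Import Order.TTheory.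
Local Open Scope nat_scope.

(** The dynamic programming table is filled by one fixed program.  In a node x
    every table entry is a maximum of contributions, and a contribution is given
    by colourings c of the bag and c', c'' of the bags of the children together
    with at most two counters.  In a join node each vertex has only five possible
    triples of colours under (c, c', c''), namely (0,0,0), (1,1,1), (1,1,1?),
    (1,1?,1) and (1?,1?,1?); in the other nodes c' alone determines what has to be
    combined, up to the colour of the introduced or forgotten vertex.  Hence the
    vectors with digits below 5, indexed by the larger of the two bags, list all
    contributions ([contribs_dp_step]); a vector that repeats a contribution is
    harmless, since only maxima are taken.

    For each of the 5 ^ b vectors (b is the size of that bag) the program decodes
    the colourings, computes the positions of their rows of the table by Horner's
    rule in base 3, decides consistency and sums the weights by comparing each of
    the N elements with the b vertices of the bag, and then relaxes the cells of c
    for the at most (G+1)^2 pairs of counters ([body_cmdP]).  Only c is tested for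
    consistency: an inconsistent colouring of a child has the value -oo and
    contributes nothing.  A node therefore takes O(5 ^ b (b N + G ^ 2)) steps with
    b <= width + 1, which is O(width 5 ^ width G ^ 2 N).  The nodes are
    solved in the reverse of a breadth-first order from the root
    ([order_cmdP], [nodes_cmdP]).  The preparations (rows of the incidence matrix,
    offsets of the cells, order) take O(M + t width) steps; here M is at most
    t (width + 1), as every group lies in a bag, and width >= 1, as the incidence
    graph has an edge.

    Two devices keep the verification short.  Costs are counted in loop
    iterations only: between two iterations a program passes at most once through
    its text, so that the cost is at most [csize p] times the number of iterations
    plus one ([run]).  Maxima are described by their upper bounds: a cell holds the
    maximum of a set of values exactly when, for all z, it is at most z iff all
    these values are.  Under this description the loops that take running maxima
    have invariants that are conjunctions, whatever the order of enumeration. *)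

(** * Running programs *)

Fixpoint csize (p : cmd) : nat :=
  match p with
  | Skip => 1
  | ISet _ e1 e2 => (icost e1 + icost e2).+1
  | RSet _ e1 e2 => (icost e1 + rcost e2).+1
  | Seq p q => csize p + csize q
  | If b p q => bcost b + (csize p + csize q)
  | While b p => bcost b + csize p
  end.

Fixpoint iwrites (p : cmd) : seq nat :=
  match p with
  | ISet a _ _ => [:: a]
  | Seq p q | If _ p q => iwrites p ++ iwrites q
  | While _ p => iwrites p
  | _ => [::]
  end.

Fixpoint rwrites (p : cmd) : seq nat :=
  match p with
  | RSet a _ _ => [:: a]
  | Seq p q | If _ p q => rwrites p ++ rwrites q
  | While _ p => rwrites p
  | _ => [::]
  end.

Fixpoint ireads (e : iexp) : seq nat :=
  match e with
  | IConst _ => [::]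
  | IGet a e1 => a :: ireads e1
  | IAdd e1 e2 | ISub e1 e2 => ireads e1 ++ ireads e2
  end.

Section Running.
Variable R : realType.
Implicit Types (s : state R) (p q : cmd) (Q : state R -> Prop).

(** States that differ in the integer arrays I and the real arrays J only: since a
    scalar variable is an array of its own, a frame is a list of array names. *)
Definition agree (I J : seq nat) s s' : Prop :=
  (forall a, a \notin I -> imem s' a =1 imem s a) /\
  (forall a, a \notin J -> rmem s' a =1 rmem s a).

Lemma agree_refl I J s : agree I J s s.
Proof. by []. Qed.

Lemma agree_trans I J s1 s2 s3 :
  agree I J s1 s2 -> agree I J s2 s3 -> agree I J s1 s3.
Proof.
by move=> [i12 r12] [i23 r23]; split=> a Ha j; rewrite ?i23 ?i12 ?r23 ?r12.
Qed.

Lemma agree_sub I J I' J' s s' :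
  {subset I <= I'} -> {subset J <= J'} -> agree I J s s' -> agree I' J' s s'.
Proof.
move=> sI sJ [i r]; split=> a Ha.
  by apply: i; apply: contra Ha; apply: sI.
by apply: r; apply: contra Ha; apply: sJ.
Qed.

Lemma agree_widen I J I' J' s s' :
  all (mem I') I -> all (mem J') J -> agree I J s s' -> agree I' J' s s'.
Proof. by move=> /allP sI /allP sJ; apply: agree_sub. Qed.

Lemma agree_exec p s s' k : exec p s s' k -> agree (iwrites p) (rwrites p) s s'.
Proof.
elim=> {p s s' k} /=; try by move=> *; apply: agree_refl.
- move=> s a e1 e2; split=> // b; rewrite inE => /negPf ne j.
  by rewrite /= /upd ne.
- move=> s a e1 e2; split=> // b; rewrite inE => /negPf ne j.
  by rewrite /= /upd ne.
- move=> p q s s1 s2 k1 k2 _ A1 _ A2; apply: (agree_trans (s2 := s1)).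
    by apply: agree_sub A1 => a; rewrite mem_cat => ->.
  by apply: agree_sub A2 => a; rewrite mem_cat orbC => ->.
- move=> b p q s s1 k _ _ A1.
  by apply: agree_sub A1 => a; rewrite mem_cat => ->.
- move=> b p q s s1 k _ _ A1.
  by apply: agree_sub A1 => a; rewrite mem_cat orbC => ->.
by move=> b p s s1 s2 k1 k2 _ _ A1 _ A2; apply: agree_trans A1 A2.
Qed.

Lemma ieval_agree I J s s' (e : iexp) :
  agree I J s s' -> ~~ has (mem I) (ireads e) -> ieval s' e = ieval s e.
Proof.
move=> [ag _]; elim: e => //= [a e IH|e1 IH1 e2 IH2|e1 IH1 e2 IH2].
- by rewrite negb_or => /andP[Ha He]; rewrite IH // ag.
- by rewrite has_cat negb_or => /andP[H1 H2]; rewrite IH1 ?IH2.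
by rewrite has_cat negb_or => /andP[H1 H2]; rewrite IH1 ?IH2.
Qed.

(** Total correctness with a budget of n loop iterations.  The witness m is the
    actual number of iterations; the factor [csize p] turns it into a cost. *)
Definition run p s Q n : Prop :=
  exists s' k m, [/\ exec p s s' k, k <= csize p * m.+1, m <= n & Q s'].

Definition seti s a j u : state R := State (upd (imem s) a j u) (rmem s).
Definition setr s a j u : state R := State (imem s) (upd (rmem s) a j u).

Lemma run_conseq p s Q Q' n n' :
  run p s Q n -> n <= n' -> (forall s', Q s' -> Q' s') -> run p s Q' n'.
Proof.
move=> [s' [k [m [ex km mn Qs]]]] nn QQ; exists s', k, m; split=> //.
  exact: leq_trans nn.
exact: QQ.
Qed.

Lemma run_frame p s Q n :
  run p s Q n ->
  run p s (fun s' => Q s' /\ agree (iwrites p) (rwrites p) s s') n.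
Proof.
move=> [s' [k [m [ex km mn Qs]]]]; exists s', k, m; split=> //; split=> //.
exact: agree_exec ex.
Qed.

(** The rule by which specifications are used: what holds after p may be combined
    with the fact that p leaves all arrays alone that it does not assign to. *)
Lemma run_use p s P Q n n' :
  run p s P n -> n <= n' ->
  (forall s', P s' -> agree (iwrites p) (rwrites p) s s' -> Q s') ->
  run p s Q n'.
Proof.
by move=> /run_frame H nn PQ; apply: run_conseq H nn _ => s' []; apply: PQ.
Qed.

Lemma run_skip s Q : Q s -> run Skip s Q 0.
Proof. by move=> Qs; exists s, 1, 0; split=> //; constructor. Qed.

Lemma run_iset s a e1 e2 Q :
  Q (seti s a (ieval s e1) (ieval s e2)) -> run (ISet a e1 e2) s Q 0.
Proof.
move=> Qs; exists (seti s a (ieval s e1) (ieval s e2)), (icost e1 + icost e2).+1, 0.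
by split=> //=; [constructor|rewrite muln1].
Qed.

Lemma run_rset s a e1 e2 Q :
  Q (setr s a (ieval s e1) (reval s e2)) -> run (RSet a e1 e2) s Q 0.
Proof.
move=> Qs; exists (setr s a (ieval s e1) (reval s e2)), (icost e1 + rcost e2).+1, 0.
by split=> //=; [constructor|rewrite muln1].
Qed.

Lemma run_seq p q s Q n1 n2 :
  run p s (fun s1 => run q s1 Q n2) n1 -> run (Seq p q) s Q (n1 + n2).
Proof.
move=> [s1 [k1 [m1 [e1 c1 l1 [s2 [k2 [m2 [e2 c2 l2 Qs]]]]]]]].
exists s2, (k1 + k2), (m1 + m2); split=> //=; [exact: ExecSeq e1 e2 | nia | lia].
Qed.

Lemma run_if b p q s Q n :
  (beval s b -> run p s Q n) -> (~~ beval s b -> run q s Q n) ->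
  run (If b p q) s Q n.
Proof.
move=> H1 H2; case: (boolP (beval s b)) => [hb|hb].
  have [s' [k [m [ex c l Qs]]]] := H1 hb.
  by exists s', (bcost b + k), m; split=> //=; [exact: ExecIfTrue|nia].
have [s' [k [m [ex c l Qs]]]] := H2 hb.
by exists s', (bcost b + k), m; split=> //=; [exact: ExecIfFalse|nia].
Qed.

Lemma run_while b p s n K (Inv : nat -> state R -> Prop) :
  Inv 0 s ->
  (forall j s', j < n -> Inv j s' -> beval s' b /\ run p s' (Inv j.+1) K) ->
  (forall s', Inv n s' -> ~~ beval s' b) ->
  run (While b p) s (Inv n) (n * K.+1).
Proof.
move=> I0 step stop.
suff H m j s1 : j + m = n -> Inv j s1 -> run (While b p) s1 (Inv n) (m * K.+1).
  exact: (H n 0).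
elim: m j s1 => [|m IH] j s1.
  rewrite addn0 => -> In; exists s1, (bcost b), 0; split=> //=; last by lia.
  by apply: ExecWhileFalse; apply: stop.
move=> jm Ij; have jn : j < n by lia.
have [hb [s2 [k1 [m1 [e1 c1 l1 I2]]]]] := step j s1 jn Ij.
have [s3 [k2 [m2 [e2 c2 l2 I3]]]] := IH j.+1 s2 ltac:(lia) I2.
exists s3, (bcost b + k1 + k2), (m1 + m2).+1; split=> //.
- exact: ExecWhileTrue e1 e2.
- move: c1 c2 => /=; nia.
- nia.
Qed.

End Running.

Definition Var a := IGet a (IConst 0).
Definition SetVar a e := ISet a (IConst 0) e.

Definition For i e p : cmd :=
  Seq (SetVar i (IConst 0))
      (While (ILe (IAdd (Var i) (IConst 1)) e)
             (Seq p (SetVar i (IAdd (Var i) (IConst 1))))).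

(** The bound e is evaluated in every test, so it must not depend on arrays that
    the body assigns to.  The invariant speaks of the state after the counter has
    been increased. *)
Lemma run_for (R : realType) i e p (s : state R) n K (Inv : nat -> state R -> Prop) :
  ieval s e = n ->
  i \notin iwrites p -> ~~ has (mem (i :: iwrites p)) (ireads e) ->
  Inv 0 (seti s i 0 0) ->
  (forall j s', j < n -> agree (i :: iwrites p) (rwrites p) s s' ->
     imem s' i 0 = j -> Inv j s' ->
     run p s' (fun s'' => Inv j.+1 (seti s'' i 0 j.+1)) K) ->
  run (For i e p) s (Inv n) (n * K.+1).
Proof.
move=> en ip ie I0 step; rewrite -[_ * _]add0n; apply: run_seq; apply: run_iset.
set A := agree (i :: iwrites p) (rwrites p) s.
have agi s1 u : A s1 -> A (seti s1 i 0 u).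
  move=> [a1 a2]; split=> // a Ha j; rewrite /= /upd.
  by move: (Ha); rewrite inE => /norP[/negPf -> _]; apply: a1.
apply: (@run_conseq _ _ _ (fun s' => [/\ Inv n s', A s' & imem s' i 0 = n]));
  [|exact: leqnn|by move=> s' []].
apply: (run_while (Inv := fun j s' => [/\ Inv j s', A s' & imem s' i 0 = j])).
- by split=> //; [apply: agi|rewrite /= /upd !eqxx].
- move=> j s1 jn [Ij As ij]; split.
    by rewrite /= ij (ieval_agree As ie) en addn1.
  rewrite -[K]addn0; apply: run_seq.
  apply: run_use (step _ _ jn As ij Ij) (leqnn _) _ => s2 I2 A2.
  have i2 : imem s2 i 0 = j by rewrite A2.1.
  apply: run_iset; rewrite /= i2 addn1; split=> //.
    apply: agi; apply: (agree_trans As).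
    by apply: agree_sub A2 => // a ap; rewrite inE ap orbT.
  by rewrite /= /upd !eqxx.
by move=> s1 [_ As ij]; rewrite /= ij (ieval_agree As ie) en addn1 ltnn.
Qed.

(** A program without loops can be executed symbolically. *)
Fixpoint straight (p : cmd) : bool :=
  match p with
  | Seq p q | If _ p q => straight p && straight q
  | While _ _ => false
  | _ => true
  end.

Section Straight.
Variable R : realType.
Implicit Types (s : state R) (p q : cmd) (Q : state R -> Prop).

Fixpoint sexec p s : state R :=
  match p with
  | ISet a e1 e2 => seti s a (ieval s e1) (ieval s e2)
  | RSet a e1 e2 => setr s a (ieval s e1) (reval s e2)
  | Seq p q => sexec q (sexec p s)
  | If b p q => if beval s b then sexec p s else sexec q s
  | _ => s
  end.

Lemma run_straight p s Q n : straight p -> Q (sexec p s) -> run p s Q n.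
Proof.
move=> st Qs; apply: (@run_conseq _ _ _ Q _ 0) => //.
elim: p s Q st Qs => //=.
- by move=> s Q _; apply: run_skip.
- by move=> a e1 e2 s Q _; apply: run_iset.
- by move=> a e1 e2 s Q _; apply: run_rset.
- move=> p IHp q IHq s Q /andP[sp sq] Qs; rewrite -[0]addn0; apply: run_seq.
  by apply: IHp => //; apply: IHq.
move=> b p IHp q IHq s Q /andP[sp sq] Qs; apply: run_if => hb.
  by apply: IHp; rewrite // hb in Qs.
by apply: IHq; rewrite // (negPf hb) in Qs.
Qed.

Lemma run_straight_seq p q s Q n :
  straight p -> run q (sexec p s) Q n -> run (Seq p q) s Q n.
Proof.
by move=> st H; rewrite -[n]add0n; apply: run_seq; apply: run_straight.
Qed.

Lemma agree_sexec p s : straight p -> agree (iwrites p) (rwrites p) s (sexec p s).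
Proof.
move=> st; have [s' [k [m [ex _ _ <-]]]] : run p s (fun s' => s' = sexec p s) 0.
  exact: run_straight.
exact: agree_exec ex.
Qed.

Lemma run_head p q s Q n :
  straight p ->
  (forall s', s' = sexec p s -> agree (iwrites p) (rwrites p) s s' ->
     run q s' Q n) ->
  run (Seq p q) s Q n.
Proof.
by move=> st H; apply: run_straight_seq => //; apply: H => //; apply: agree_sexec.
Qed.

End Straight.

Definition Cst := IConst.
Definition Eqb e1 e2 := BAnd (ILe e1 e2) (ILe e2 e1).
Definition Ltb e1 e2 := ILe (IAdd e1 (IConst 1)) e2.
Definition When b p := If b p Skip.

(** [frame H] reads memory cells in the state before a command instead of the one
    after it; [isT] proves by computation that the array is not written. *)
Ltac frame H :=
  match type of H with
  | agree _ _ ?s0 ?s =>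
    repeat match goal with
    | |- context [imem s ?a ?j] => rewrite (proj1 H a isT j)
    | |- context [rmem s ?a ?j] => rewrite (proj2 H a isT j)
    end
  end.

Ltac frames :=
  repeat match goal with
  | H : agree _ _ _ ?s |- context [imem ?s ?a ?j] => rewrite (proj1 H a isT j)
  | H : agree _ _ _ ?s |- context [rmem ?s ?a ?j] => rewrite (proj2 H a isT j)
  end.

Declare Scope cmd_scope.
Notation "p ;; q" := (Seq p q) (at level 70, right associativity) : cmd_scope.
Local Open Scope cmd_scope.

(** Conditional expressions.  Assigning one to a variable changes a single cell,
    whichever branch is taken, so that states do not branch in the proofs. *)
Inductive cexp := CE of iexp | CIf of bexp & cexp & cexp.

Fixpoint ceval (R : realType) (s : state R) (c : cexp) : nat :=
  match c with
  | CE e => ieval s e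
  | CIf b c1 c2 => if beval s b then ceval s c1 else ceval s c2
  end.

Fixpoint put (a : nat) (c : cexp) : cmd :=
  match c with
  | CE e => SetVar a e
  | CIf b c1 c2 => If b (put a c1) (put a c2)
  end.

Lemma straight_put a c : straight (put a c).
Proof. by elim: c => //= b c1 -> c2 ->. Qed.

Lemma sexec_put (R : realType) (s : state R) a c :
  sexec (put a c) s = seti s a 0 (ceval s c).
Proof. by elim: c => //= b c1 -> c2 ->; case: ifP. Qed.

Lemma iwrites_put a c : {subset iwrites (put a c) <= [:: a]}.
Proof.
by elim: c => [e|b c1 H1 c2 H2] d //=; rewrite mem_cat => /orP[/H1|/H2].
Qed.

Lemma rwrites_put a c : rwrites (put a c) = [::].
Proof. by elim: c => //= b c1 -> c2 ->. Qed.

Definition flag a b := put a (CIf b (CE (Cst 1)) (CE (Var a))).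

Lemma agree_seti (R : realType) (s : state R) a j u :
  agree [:: a] [::] s (seti s a j u).
Proof. by split=> // b; rewrite inE => /negPf nb k; rewrite /= /upd nb. Qed.

Lemma run_put (R : realType) (s : state R) a c q Q n :
  (forall s', imem s' a 0 = ceval s c -> agree [:: a] [::] s s' -> run q s' Q n) ->
  run (put a c ;; q) s Q n.
Proof.
move=> H; apply: run_straight_seq; first exact: straight_put.
by rewrite sexec_put; apply: H (agree_seti _ _ _ _); rewrite /= /upd !eqxx.
Qed.

Lemma run_put_last (R : realType) (s : state R) a c (Q : state R -> Prop) n :
  (forall s', imem s' a 0 = ceval s c -> agree [:: a] [::] s s' -> Q s') ->
  run (put a c) s Q n.
Proof.
move=> H; apply: run_straight; first exact: straight_put.
by rewrite sexec_put; apply: H (agree_seti _ _ _ _); rewrite /= /upd !eqxx.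
Qed.

Lemma run_set (R : realType) (s : state R) a e q Q n :
  (forall s', imem s' a 0 = ieval s e -> agree [:: a] [::] s s' -> run q s' Q n) ->
  run (SetVar a e ;; q) s Q n.
Proof. exact: (@run_put _ _ _ (CE e)). Qed.

(** * Memory layout *)

(** A name beginning with v is a scalar variable, stored in cell 0 of its array;
    the prefix a marks arrays of natural numbers and r those of extended reals.
    The arrays 0 to 7, which hold the input, are never written. *)
Notation vNodeIdx := 10 (only parsing).
Notation vNode := 11 (only parsing).
Notation vKind := 12 (only parsing).
Notation vVertex := 13 (only parsing).
Notation vChild1 := 14 (only parsing).
Notation vChild2 := 15 (only parsing).
Notation vBlock := 16 (only parsing).
Notation vBlock1 := 17 (only parsing).
Notation vBlock2 := 18 (only parsing).
Notation vBagStart := 19 (only parsing).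
Notation vBagLen := 20 (only parsing).
Notation vPower := 21 (only parsing).
Notation vIter := 22 (only parsing).
Notation vPos := 23 (only parsing).
Notation vPtr := 24 (only parsing).
Notation vCurVertex := 25 (only parsing).
Notation vDigit := 26 (only parsing).
Notation vColour := 27 (only parsing).
Notation vCode := 28 (only parsing).
Notation vSpecial := 29 (only parsing).
Notation vCell2 := 30 (only parsing).
Notation vCell1 := 31 (only parsing).
Notation vCell0 := 32 (only parsing).
Notation vHasNbh := 33 (only parsing).
Notation vShared := 34 (only parsing).
Notation vElem := 35 (only parsing).
Notation vCovered := 36 (only parsing).
Notation vExcluded := 37 (only parsing).
Notation vRequired := 38 (only parsing).
Notation vPresent := 39 (only parsing).
Notation vValid := 40 (only parsing).
Notation vUp := 41 (only parsing).
Notation vDown := 42 (only parsing).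
Notation vLow := 43 (only parsing).
Notation vCount1 := 44 (only parsing).
Notation vCount2 := 45 (only parsing).
Notation vTarget := 46 (only parsing).
Notation vCarry := 47 (only parsing).
Notation vTail := 48 (only parsing).
Notation vBigNode := 49 (only parsing).
Notation aRows := 50 (only parsing).
Notation aOffsets := 51 (only parsing).
Notation aQueue := 52 (only parsing).
Notation aDigits := 53 (only parsing).
Notation aColours := 54 (only parsing).
Notation rSignal := 0 (only parsing).
Notation rTable := 1 (only parsing).
Notation rOutput := 2 (only parsing).
Notation rGain := 3 (only parsing).
Notation rCorr := 4 (only parsing).

Definition eN := IGet 0 (Cst 0).
Definition eM := IGet 0 (Cst 1).
Definition eG := IGet 0 (Cst 2).
Definition eG1 := IAdd eG (Cst 1).
Definition RVar a := RGet a (Cst 0).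

(** * Relaxing the cells of one colouring *)

(** The rows of c and c' in the table start at [vCell0] and [vCell1].  The value for
    the counter i1 in the row of c' goes, increased by [rGain], to the counter
    i1 + up - down in the row of c, unless that counter is less than [vLow]. *)
Definition relax_cmd : cmd :=
  For vCount1 eG1
   (SetVar vTarget (ISub (IAdd (Var vCount1) (Var vUp)) (Var vDown)) ;;
    When (BAnd (ILe (Var vDown) (IAdd (Var vCount1) (Var vUp)))
           (BAnd (ILe (Var vTarget) eG) (ILe (Var vLow) (Var vTarget))))
     (When (RLe (RGet rTable (IAdd (Var vCell0) (Var vTarget)))
                (RAdd (RGet rTable (IAdd (Var vCell1) (Var vCount1))) (RVar rGain)))
       (RSet rTable (IAdd (Var vCell0) (Var vTarget))
          (RAdd (RGet rTable (IAdd (Var vCell1) (Var vCount1))) (RVar rGain))))).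

Section Upd.
Variable R : realType.
Implicit Types s : state R.

Lemma relax_cmdP s (CX := imem s vCell0 0) (CY := imem s vCell1 0) (G := imem s 0 2) :
  (forall i i', i <= G -> i' <= G -> CX + i != CY + i') ->
  run relax_cmd s (fun s' =>
    (forall i, i <= G -> forall z : \bar R, (rmem s' rTable (CX + i) <= z)%E <->
       (rmem s rTable (CX + i) <= z)%E /\
       forall i1, i1 <= G -> i1 + imem s vUp 0 = i + imem s vDown 0 ->
         imem s vLow 0 <= i -> (rmem s rTable (CY + i1) + rmem s rGain 0 <= z)%E) /\
    (forall a, ~~ (CX <= a <= CX + G) -> rmem s' rTable a = rmem s rTable a)) G.+1.
Proof.
move=> dis.
apply: (@run_conseq _ _ _ _ _ (G.+1 * 1)); last first.
- by move=> s'; exact.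
- by rewrite muln1.
pose Inv k s' :=
    (forall i, i <= G -> forall z : \bar R, (rmem s' rTable (CX + i) <= z)%E <->
       (rmem s rTable (CX + i) <= z)%E /\
       forall i1, i1 < k -> i1 + imem s vUp 0 = i + imem s vDown 0 ->
         imem s vLow 0 <= i -> (rmem s rTable (CY + i1) + rmem s rGain 0 <= z)%E) /\
    (forall a, ~~ (CX <= a <= CX + G) -> rmem s' rTable a = rmem s rTable a).
apply: (run_for (Inv := Inv)) => //.
- by rewrite /= addn1.
- by split=> // i _ z; split=> [H|[]//]; split.
move=> j s1 jG A1 j1 [I1 I2].
apply: run_straight => //.
rewrite /= /upd /= j1; frame A1; rewrite -/CX -/CY -/G.
set up := imem s vUp 0; set dn := imem s vDown 0; set lo := imem s vLow 0.
have CYj : rmem s1 rTable (CY + j) = rmem s rTable (CY + j).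
  by apply: I2; apply/negP => /andP[le1 le2]; have := dis (CY + j - CX) j; lia.
rewrite CYj.
set v := (rmem s rTable (CY + j) + _)%E; set tg := j + up - dn.
(* the iteration adds the value v to the candidates of the cell tg *)
have ext i z : (forall i1, i1 < j.+1 -> i1 + up = i + dn -> lo <= i ->
      (rmem s rTable (CY + i1) + rmem s rGain 0 <= z)%E) <->
    (forall i1, i1 < j -> i1 + up = i + dn -> lo <= i ->
      (rmem s rTable (CY + i1) + rmem s rGain 0 <= z)%E) /\
    (j + up = i + dn -> lo <= i -> (v <= z)%E).
  split=> [H|[H1 H2] i1]; first by split=> [i1 i1j|]; apply: H => //; apply: ltnW.
  by rewrite ltnS leq_eqVlt => /orP[/eqP ->|]; [apply: H2|apply: H1].
case: ifP => [/and3P[c1 c2 c3]|c]; first case: ifP => c4.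
- split; rewrite /= /upd /=; [move=> i iG z|move=> a na]; last first.
    by case: eqP => [e|_]; [move: na; rewrite e; lia|apply: I2].
  case: eqP => [e|ne].
    have -> : i = tg by lia.
    have c5 : j + up = tg + dn by lia.
    rewrite ext; split=> [vz|[_ [_ H]]]; last exact: H.
    have /(I1 _ c2)[H1 H2] := le_trans c4 vz.
    by split.
  rewrite I1 // ext; split=> [[H1 H2]|[H1 [H2 _]]] //; split=> //; split=> // e.
  by case: ne; lia.
- split; rewrite /=; [move=> i iG z|exact: I2].
  rewrite ext I1 //; split=> [[H1 H2]|[H1 [H2 _]]] //; split=> //; split=> // e _.
  have ei : tg = i by lia.
  apply: le_trans (_ : (rmem s1 rTable (CX + i) <= z)%E); last by apply/(I1 _ iG).
  by rewrite ltW // ltNge -ei c4.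
- split; rewrite /=; [move=> i iG z|exact: I2].
  rewrite ext I1 //; split=> [[H1 H2]|[H1 [H2 _]]] //; split=> //; split=> // e le.
  by move: c; rewrite (_ : tg = i); lia.
Qed.

End Upd.

(** For a join the counter i2 of the second child shifts the target upwards, and
    the number of groups chosen on both sides shifts it downwards. *)
Definition join_loop : cmd :=
  For vCount2 eG1
    (RSet rGain (Cst 0) (RSub (RGet rTable (IAdd (Var vCell2) (Var vCount2))) (RVar rCorr)) ;;
     SetVar vUp (Var vCount2) ;; relax_cmd).

Lemma join_loopP (R : realType) (s : state R)
    (CX := imem s vCell0 0) (CY := imem s vCell1 0) (CZ := imem s vCell2 0) (G := imem s 0 2) :
  (forall i i', i <= G -> i' <= G -> CX + i != CY + i') ->
  (forall i i', i <= G -> i' <= G -> CX + i != CZ + i') ->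
  run join_loop s (fun s' =>
    (forall i, i <= G -> forall z : \bar R, (rmem s' rTable (CX + i) <= z)%E <->
       (rmem s rTable (CX + i) <= z)%E /\
       forall i1 i2, i1 <= G -> i2 <= G -> i1 + i2 = i + imem s vDown 0 ->
         imem s vLow 0 <= i ->
         (rmem s rTable (CY + i1) + (rmem s rTable (CZ + i2) - rmem s rCorr 0) <= z)%E) /\
    (forall a, ~~ (CX <= a <= CX + G) -> rmem s' rTable a = rmem s rTable a)) (G.+1 * G.+2).
Proof.
move=> disY disZ.
pose Inv k s' :=
    (forall i, i <= G -> forall z : \bar R, (rmem s' rTable (CX + i) <= z)%E <->
       (rmem s rTable (CX + i) <= z)%E /\
       forall i1 i2, i1 <= G -> i2 < k -> i1 + i2 = i + imem s vDown 0 ->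
         imem s vLow 0 <= i ->
         (rmem s rTable (CY + i1) + (rmem s rTable (CZ + i2) - rmem s rCorr 0) <= z)%E) /\
    (forall a, ~~ (CX <= a <= CX + G) -> rmem s' rTable a = rmem s rTable a).
apply: (run_for (Inv := Inv)) => //; first by rewrite /= addn1.
  by split=> // i _ z; split=> [|[]].
move=> j s1 jG A1 j1 [I1 I2].
apply: run_head => // s2 e2 A2; apply: run_set => s3 e3 A3.
have outY i : i <= G -> ~~ (CX <= CY + i <= CX + G).
  by move=> iG; apply/negP => /andP[l1 l2]; have := disY (CY + i - CX) i; lia.
have outZ i : i <= G -> ~~ (CX <= CZ + i <= CX + G).
  by move=> iG; apply/negP => /andP[l1 l2]; have := disZ (CZ + i - CX) i; lia.
have T3 a : rmem s3 rTable a = rmem s1 rTable a by rewrite A3.2 // e2.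
have ADD3 : rmem s3 rGain 0 = (rmem s rTable (CZ + j) - rmem s rCorr 0)%E.
  by rewrite A3.2 // e2 /= /upd /= j1; frame A1; rewrite -I2 // outZ.
have UP3 : imem s3 vUp 0 = j by rewrite e3 /=; frames.
have CX3 : imem s3 vCell0 0 = CX by frames.
have CY3 : imem s3 vCell1 0 = CY by frames.
have G3 : imem s3 0 2 = G by frames.
have DN3 : imem s3 vDown 0 = imem s vDown 0 by frames.
have LO3 : imem s3 vLow 0 = imem s vLow 0 by frames.
have := @relax_cmdP _ s3; rewrite CX3 CY3 G3 DN3 LO3 UP3 ADD3 => /(_ disY) H.
apply: run_use H (leqnn _) _ => s4 [J1 J2] A4; split=> [i iG z|a na]; last first.
  by rewrite /= J2 // T3 I2.
rewrite /= J1 // T3 I1 //; split=> [[[H1 H2] H3]|[H1 H2]].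
  split=> // i1 i2 i1G; rewrite ltnS leq_eqVlt => /orP[/eqP ->|i2j]; last exact: H2.
  by move=> e12 lo; have := H3 i1 i1G e12 lo; rewrite T3 I2 // outY.
split=> [|i1 i1G e12 lo]; first by split=> // i1 i2 i1G i2j; apply: H2 => //; apply: ltnW.
by rewrite T3 I2 ?outY //; apply: H2.
Qed.

(** * Decoding a digit vector *)

Definition positional (b : nat) (s : seq nat) : nat := foldr (fun d a => d + b * a) 0 s.

Lemma has_iotaS (p : pred nat) k : has p (iota 0 k.+1) = has p (iota 0 k) || p k.
Proof. by rewrite -addn1 iotaD has_cat /= orbF. Qed.
Lemma all_iotaS (p : pred nat) k : all p (iota 0 k.+1) = all p (iota 0 k) && p k.
Proof. by rewrite -addn1 iotaD all_cat /= andbT. Qed.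
Lemma count_iotaS (p : pred nat) k :
  count p (iota 0 k.+1) = count p (iota 0 k) + p k.
Proof. by rewrite -addn1 iotaD count_cat /= addn0. Qed.

Section Layout.
Variable R : realType.
Implicit Types s : state R.

(** The bag over which digit vectors range, as the program sees it: its j-th vertex,
    the j-th digit, and the j-th colour of the colouring being decoded. *)
Definition bag_len s := imem s vBagLen 0.
Definition vertex_at s j := imem s 7 (imem s vBagStart 0 + j).
Definition digit_at s j := imem s aDigits j.
Definition colour_at s j := imem s aColours j.
Definition incident s u e := 0 < imem s 1 (imem s aRows (u - imem s 0 0) + e).
End Layout.

Definition eInc u e := ILe (Cst 1) (IGet 1 (IAdd (IGet aRows (ISub u eN)) e)).
Definition load_vertex := SetVar vCurVertex (IGet 7 (IAdd (Var vBagStart) (Var vPos))).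
Definition is_elem u := Ltb u eN.
Definition is_group u := ILe eN u.

(** In an introduce or forget node the digit of the vertex concerned selects the
    case of the recursion. *)
Definition scan_cmd : cmd :=
  SetVar vSpecial (Cst 0) ;;
  For vPos (Var vBagLen)
    (load_vertex ;; When (Eqb (Var vCurVertex) (Var vVertex)) (SetVar vSpecial (IGet aDigits (Var vPos)))).

Lemma scan_cmdP (R : realType) (s : state R) :
  (forall i j, i < bag_len s -> j < bag_len s -> vertex_at s i = vertex_at s j -> i = j) ->
  run scan_cmd s (fun s' => forall j, j < bag_len s -> vertex_at s j = imem s vVertex 0 ->
     imem s' vSpecial 0 = digit_at s j) (bag_len s).
Proof.
move=> inj; apply: run_head => // s0 _ A0.
apply: (@run_conseq _ _ _ _ _ (bag_len s * 1)); [|by rewrite muln1|by move=> s'; apply].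
apply: (run_for (Inv := fun k s' => forall j, j < k -> vertex_at s j = imem s vVertex 0 ->
     imem s' vSpecial 0 = digit_at s j)) => //.
  by rewrite /=; frame A0.
move=> j s1 jb A1 j1 I1; apply: run_straight => //.
rewrite /= /upd /= j1; frame A1; frame A0.
rewrite -/(vertex_at s j) -eqn_leq => i; rewrite ltnS => ij iv.
case: eqP => [jv|nv] /=; rewrite /upd /=.
  by frame A1; frame A0; rewrite (inj i j) ?jv //; apply: leq_ltn_trans jb.
by apply: I1 => //; rewrite ltn_neqAle ij andbT; apply: contra_notN nv => /eqP <-.
Qed.

(** One step of Horner's rule in base 3, scaled by G + 1 because there is no
    multiplication.  A colour of 3 stands for a vertex outside the bag and is
    skipped. *)
Definition add_digit : cmd :=
  When (ILe (Var vColour) (Cst 2))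
   (SetVar vCode (IAdd (Var vCode) (IAdd (Var vCode) (Var vCode))) ;;
    When (ILe (Cst 1) (Var vColour)) (SetVar vCode (IAdd (Var vCode) eG1)) ;;
    When (ILe (Cst 2) (Var vColour)) (SetVar vCode (IAdd (Var vCode) eG1))).

Lemma add_digitP (R : realType) (s : state R) (o := imem s vColour 0) :
  imem (sexec add_digit s) vCode 0 =
  if o < 3 then (imem s 0 2).+1 * o + 3 * imem s vCode 0 else imem s vCode 0.
Proof.
rewrite /add_digit /= ltnS -/o; case: ifP => [o2|//].
case: (ltnP 0 o) => o0; rewrite /= /upd /= -/o;
  case: (ltnP 1 o) => o1; rewrite /= /upd /=; try lia.
  by rewrite (_ : o = 2); lia.
by rewrite (_ : o = 1); lia.
Qed.

(** Positions are visited from the last to the first, since the first vertex of a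
    bag carries the least significant digit. *)
Definition fill_load : cmd :=
  SetVar vPtr (ISub (Var vBagLen) (IAdd (Var vPos) (Cst 1))) ;;
  SetVar vCurVertex (IGet 7 (IAdd (Var vBagStart) (Var vPtr))) ;;
  SetVar vDigit (IGet aDigits (Var vPtr)).

Definition fill_cmd (c : cexp) : cmd :=
  SetVar vCode (Cst 0) ;;
  For vPos (Var vBagLen)
   (fill_load ;; put vColour c ;; ISet aColours (Var vPtr) (Var vColour) ;; add_digit).

Definition fill_code (b G : nat) (f : nat -> nat) : nat :=
  G.+1 * positional 3 [seq x <- [seq f j | j <- iota 0 b] | x < 3].

Definition fill_mods := [:: vCode; vPos; vPtr; vCurVertex; vDigit; vColour; aColours].

Lemma iwrites_fill c : {subset iwrites (fill_cmd c) <= fill_mods}.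
Proof.
move=> a; rewrite /= !(mem_cat, inE).
by do ![case/orP] => [->|->|->|->|->|/iwrites_put|->|->|->|->|->];
  rewrite ?inE ?orbT // => ->; rewrite ?orbT.
Qed.

Lemma rwrites_fill c : rwrites (fill_cmd c) = [::].
Proof. by rewrite /= rwrites_put. Qed.

Lemma fill_cmdP (R : realType) (c : cexp) (f : nat -> nat -> nat) (s : state R) :
  (forall s', agree fill_mods [::] s s' ->
     ceval s' c = f (imem s' vCurVertex 0) (imem s' vDigit 0)) ->
  run (fill_cmd c) s (fun s' =>
    [/\ forall j, j < bag_len s -> colour_at s' j = f (vertex_at s j) (digit_at s j),
        imem s' vCode 0 =
          fill_code (bag_len s) (imem s 0 2) (fun j => f (vertex_at s j) (digit_at s j))
      & agree fill_mods [::] s s'])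
    (bag_len s).
Proof.
move=> fc.
set b := bag_len s; set g := fun j => f (vertex_at s j) (digit_at s j).
apply: (run_use (n := b)
  (P := fun s' => (forall j, b - b <= j < b -> colour_at s' j = g j) /\
    imem s' vCode 0 = (imem s 0 2).+1 *
       positional 3 [seq x <- [seq g j | j <- iota (b - b) b] | x < 3])) => //; last first.
  move=> s' [H1 H2] A; split=> [j jb||].
  - by apply: H1; rewrite subnn.
  - by rewrite H2 subnn.
  by apply: agree_sub A; [apply: iwrites_fill|rewrite rwrites_fill].
apply: run_head => // s0 e0 A0.
rewrite -[X in run _ _ _ X]muln1.
apply: (run_for (Inv := fun k s' => (forall j, b - k <= j < b -> colour_at s' j = g j) /\
    imem s' vCode 0 = (imem s 0 2).+1 *
       positional 3 [seq x <- [seq g j | j <- iota (b - k) k] | x < 3])) => //.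
- by rewrite /= /b /bag_len; frame A0.
- rewrite /= !(mem_cat, inE); apply/negP => H.
  by do ![case/orP: H => H] => //; move: (iwrites_put H); apply/negP.
- apply/hasPn => a; rewrite !inE => /eqP ->; rewrite /= !(mem_cat, inE); apply/negP => H.
  by do ![case/orP: H => H] => //; move: (iwrites_put H); apply/negP.
- by rewrite e0 /= /upd /= muln0; split=> // j; lia.
move=> j s1 jb A1 j1 [I1 I2].
have As : agree fill_mods [::] s s1.
  apply: (agree_trans (s2 := s0)); first exact: agree_widen A0.
  apply: agree_sub A1; last by rewrite /= rwrites_put.
  move=> a Ha; apply: (@iwrites_fill c).
  set X := iwrites _ in Ha; change (a \in vCode :: (vPos :: X ++ [:: vPos])); clearbody X.
  by move: Ha; rewrite !(inE, mem_cat) => /orP[->|->]; rewrite !orbT.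
apply: run_head => // s2 e2 A2; apply: run_head; first exact: straight_put.
move=> s3; rewrite sexec_put => e3 _; apply: run_head => // s4 e4 _.
have As2 : agree fill_mods [::] s s2.
  by apply: (agree_trans As); apply: agree_widen A2.
have u2 : imem s2 vPtr 0 = b - j.+1.
  by rewrite e2 /= /upd /= j1 addn1; frame As.
have {}fc : ceval s2 c = g (b - j.+1).
  by rewrite fc // e2 /= /upd /= j1 addn1; frame As.
have wE i : colour_at s4 i = if i == b - j.+1 then g (b - j.+1) else colour_at s1 i.
  by rewrite e4 e3 /colour_at /= /upd /= u2 fc; frame A2.
apply: run_straight => //.
have A5 : agree [:: vCode] [::] s4 (sexec add_digit s4).
  by apply: agree_widen (agree_sexec (p := add_digit) s4 _).
have addP := add_digitP s4.
move: (sexec add_digit s4) A5 addP => s5 A5 addP.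
split=> [i ib|].
  rewrite /colour_at /= /upd /=; frame A5; rewrite -/(colour_at s4 i) wE.
  by case: eqP => [->//|ni]; apply: I1; lia.
have oE : imem s4 vColour 0 = g (b - j.+1) by rewrite e4 e3 /= /upd /= fc.
have cE : imem s4 vCode 0 = imem s1 vCode 0.
  by rewrite e4 e3 /= /upd /=; frame A2.
have GE : imem s4 0 2 = imem s 0 2.
  by rewrite e4 e3 /= /upd /=; frame As2.
rewrite /seti /= /upd /= addP oE cE GE I2.
rewrite (_ : (b - j.+1).+1 = b - j) /=; last by lia.
by case: ifP => // _; rewrite /= mulnDr; lia.
Qed.

(** * Consistency and weights *)

(** At a join the digit 1 stands for colour 1 on both sides, so that [vShared] counts
    the groups that both children have counted. *)
Definition flags_cmd : cmd :=
  SetVar vHasNbh (Cst 0) ;; SetVar vShared (Cst 0) ;;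
  For vPos (Var vBagLen)
    (load_vertex ;;
     flag vHasNbh (BAnd (Eqb (IGet aColours (Var vPos)) (Cst 1))
                (BAnd (is_elem (Var vCurVertex)) (eInc (Var vVertex) (Var vCurVertex)))) ;;
     put vShared (CIf (BAnd (Eqb (IGet aDigits (Var vPos)) (Cst 1)) (is_group (Var vCurVertex)))
                (CE (IAdd (Var vShared) (Cst 1))) (CE (Var vShared)))).

Lemma flags_cmdP (R : realType) (s : state R) :
  run flags_cmd s (fun s' =>
    imem s' vHasNbh 0 = has (fun j => [&& colour_at s j == 1, vertex_at s j < imem s 0 0
                      & incident s (imem s vVertex 0) (vertex_at s j)]) (iota 0 (bag_len s)) /\
    imem s' vShared 0 = count (fun j => (digit_at s j == 1) && (imem s 0 0 <= vertex_at s j))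
                      (iota 0 (bag_len s))) (bag_len s).
Proof.
apply: run_straight_seq => //; apply: run_head => // s0 e0 A0.
have {}A0 : agree [:: vHasNbh; vShared] [::] s s0.
  by apply: agree_trans (agree_widen _ _ A0) => //; apply: agree_widen (agree_sexec (p := SetVar vHasNbh (Cst 0)) s _).
rewrite -[X in run _ _ _ X]muln1.
apply: (run_for (Inv := fun k s' =>
    imem s' vHasNbh 0 = has (fun j => [&& colour_at s j == 1, vertex_at s j < imem s 0 0
                      & incident s (imem s vVertex 0) (vertex_at s j)]) (iota 0 k) /\
    imem s' vShared 0 = count (fun j => (digit_at s j == 1) && (imem s 0 0 <= vertex_at s j))
                      (iota 0 k))) => //.
- by rewrite /=; frame A0.
- by rewrite e0.
move=> j s1 jb A1 j1 [I1 I2].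
apply: run_set => s2 e2 A2; apply: run_put => s3 e3 A3; apply: run_put_last => s4 e4 A4.
rewrite has_iotaS count_iotaS /= /upd /=; frame A4; rewrite e4 e3 /=.
frame A3; frame A2; rewrite e2 /= j1 I1 I2 -!eqn_leq addn1.
rewrite /colour_at /vertex_at /digit_at /incident; frame A1; frame A0.
by split; case: ifP => H; rewrite ?H ?orbT ?orbF ?addn0 ?addn1.
Qed.

(** For each element four questions about the bag are answered in one pass: is the
    element in the bag or in a group of the bag, does it have colour 0, does it lie
    in a group of colour 1, and does it have colour 1?  The last two decide
    consistency, the first two the weight to be subtracted at a join. *)
Definition elem_cmd : cmd :=
  SetVar vValid (Cst 1) ;; RSet rCorr (Cst 0) RZero ;;
  For vElem eN
   (SetVar vCovered (Cst 0) ;; SetVar vExcluded (Cst 0) ;; SetVar vRequired (Cst 0) ;; SetVar vPresent (Cst 0) ;;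
    For vPos (Var vBagLen)
     (load_vertex ;; SetVar vDigit (IGet aColours (Var vPos)) ;;
      flag vCovered (Eqb (Var vCurVertex) (Var vElem)) ;;
      flag vCovered (BAnd (is_group (Var vCurVertex)) (eInc (Var vCurVertex) (Var vElem))) ;;
      flag vExcluded (BAnd (Eqb (Var vCurVertex) (Var vElem)) (Eqb (Var vDigit) (Cst 0))) ;;
      flag vRequired (BAnd (is_group (Var vCurVertex))
                  (BAnd (eInc (Var vCurVertex) (Var vElem)) (Eqb (Var vDigit) (Cst 1)))) ;;
      put vPresent (CIf (BAnd (Eqb (Var vCurVertex) (Var vElem)) (Eqb (Var vDigit) (Cst 1)))
                 (CE (Cst 1)) (CE (Var vPresent)))) ;;
    put vValid (CIf (BAnd (Eqb (Var vRequired) (Cst 1)) (Eqb (Var vPresent) (Cst 0)))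
               (CE (Cst 0)) (CE (Var vValid))) ;;
    When (BAnd (Eqb (Var vCovered) (Cst 1)) (Eqb (Var vExcluded) (Cst 0)))
      (RSet rCorr (Cst 0)
         (RAdd (RVar rCorr) (RMul (RGet rSignal (Var vElem)) (RGet rSignal (Var vElem)))))).

Section Elem.
Variable R : realType.
Implicit Types s : state R.

Definition in_scope s e j :=
  (vertex_at s j == e) || (imem s 0 0 <= vertex_at s j) && incident s (vertex_at s j) e.
Definition elem_has s d e j := (vertex_at s j == e) && (colour_at s j == d).
Definition chosen_group s e j :=
  [&& imem s 0 0 <= vertex_at s j, incident s (vertex_at s j) e & colour_at s j == 1].
Definition ex_pos s (p : pred nat) := has p (iota 0 (bag_len s)).

Definition ok_at s e :=
  ex_pos s (chosen_group s e) ==> ex_pos s (elem_has s 1 e).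
Definition corr_at s e :=
  ex_pos s (in_scope s e) && ~~ ex_pos s (elem_has s 0 e).

Lemma elem_cmdP s :
  run elem_cmd s (fun s' =>
    imem s' vValid 0 = all (ok_at s) (iota 0 (imem s 0 0)) /\
    rmem s' rCorr 0 = (\sum_(0 <= e < imem s 0 0 | corr_at s e)
        (rmem s rSignal e * rmem s rSignal e))%E)
    (imem s 0 0 * (bag_len s).+1).
Proof.
apply: run_straight_seq => //; apply: run_head => // s0 e0 A0.
have {}A0 : agree [:: vValid] [:: rCorr] s s0.
  apply: agree_trans (agree_widen _ _ A0) => //.
  exact: agree_widen (agree_sexec (p := SetVar vValid (Cst 1)) s _).
apply: (run_for (Inv := fun k s' =>
    imem s' vValid 0 = all (ok_at s) (iota 0 k) /\
    rmem s' rCorr 0 = (\sum_(0 <= e < k | corr_at s e)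
        (rmem s rSignal e * rmem s rSignal e))%E)) => //.
- by rewrite /=; frame A0.
- by rewrite e0 /= /upd /= big_nil.
move=> e s1 eN A1 e1 [I1 I2].
do 3! apply: run_straight_seq => //; apply: run_head => // s2 e2 _.
have A2 : agree [:: vCovered; vExcluded; vRequired; vPresent] [::] s1 s2.
  rewrite e2; split=> // a; rewrite !inE !negb_or /= /upd.
  by move=> /and4P[/negPf -> /negPf -> /negPf -> /negPf ->].
rewrite -[bag_len s]addn0; apply: run_seq; rewrite -[X in run _ _ _ X]muln1.
apply: (run_use (P := fun s' =>
  [/\ imem s' vCovered 0 = has (in_scope s e) (iota 0 (bag_len s)),
      imem s' vExcluded 0 = has (elem_has s 0 e) (iota 0 (bag_len s)),
      imem s' vRequired 0 = has (chosen_group s e) (iota 0 (bag_len s))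
    & imem s' vPresent 0 = has (elem_has s 1 e) (iota 0 (bag_len s))]) (n := bag_len s * 1)) => //.
  apply: (run_for (Inv := fun k s' =>
    [/\ imem s' vCovered 0 = has (in_scope s e) (iota 0 k),
      imem s' vExcluded 0 = has (elem_has s 0 e) (iota 0 k),
      imem s' vRequired 0 = has (chosen_group s e) (iota 0 k)
    & imem s' vPresent 0 = has (elem_has s 1 e) (iota 0 k)])) => //.
  - by rewrite /=; frame A2; frame A1; frame A0.
  - by rewrite e2.
  move=> j s3 jb A3 j3 [I3 I4 I5 I6]; apply: run_set => s31 e31 A31; apply: run_set => s32 e32 A32.
  apply: run_put => s4 e4 A4; apply: run_put => s5 e5 A5.
  apply: run_put => s6 e6 A6; apply: run_put => s7 e7 A7.
  apply: run_put_last => s8 e8 A8.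
  rewrite !has_iotaS; move: e4 e5 e6 e7 e8; rewrite /= -!eqn_leq; frames.
  rewrite e31 /=; frames; rewrite e32 /=; frames.
  rewrite j3 e1 I3 I4 I5 I6 => e4 e5 e6 e7 e8.
  rewrite /upd /=; frames; rewrite e5 e4 e6 e7 e8.
  rewrite /in_scope /elem_has /chosen_group /incident /vertex_at /colour_at.
  split; last 3 first.
  - by case: ifP => H; rewrite ?H ?orbT ?orbF.
  - by case: ifP => H; rewrite ?H ?orbT ?orbF.
  - by case: ifP => H; rewrite ?H ?orbT ?orbF.
  by do 2 (case: ifP => ?; rewrite ?orbT ?orbF //).
move=> s3 [F1 F2 F3 F4] A3; apply: run_put => s4 e4 A4.
apply: run_if; rewrite [beval _ _]/= -!eqn_leq; frames; rewrite F1 F2 => hb.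
  apply: run_rset; rewrite all_iotaS /= /upd /=; frames; split.
    rewrite e4 /= -!eqn_leq; frames; rewrite F3 F4 I1 /ok_at /ex_pos.
    by do 2 case: has; rewrite /= ?andbT ?andbF.
  rewrite big_mkcond big_nat_recr //= -big_mkcond /= e1 I2 /corr_at.
  by move: hb; rewrite /ex_pos; do 2 case: has.
apply: run_skip; rewrite all_iotaS /= /upd /=; frames; split.
  rewrite e4 /= -!eqn_leq; frames; rewrite F3 F4 I1 /ok_at /ex_pos.
  by do 2 case: has; rewrite /= ?andbT ?andbF.
rewrite big_mkcond big_nat_recr //= -big_mkcond /= I2 /corr_at.
by move: hb; rewrite /ex_pos; do 2 case: has; rewrite /= ?adde0.
Qed.

End Elem.

(** * From memory to colourings *)

Lemma map_index_uniq (T : eqType) (s : seq T) :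
  uniq s -> [seq index x s | x <- s] = iota 0 (size s).
Proof.
move=> uniq_s; case: s uniq_s => [//|x0 s0]; set s := x0 :: s0 => uniq_s.
apply: (@eq_from_nth _ 0); rewrite ?size_map ?size_iota // => i isz.
by rewrite (nth_map x0) // index_uniq // nth_iota.
Qed.

Definition colour_of (d : nat) : option colour :=
  match d with 0 => Some c0 | 1 => Some c1 | 2 => Some cq | _ => None end.

Lemma digit_colour_of d : d < 3 -> digit (colour_of d) = d.
Proof. by case: d => [|[|[|]]]. Qed.

Lemma isSome_colour_of d : isSome (colour_of d) = (d < 3).
Proof. by case: d => [|[|[|]]]. Qed.

Section Bridge.
Variables (R : realType) (N M : nat) (grp : 'I_M -> {set 'I_N}).
Local Notation V := (vertex N M).
Local Notation Gamma := (nbh (incidence grp)).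
Implicit Types (s : state R) (c : pcol V) (u : V).
Variable B : {set V}.

Definition bag_index u := index u (enum B).

Lemma bag_index_lt u : u \in B -> bag_index u < #|B|.
Proof. by rewrite cardE index_mem mem_enum. Qed.

Lemma map_bag_index : [seq bag_index u | u <- enum B] = iota 0 #|B|.
Proof. by rewrite map_index_uniq ?enum_uniq // cardE. Qed.

Lemma has_bag_index (p : pred nat) : has p (iota 0 #|B|) = [exists u in B, p (bag_index u)].
Proof.
rewrite -map_bag_index has_map; apply/hasP/existsP => [[u]|[u /andP[uB pu]]].
  by rewrite mem_enum /= => uB pu; exists u; rewrite uB.
by exists u; rewrite ?mem_enum.
Qed.

Lemma count_bag_index (p : pred nat) :
  count p (iota 0 #|B|) = #|[set u in B | p (bag_index u)]|.
Proof.
rewrite -map_bag_index count_map -sum1_count big_enum_cond /= -sum1_card.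
by apply: eq_bigl => u; rewrite inE.
Qed.

Lemma vcode_inj : injective (@vcode N M).
Proof.
move=> [e|g] [e'|g'] /= h.
- by congr inl; apply: val_inj.
- by have := ltn_ord e; lia.
- by have := ltn_ord e'; lia.
by congr inr; apply: val_inj => /=; lia.
Qed.

(** [views] and [shows] say that the arrays represent the bag B, the incidence
    relation and the colouring c.  Vertices are located by [bag_index], which,
    unlike indexing with a default value, needs no vertex to exist. *)
Definition views s : Prop :=
  [/\ imem s 0 0 = N, bag_len s = #|B|,
      forall u, u \in B -> vertex_at s (bag_index u) = vcode u
    & forall (g : 'I_M) (e : 'I_N), incident s (N + g) e = (e \in grp g)].

Definition shows s c : Prop :=
  (forall u, u \in B -> colour_of (colour_at s (bag_index u)) = c u) /\
  (forall u, u \notin B -> c u = None).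

Lemma consistentP c :
  reflect (forall (g : 'I_M) (e : 'I_N),
      c (inr g) = Some c1 -> e \in grp g -> c (inl e) = Some c1)
    (consistent grp c).
Proof.
apply: (iffP subsetP) => [H g e cg eg|H e /bigcupP[g]].
  by have := H e; rewrite !inE => /(_ _)/eqP; apply; apply/bigcupP; exists g;
    rewrite ?inE ?cg.
by rewrite !inE => /eqP cg eg; rewrite (H g).
Qed.

Lemma colour_at_eq s c u k : shows s c -> u \in B ->
  (colour_at s (bag_index u) == nat_of_ord k) = (c u == Some k) :> bool.
Proof.
move=> [H _] uB; rewrite -H //; case: (colour_at _ _) => [|[|[|n]]]; case: k => [[|[|[|]]]] //=.
Qed.

Lemma vcode_elem u (e : 'I_N) : (vcode u == e) = (u == inl e).
Proof. by rewrite -[nat_of_ord e]/(vcode (inl e : V)) (inj_eq vcode_inj). Qed.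

Section Checks.
Variables (s : state R) (c : pcol V).
Hypotheses (vw : views s) (sh : shows s c).

Lemma has_elem (e : 'I_N) k :
  ex_pos s (elem_has s (nat_of_ord k) e) = (c (inl e) == Some k).
Proof.
have [_ bl uE _] := vw; rewrite /ex_pos bl has_bag_index.
apply/existsP/eqP => [[u /and3P[uB]]|ce].
  by rewrite uE // vcode_elem => /eqP eu; rewrite (colour_at_eq _ sh) // eu => /eqP.
have eB : inl e \in B by apply/negPn/negP => /(proj2 sh); rewrite ce.
exists (inl e); rewrite eB /elem_has uE // vcode_elem eqxx.
by rewrite (colour_at_eq _ sh) // ce eqxx.
Qed.

Lemma all_ok_at : all (ok_at s) (iota 0 N) = consistent grp c.
Proof.
have [n0 bl uE iE] := vw.
have chosenE (e : 'I_N) : ex_pos s (chosen_group s e) =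
    [exists g : 'I_M, (c (inr g) == Some c1) && (e \in grp g)].
  rewrite /ex_pos bl has_bag_index; apply/existsP/existsP => [[u /and4P[uB]]|[g /andP[/eqP cg eg]]].
    rewrite uE // n0; case: u uB => [e'|g] uB /=; first by rewrite leqNgt ltn_ord.
    move=> _; rewrite iE => eg; rewrite (colour_at_eq c1 sh) // => cg.
    by exists g; rewrite cg.
  have gB : inr g \in B by apply/negPn/negP => /(proj2 sh); rewrite cg.
  exists (inr g); rewrite gB /chosen_group uE //= n0 leq_addr iE eg /=.
  by rewrite (colour_at_eq c1 sh) // cg.
apply/allP/consistentP => [H g e cg eg|H e].
  have := H e; rewrite mem_iota ltn_ord /ok_at chosenE (has_elem e c1) => /(_ isT).
  move/implyP=> He; apply/eqP/He; apply/existsP; exists g.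
  by rewrite cg eqxx.
rewrite mem_iota add0n => /= eN; rewrite /ok_at.
rewrite (chosenE (Ordinal eN)) (has_elem (Ordinal eN) c1).
by apply/implyP => /existsP[g /andP[/eqP cg eg]]; apply/eqP/(H g).
Qed.

Lemma sum_corr_at (x_ : 'rV[R]_N) :
  (forall e : 'I_N, rmem s rSignal e = (x_ 0%R e)%:E) ->
  (\sum_(0 <= e < N | corr_at s e) (rmem s rSignal e * rmem s rSignal e))%E =
  (join_correction grp x_ B c)%:E.
Proof.
move=> xE; have [n0 bl uE iE] := vw.
rewrite big_mkord /join_correction /wset -sumEFin; apply: eq_big => [e|e _].
  rewrite /corr_at (has_elem e c0) !inE andbC; congr (_ && _).
  rewrite /ex_pos bl has_bag_index; apply/existsP/orP => [[u /andP[uB]]|].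
    rewrite /in_scope uE // n0 vcode_elem => /orP[/eqP <-|]; first by left.
    case: u uB => [e'|g] uB /=; first by rewrite leqNgt ltn_ord.
    by rewrite iE => /andP[_ eg]; right; apply/bigcupP; exists g.
  case=> [eB|/bigcupP[g gB eg]].
    by exists (inl e); rewrite eB /in_scope uE // vcode_elem eqxx.
  by exists (inr g); rewrite gB /in_scope uE //= n0 leq_addr iE eg orbT.
by rewrite xE /weight GRing.expr2.
Qed.

Lemma has_chosen_nbh (g : 'I_M) :
  has (fun j => [&& colour_at s j == 1, vertex_at s j < imem s 0 0 & incident s (N + g) (vertex_at s j)])
    (iota 0 (bag_len s)) = (fiber c c1 :&: Gamma (inr g) != set0).
Proof.
have [n0 bl uE iE] := vw; rewrite bl has_bag_index n0.
apply/existsP/set0Pn => [[u /and4P[uB]]|[u]].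
  rewrite (colour_at_eq c1 sh) // uE // => cu.
  case: u uB cu => [e|g'] uB cu /=; last by rewrite ltnNge leq_addr.
  by rewrite iE => _ eg; exists (inl e); rewrite !inE cu.
rewrite !inE => /andP[cu]; case: u cu => [e|//] cu /= eg.
have eB : inl e \in B by apply/negPn/negP => /(proj2 sh); rewrite (eqP cu).
by exists (inl e); rewrite eB (colour_at_eq c1 sh) // cu uE //= ltn_ord iE eg.
Qed.

End Checks.

Lemma positional_sum b (d : nat -> nat) n :
  positional b [seq d j | j <- iota 0 n] = \sum_(j < n) d j * b ^ j.
Proof.
elim: n d => [|n IH] d; first by rewrite big_ord0.
rewrite big_ord_recl /= muln1; congr (_ + _).
rewrite -[iota 1 n]/(iota (1 + 0) n) iotaDl -map_comp IH big_distrr /=.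
by apply: eq_bigr => j _; rewrite expnS mulnCA.
Qed.

Lemma ccode_positional c :
  ccode B c = positional 3 [seq digit (c u) | u <- enum B].
Proof.
rewrite /ccode.
have [u0 uB|B0] := pickP (mem B); last first.
  have -> : enum B = [::] by apply: size0nil; rewrite -cardE; apply: eq_card0.
  rewrite big1 // => j _; have := ltn_ord j; rewrite [X in _ < X]eq_card0 //.
rewrite (eq_bigr (fun j : 'I_#|B| => digit (c (nth u0 (enum B) j)) * 3 ^ j)).
  rewrite -(positional_sum _ (fun j => digit (c (nth u0 (enum B) j)))).
  congr (positional _); rewrite -[in RHS](mkseq_nth u0 (enum B)) -map_comp -cardE.
  by apply: eq_map.
by move=> j _; rewrite (enum_val_nth u0).
Qed.

End Bridge.

(** The bag B' of a child or parent may lack a vertex of B.  Enumerations of sets are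
    filtered from one enumeration of all vertices, so skipping that vertex yields
    the code with respect to B'. *)
Lemma fill_code_ccode (N M : nat) (B B' : {set vertex N M}) (c : pcol _) g G :
  B' \subset B -> colouring B' c ->
  (forall u, u \in B -> colour_of (g (bag_index B u)) = c u) ->
  fill_code #|B| G g = G.+1 * ccode B' c.
Proof.
move=> sub /forallP col gc; congr (_ * _); rewrite ccode_positional.
rewrite filter_map -map_bag_index filter_map -map_comp.
have -> : enum B' = [seq u <- enum B | u \in B'].
  rewrite {2}/enum_mem -filter_predI; apply: eq_filter => u /=.
  by rewrite andb_idr //; apply: (subsetP sub).
have -> : [seq u <- enum B | preim (bag_index B) (preim g (fun x => x < 3)) u] =
          [seq u <- enum B | u \in B'].
  apply: eq_in_filter => u; rewrite mem_enum /= => uB.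
  by rewrite -isSome_colour_of gc // (eqP (col u)).
congr (positional 3 _); apply/eq_in_map => u; rewrite mem_filter mem_enum /= => /andP[uB' uB].
rewrite -gc // digit_colour_of // -isSome_colour_of gc //.
by rewrite (eqP (col u)).
Qed.

(** * The contributions of digit vectors *)

Lemma bigmaxe_leP (R : realType) (I : finType) (P : pred I) (F : I -> \bar R) z :
  (\big[maxe/-oo]_(i | P i) F i <= z)%E <-> (forall i, P i -> (F i <= z)%E).
Proof.
split=> [H i Pi|H]; first by apply: le_trans H; apply: le_bigmax_cond.
by apply/bigmax_leP; split=> //; apply: leNye.
Qed.

(** The digits 0 to 4 in a join are the five colour triples; in other nodes the
    superfluous digits are mapped to colour 0. *)
Definition clamp d := if d <= 2 then d else 0.
Definition is_one d := if d == 1 then 1 else 0.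
Definition join0 d := if d == 0 then 0 else if d <= 3 then 1 else 2.
Definition join1 d := if d == 0 then 0 else if d <= 2 then 1 else 2.
Definition join2 d := if d == 0 then 0 else if d == 1 then 1 else if d == 3 then 1 else 2.
Definition join_digit d1 d2 :=
  if d1 == 0 then 0 else if d1 == 1 then (if d2 == 1 then 1 else 2)
  else if d2 == 1 then 3 else 4.

Lemma clamp_lt3 d : clamp d < 3.
Proof. by rewrite /clamp; case: ifP. Qed.
Lemma is_one_lt3 d : is_one d < 3.
Proof. by rewrite /is_one; case: ifP. Qed.
Lemma join1_lt3 d : join1 d < 3.
Proof. by rewrite /join1; do ![case: ifP => //]. Qed.
Lemma join2_lt3 d : join2 d < 3.
Proof. by rewrite /join2; do ![case: ifP => //]. Qed.

Section Contributions.
Variables (R : realType) (N M : nat) (grp : 'I_M -> {set 'I_N}) (G : nat).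
Variables (x_ : 'rV[R]_N) (t : nat) (root : 'I_t) (par : 'I_t -> 'I_t).
Variables (bag : 'I_t -> {set vertex N M}).
Variable (ty : 'I_t -> node_type (vertex N M) 'I_t).
Local Notation V := (vertex N M).
Local Notation Gamma := (nbh (incidence grp)).
Implicit Types (x y : 'I_t) (c : pcol V) (u v : V) (dl : nat -> nat).

(** Digit vectors range over the larger of the bags of x and its children, so that
    all colourings involved can be read off. *)
Definition big_bag x := match ty x with Forget _ y => bag y | _ => bag x end.

(** The digit that selects the case of the recursion; 0 is a placeholder. *)
Definition special x dl := match ty x with
  | Introduce v _ | Forget v _ => dl (bag_index (big_bag x) v)
  | _ => 0 end.

Definition dec1 x u d := match ty x with
  | Join _ _ => join1 d
  | Introduce v _ => if u == v then 3 else clamp d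
  | Forget v _ => if u == v then is_one d else clamp d
  | Leaf => 0 end.

(** In the node that introduces a group g with colour 1, the elements of g that had
    the colour 1? in the child get colour 1; dv is the digit of g. *)
Definition dec0 x dv u d := match ty x with
  | Join _ _ => join0 d
  | Introduce (inl e) _ => clamp d
  | Introduce (inr g) _ => if u == inr g then is_one d
      else if [&& dv == 1, d == 2 & u \in Gamma (inr g)] then 1 else clamp d
  | Forget v _ => if u == v then 3 else clamp d
  | Leaf => 0 end.

Definition pcol_of (B : {set V}) (f : V -> nat) : pcol V :=
  [ffun u => if u \in B then colour_of (f u) else None].

Definition colour1 x dl :=
  pcol_of (big_bag x) (fun u => dec1 x u (dl (bag_index (big_bag x) u))).
Definition colour2 x dl :=
  pcol_of (big_bag x) (fun u => join2 (dl (bag_index (big_bag x) u))).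
Definition colour0 x dl :=
  pcol_of (big_bag x) (fun u => dec0 x (special x dl) u (dl (bag_index (big_bag x) u))).

(** The terms of the maximum that the digit vector dl stands for.  Inconsistent
    colourings of the children are let in: their value -oo leaves the maximum
    unchanged. *)
Definition contrib (f : dp_table R N M 'I_t) x dl c i (val : \bar R) : Prop :=
  [/\ c = colour0 x dl, consistent grp c &
  match ty x with
  | Leaf => False
  | Introduce (inl e) y =>
      (c (inl e) = Some c1 -> 0 < i) /\
      val = (f y i (colour1 x dl) +
             (if c (inl e) == Some c0 then 0 else (weight x_ e)%:E))%E
  | Introduce (inr g) y =>
      if c (inr g) == Some c1 then
        [/\ fiber c c1 :&: Gamma (inr g) != set0, 0 < i
          & val = (f y i.-1 (colour1 x dl) + 0)%E]
      else val = (f y i (colour1 x dl) + 0)%E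
  | Forget v y => val = (f y i (colour1 x dl) + 0)%E
  | Join y z => exists i1 i2, [/\ i1 <= G, i2 <= G,
      i1 + i2 = i + #|fiber (colour1 x dl) c1 :&: fiber (colour2 x dl) c1
                       :&: groups N M|
      & val = (f y i1 (colour1 x dl) +
               (f z i2 (colour2 x dl) - (join_correction grp x_ (bag x) c)%:E))%E]
  end].

Lemma digits_of (B : {set V}) (d : V -> nat) :
  (forall u, u \in B -> d u < 5) ->
  exists2 dl, (forall u, u \in B -> dl (bag_index B u) = d u) & forall j, dl j < 5.
Proof.
move=> d5; exists (fun j => nth 0 [seq d u | u <- enum B] j) => [u uB|j].
  by rewrite (nth_map u) ?nth_index ?index_mem ?mem_enum.
have [jB|jB] := ltnP j #|B|; last first.
  by rewrite nth_default // size_map -cardE.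
have /card_gt0P [u0 _] : 0 < #|B| by apply: leq_ltn_trans jB.
rewrite (nth_map u0) -?cardE // d5 // -mem_enum mem_nth // -cardE //.
Qed.

Lemma colouring_in B c u : colouring B c -> (u \in B) = isSome (c u).
Proof. by move=> /forallP/(_ u)/eqP ->. Qed.

Lemma colouring_ex B c u : colouring B c -> u \in B -> exists k, c u = Some k.
Proof. by move=> /colouring_in ->; case: (c u) => // k _; exists k. Qed.

Lemma colouring_none B c u : colouring B c -> u \notin B -> c u = None.
Proof. by move=> /colouring_in ->; case: (c u). Qed.

Lemma colour_of_clamp k : colour_of (clamp (digit (Some k))) = Some k.
Proof. by rewrite /clamp; case: k => [[|[|[|]]] // h]; congr Some; apply: val_inj. Qed.

Lemma digit5 o : digit o < 5.
Proof. by case: o => [[[|[|[|]]]]|]. Qed.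

Lemma colourE (k : colour) : [\/ k = c0, k = c1 | k = cq].
Proof.
by case: k => [[|[|[|]]] // h]; [apply: Or31|apply: Or32|apply: Or33];
  apply: val_inj.
Qed.

Section Node.
Variable x : 'I_t.
Hypothesis nice : nice_node root par bag ty x.
Variable f : dp_table R N M 'I_t.
Hypothesis f_cons : forall y i c, ~~ consistent grp c -> f y i c = -oo%E.

Definition contribs_below c i z : Prop :=
  forall dl val, (forall j, dl j < 5) -> contrib f x dl c i val -> (val <= z)%E.

Lemma contribs_introduce_elem e y c i z :
  ty x = Introduce (inl e) y -> colouring (bag x) c -> consistent grp c ->
  contribs_below c i z <-> (dp_step grp G x_ bag ty f x i c <= z)%E.
Proof.
move=> tx cc cons; move: nice; rewrite /nice_node tx => -[_ vy bx].
have bB : big_bag x = bag x by rewrite /big_bag tx.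
have r1 dl : colour1 x dl = restrict (bag y) (colour0 x dl).
  apply/ffunP => u; rewrite !ffunE bB /dec1 /dec0 tx bx in_setU1.
  by case: eqP => [->|_] /=; rewrite ?(negPf vy) //; case: ifP.
have [dl dlE dl5] := digits_of (B := bag x) (fun u _ => digit5 (c u)).
have c0E : c = colour0 x dl.
  apply/ffunP => u; rewrite ffunE bB /dec0 tx; case: ifP => [ux|/negbT ux].
    by rewrite dlE //; have [k ->] := colouring_ex cc ux; rewrite colour_of_clamp.
  exact: colouring_none cc ux.
rewrite /dp_step cons tx /=.
set w := (if c (inl e) == Some c0 then 0 else (weight x_ e)%:E)%E.
have -> : contribs_below c i z <->
    ((c (inl e) = Some c1 -> 0 < i) -> (f y i (restrict (bag y) c) + w <= z)%E).
  rewrite /contribs_below /contrib tx; split=> [H Hi|H dl' val _ [e1 _ [Hi ->]]].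
    by apply: (H dl) => //; rewrite r1 -c0E.
  by rewrite r1 -e1; apply: H.
have [k ck] : exists k, c (inl e) = Some k.
  by apply: colouring_ex cc _; rewrite bx setU11.
rewrite /w ck; case: (colourE k) => -> //=.
- by rewrite adde0; split=> [|H _ //]; apply; move/(congr1 digit).
- case: ltnP => i0; first by split=> [|H _ //]; apply.
  by rewrite leNye; split=> // _ /(_ erefl).
by split=> [|H _ //]; apply; move/(congr1 digit).
Qed.

Lemma contribs_forget v y c i z :
  ty x = Forget v y -> colouring (bag x) c -> consistent grp c ->
  contribs_below c i z <-> (dp_step grp G x_ bag ty f x i c <= z)%E.
Proof.
move=> tx cc cons; move: nice; rewrite /nice_node tx => -[_ vx bx].
have bB : big_bag x = bag y by rewrite /big_bag tx.
rewrite /dp_step cons tx /= bigmaxe_leP.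
rewrite /contribs_below /contrib tx; split=> [H c'|H dl val dl5 [cE _ ->]].
  case/and3P => cc' /eqP cE nq.
  have [dl dlE dl5] := digits_of (B := bag y) (fun u _ => digit5 (c' u)).
  have c1E : colour1 x dl = c'.
    apply/ffunP => u; rewrite ffunE bB /dec1 tx; case: ifP => [uy|/negbT uy].
      rewrite dlE //; have [k ck] := colouring_ex cc' uy.
      case: eqP => [uv|_]; last by rewrite ck colour_of_clamp.
      by move: nq; rewrite -uv ck; case: (colourE k) => ->.
    by rewrite (colouring_none cc' uy).
  apply: (H dl) => //; rewrite c1E; split=> //; last by rewrite adde0.
  have uyE u : (u \in bag y) = (u == v) || (u \in bag x) by rewrite bx in_setU1.
  apply/ffunP => u; rewrite cE !ffunE bB /dec0 tx uyE.
  case: eqP => [->|_] /=; first by rewrite (negPf vx).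
  case: ifP => // ux; have uy : u \in bag y by rewrite uyE ux orbT.
  by rewrite dlE //; have [k ->] := colouring_ex cc' uy; rewrite colour_of_clamp.
rewrite adde0; apply: H; apply/and3P; split.
- apply/forallP => u; rewrite ffunE bB /dec1 tx; case: ifP => // _.
  by rewrite isSome_colour_of; case: ifP => _; rewrite ?is_one_lt3 ?clamp_lt3.
- apply/eqP/ffunP => u; rewrite cE !ffunE bB /dec0 /dec1 tx bx in_setU1.
  by case: eqP => [->|_] /=; rewrite ?(negPf vx) //; case: ifP.
by rewrite ffunE bB bx setU11 /dec1 tx eqxx /is_one; case: ifP.
Qed.

(** Digits are recovered from (c', c'') vertex by vertex with [join_digit]. *)
Lemma contribs_join y z' c i z :
  ty x = Join V y z' -> colouring (bag x) c -> consistent grp c -> i <= G ->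
  contribs_below c i z <-> (dp_step grp G x_ bag ty f x i c <= z)%E.
Proof.
move=> tx cc cons iG; have bB : big_bag x = bag x by rewrite /big_bag tx.
rewrite /dp_step cons tx /= bigmaxe_leP.
rewrite /contribs_below /contrib tx; split=> [H c' /andP[cc' cons']|].
  rewrite bigmaxe_leP => c'' /and5P[cc'' cons'' /eqP f0' /eqP f0'' /eqP f1].
  rewrite bigmaxe_leP => i1 _; rewrite bigmaxe_leP => i2 /eqP i12.
  rewrite -addeA.
  have d5 u : u \in bag x -> join_digit (digit (c' u)) (digit (c'' u)) < 5.
    by rewrite /join_digit; do ![case: ifP].
  have [dl dlE dl5] := digits_of d5.
  have same0 u : (c u == Some c0) = (c' u == Some c0) /\
                 (c u == Some c0) = (c'' u == Some c0).
    by move/setP/(_ u): f0'; move/setP/(_ u): f0''; rewrite !inE.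
  have same1 u : (c u == Some c1) = (c' u == Some c1) || (c'' u == Some c1).
    by move/setP/(_ u): f1; rewrite !inE.
  have c1E : colour1 x dl = c'.
    apply/ffunP => u; rewrite ffunE bB /dec1 tx; case: ifP => [ux|/negbT ux].
      rewrite dlE //; have [k' ck'] := colouring_ex cc' ux.
      have [k'' ck''] := colouring_ex cc'' ux; have [] := same0 u.
      rewrite ck' ck'' => -> /eqP.
      by case: (colourE k') => ->; case: (colourE k'') => ->.
    by rewrite (colouring_none cc' ux).
  have c2E : colour2 x dl = c''.
    apply/ffunP => u; rewrite ffunE bB; case: ifP => [ux|/negbT ux].
      rewrite dlE //; have [k' ck'] := colouring_ex cc' ux.
      have [k'' ck''] := colouring_ex cc'' ux; have [] := same0 u.
      rewrite ck' ck'' => -> /eqP.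
      by case: (colourE k') => ->; case: (colourE k'') => ->.
    by rewrite (colouring_none cc'' ux).
  apply: (H dl) => //; rewrite c1E c2E; split=> //; last first.
    by exists i1, i2; split=> //; rewrite -ltnS ltn_ord.
  apply/ffunP => u; rewrite ffunE bB /dec0 tx; case: ifP => [ux|/negbT ux].
    rewrite dlE //; have [k' ck'] := colouring_ex cc' ux.
    have [k'' ck''] := colouring_ex cc'' ux; have [] := same0 u.
    have [k ck] := colouring_ex cc ux; have := same1 u.
    rewrite ck' ck'' ck => e1 e2 e3; move: e1 e2 e3.
    by case: (colourE k) => ->; case: (colourE k') => ->; case: (colourE k'') => ->.
  by rewrite (colouring_none cc ux).
move=> H dl val dl5 [cE _ [i1 [i2 [i1G i2G i12 ->]]]].
have cc1 : colouring (bag x) (colour1 x dl).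
  apply/forallP => u; rewrite ffunE bB /dec1 tx; case: ifP => // _.
  by rewrite isSome_colour_of join1_lt3.
have cc2 : colouring (bag x) (colour2 x dl).
  apply/forallP => u; rewrite ffunE bB; case: ifP => // _.
  by rewrite isSome_colour_of join2_lt3.
have [cons1|/f_cons ->] := boolP (consistent grp (colour1 x dl)); last first.
  by rewrite addNye leNye.
have [cons2|/f_cons ->] := boolP (consistent grp (colour2 x dl)); last first.
  by rewrite addNye addeNy leNye.
have := H (colour1 x dl); rewrite cc1 cons1 => /(_ isT).
rewrite bigmaxe_leP => /(_ (colour2 x dl)); rewrite cc2 cons2 /=.
have dig u : u \in bag x -> exists2 d, d < 5 &
    [/\ c u = colour_of (join0 d), colour1 x dl u = colour_of (join1 d) &
        colour2 x dl u = colour_of (join2 d)].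
  move=> ux; exists (dl (bag_index (bag x) u)) => //.
  by rewrite {1}cE !ffunE bB /dec1 /dec0 tx ux.
have dig' u : u \notin bag x ->
    [/\ c u = None, colour1 x dl u = None & colour2 x dl u = None].
  by move=> ux; rewrite (colouring_none cc) // (colouring_none cc1) //
    (colouring_none cc2).
have -> : fiber c c0 == fiber (colour1 x dl) c0.
  apply/eqP/setP => u; rewrite !inE; case: (boolP (u \in bag x)) => ux.
    by have [[|[|[|[|[|d]]]]] // _ [-> -> _]] := dig u ux.
  by have [-> -> _] := dig' u ux.
have -> : fiber c c0 == fiber (colour2 x dl) c0.
  apply/eqP/setP => u; rewrite !inE; case: (boolP (u \in bag x)) => ux.
    by have [[|[|[|[|[|d]]]]] // _ [-> _ ->]] := dig u ux.
  by have [-> _ ->] := dig' u ux.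
have -> : fiber c c1 == fiber (colour1 x dl) c1 :|: fiber (colour2 x dl) c1.
  apply/eqP/setP => u; rewrite !inE; case: (boolP (u \in bag x)) => ux.
    by have [[|[|[|[|[|d]]]]] // _ [-> -> ->]] := dig u ux.
  by have [-> -> ->] := dig' u ux.
move=> /(_ isT); rewrite bigmaxe_leP => /(_ (Ordinal (i1G : i1 < G.+1)) isT).
rewrite bigmaxe_leP => /(_ (Ordinal (i2G : i2 < G.+1))) /=.
by rewrite i12 eqxx -addeA; apply.
Qed.

(** A group of colour 0 changes nothing in the child.  For a group of colour 1 the
    colouring c' ranges over the colourings compatible with c, and each of
    them is the decoding of its own digits. *)
Lemma contribs_introduce_group g y c i z :
  ty x = Introduce (inr g) y -> colouring (bag x) c -> consistent grp c ->
  contribs_below c i z <-> (dp_step grp G x_ bag ty f x i c <= z)%E.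
Proof.
move=> tx cc cons; move: nice; rewrite /nice_node tx => -[_ vy bx].
have bB : big_bag x = bag x by rewrite /big_bag tx.
have vx : inr g \in bag x by rewrite bx setU11.
have [k ck] := colouring_ex cc vx.
have cE dl : c = colour0 x dl -> Some k = colour_of (is_one (special x dl)).
  by move=> ce; rewrite -ck {1}ce ffunE bB vx /dec0 tx eqxx /special tx bB.
rewrite /dp_step cons tx /= /contribs_below /contrib tx ck.
case: (colourE k) ck cE => -> ck cE /=.
- have r1 dl : special x dl != 1 -> colour1 x dl = restrict (bag y) (colour0 x dl).
    move=> s1; apply/ffunP => u; rewrite !ffunE bB /dec1 /dec0 tx bx in_setU1.
    by rewrite (negPf s1); case: eqP => [->|_] /=; rewrite ?(negPf vy) //; case: ifP.
  split=> [H|H dl val dl5 [ce _ ->]].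
    have [dl dlE dl5] := digits_of (B := bag x) (fun u _ => digit5 (c u)).
    have s0 : special x dl = 0 by rewrite /special tx bB dlE // ck.
    have ce : c = colour0 x dl.
      apply/ffunP => u; rewrite ffunE bB /dec0 tx s0 /=.
      case: ifP => [ux|/negbT ux]; last exact: colouring_none cc ux.
      rewrite dlE //; case: eqP => [->|_]; first by rewrite ck.
      by have [k' ->] := colouring_ex cc ux; rewrite colour_of_clamp.
    by apply: (H dl) => //; rewrite r1 ?s0 // -ce adde0.
  rewrite adde0 r1 -?ce //; apply/negP => /eqP s1.
  by have := cE dl ce; rewrite s1.
- split=> [H|].
    case: ifP => [/andP[ne i0]|_]; last exact: leNye.
    rewrite bigmaxe_leP => c' /and4P[cc' cons' /eqP f0 /eqP f1].
    pose d u := if u == inr g then 1 else digit (c' u).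
    have d5 u : u \in bag x -> d u < 5.
      by rewrite /d; case: eqP => // _; rewrite digit5.
    have [dl dlE dl5] := digits_of d5.
    have s1 : special x dl = 1 by rewrite /special tx bB dlE // /d eqxx.
    have c1E : colour1 x dl = c'.
      apply/ffunP => u; rewrite ffunE bB /dec1 tx.
      case: ifP => [ux|/negbT ux].
        rewrite dlE // /d; case: eqP => [->|/eqP nu].
          by rewrite (colouring_none cc' vy).
        have uy : u \in bag y by move: ux; rewrite bx in_setU1 (negPf nu).
        by have [k' ->] := colouring_ex cc' uy; rewrite colour_of_clamp.
      by rewrite (colouring_none cc') //; move: ux; rewrite bx in_setU1 => /norP[].
    apply: (H dl) => //; rewrite c1E; split=> //; last by rewrite adde0.
    apply/ffunP => u; rewrite ffunE bB /dec0 tx s1.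
    case: ifP => [ux|/negbT ux]; last by rewrite (colouring_none cc).
    rewrite dlE // /d; case: eqP => [->|/eqP nu]; first by rewrite ck.
    have uy : u \in bag y by move: ux; rewrite bx in_setU1 (negPf nu).
    have [k' ck'] := colouring_ex cc' uy; have [k'' ck''] := colouring_ex cc ux.
    move/setP/(_ u): f0; move/setP/(_ u): f1; rewrite !inE uy andbT ck' ck''.
    by case: (incidence grp (inr g) u); have [->|->|->] := colourE k'; have [->|->|->] := colourE k''.
  move=> H dl val dl5 [ce _ [ne i0 ->]]; move: H; rewrite ne i0 adde0 /=.
  rewrite bigmaxe_leP => H.
  have [cons1|/f_cons ->] := boolP (consistent grp (colour1 x dl)); last exact: leNye.
  have s1 : special x dl = 1.
    by have := cE dl ce; rewrite /is_one; case: eqP.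
  have out u : u \notin bag y -> colour1 x dl u = None.
    move=> uy; rewrite ffunE bB bx in_setU1 (negPf uy) orbF /dec1 tx.
    by case: eqP.
  have inside u : u \in bag y -> colour1 x dl u = colour_of (clamp (dl (bag_index (bag x) u))) /\
     c u = colour_of (if (dl (bag_index (bag x) u) == 2) && (u \in Gamma (inr g)) then 1
                   else clamp (dl (bag_index (bag x) u))).
    move=> uy; have nu : (u == inr g) = false by apply: contraNF vy => /eqP <-.
    by rewrite {1}ce !ffunE bB bx in_setU1 uy orbT /dec1 /dec0 tx s1 nu.
  apply: H; apply/and4P; split=> //.
  + apply/forallP => u; have [uy|uy] := boolP (u \in bag y).
      by have [-> _] := inside u uy; rewrite isSome_colour_of clamp_lt3.
    by rewrite out.
  + apply/eqP/setP => u; rewrite !inE; have [uy|uy] := boolP (u \in bag y).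
      have [-> ->] := inside u uy; case: ifP => // /andP[/eqP -> _] //.
    rewrite out //; have [->|nu] := eqVneq u (inr g); first by rewrite ck.
    by rewrite (colouring_none cc) // bx in_setU1 negb_or nu.
  apply/eqP/setP => u; rewrite !inE; have [uy|uy] := boolP (u \in bag y).
    have [-> ->] := inside u uy; rewrite andbT [u \in nbh _ _]inE.
    case: (incidence grp (inr g) u); have := dl5 (bag_index (bag x) u);
      by case: (dl _) => [|[|[|[|[|]]]]].
  by rewrite out ?andbF.
rewrite leNye; split=> // _ dl val _ [ce]; have := cE dl ce.
by rewrite /is_one; case: ifP.
Qed.

(** The digit vectors list exactly the terms of the recursion, up to terms -oo:
    this is where the bound 5 ^ b on the number of combinations comes from. *)
Lemma contribs_dp_step c i z :
  ty x <> Leaf -> colouring (bag x) c -> i <= G ->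
  contribs_below c i z <-> (dp_step grp G x_ bag ty f x i c <= z)%E.
Proof.
move=> nl cc iG; have [cons|incons] := boolP (consistent grp c); last first.
  rewrite /dp_step incons leNye; split=> // _ dl val _ [_ cons].
  by rewrite cons in incons.
case tx: (ty x) nl => [|[e|g] y|v y|y z'] // _.
- exact: contribs_introduce_elem tx cc cons.
- exact: contribs_introduce_group tx cc cons.
- exact: contribs_forget tx cc cons.
exact: contribs_join tx cc cons iG.
Qed.

End Node.

Lemma colour1_colouring x y dl : nice_node root par bag ty x ->
  (exists v, ty x = Introduce v y) \/ (exists v, ty x = Forget v y) \/
  (exists z, ty x = Join V y z) ->
  y \in children root par x /\ colouring (bag y) (colour1 x dl).
Proof.
move=> + tx; rewrite /nice_node; case: tx => [[v tx]|[[v tx]|[z tx]]]; rewrite tx.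
- move=> [-> vy bx]; rewrite set11; split=> //.
  apply/forallP => u; rewrite ffunE /dec1 tx {1}/big_bag tx bx in_setU1.
  case: (u =P v) => [->|_] /=; first by rewrite (negPf vy).
  by case: ifP; rewrite ?isSome_colour_of ?clamp_lt3.
- move=> [-> vx byE]; rewrite set11; split=> //.
  apply/forallP => u; rewrite ffunE /dec1 tx {1}/big_bag tx.
  by case: ifP => // _; rewrite isSome_colour_of; case: ifP; rewrite ?is_one_lt3 ?clamp_lt3.
move=> [_ -> bxy bxz]; rewrite set21; split=> //.
apply/forallP => u; rewrite ffunE /dec1 tx {1}/big_bag tx -bxy.
by case: ifP; rewrite ?isSome_colour_of ?join1_lt3.
Qed.

Lemma colour2_colouring x y z dl : nice_node root par bag ty x -> ty x = Join V y z ->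
  z \in children root par x /\ colouring (bag z) (colour2 x dl).
Proof.
rewrite /nice_node => + tx; rewrite tx => -[_ -> bxy bxz]; rewrite set22; split=> //.
apply/forallP => u; rewrite ffunE {1}/big_bag tx -bxz.
by case: ifP; rewrite ?isSome_colour_of ?join2_lt3.
Qed.

End Contributions.

(** * One digit vector in one node *)

Definition one_c := CIf (Eqb (Var vDigit) (Cst 1)) (CE (Cst 1)) (CE (Cst 0)).
Definition clamp_c := CIf (ILe (Var vDigit) (Cst 2)) (CE (Var vDigit)) (CE (Cst 0)).
Definition ty_is k := Eqb (Var vKind) (Cst k).

Definition dec1_c :=
  CIf (ty_is 3)
    (CIf (Eqb (Var vDigit) (Cst 0)) (CE (Cst 0))
      (CIf (ILe (Var vDigit) (Cst 2)) (CE (Cst 1)) (CE (Cst 2))))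
    (CIf (Eqb (Var vCurVertex) (Var vVertex))
      (CIf (ty_is 2) one_c (CE (Cst 3)))
      clamp_c).

Definition dec2_c :=
  CIf (Eqb (Var vDigit) (Cst 0)) (CE (Cst 0))
    (CIf (Eqb (Var vDigit) (Cst 1)) (CE (Cst 1))
      (CIf (Eqb (Var vDigit) (Cst 3)) (CE (Cst 1)) (CE (Cst 2)))).

Definition dec0_c :=
  CIf (ty_is 3)
    (CIf (Eqb (Var vDigit) (Cst 0)) (CE (Cst 0))
      (CIf (ILe (Var vDigit) (Cst 3)) (CE (Cst 1)) (CE (Cst 2))))
    (CIf (Eqb (Var vCurVertex) (Var vVertex))
      (CIf (ty_is 2) (CE (Cst 3)) (CIf (is_elem (Var vVertex)) clamp_c one_c))
      (CIf (BAnd (ty_is 1) (BAnd (is_group (Var vVertex)) (BAnd (Eqb (Var vSpecial) (Cst 1))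
             (BAnd (Eqb (Var vDigit) (Cst 2))
               (BAnd (is_elem (Var vCurVertex)) (eInc (Var vVertex) (Var vCurVertex)))))))
        (CE (Cst 1)) clamp_c)).

Section Decoders.
Variable R : realType.
Implicit Types s : state R.

(** The decoders in terms of the codes of vertices and node types in memory. *)
Definition state_dec1 s u d :=
  if imem s vKind 0 == 3 then join1 d
  else if u == imem s vVertex 0 then (if imem s vKind 0 == 2 then is_one d else 3)
  else clamp d.

Definition state_dec0 s u d :=
  if imem s vKind 0 == 3 then join0 d
  else if u == imem s vVertex 0 then
    (if imem s vKind 0 == 2 then 3
     else if imem s vVertex 0 < imem s 0 0 then clamp d else is_one d)
  else if [&& imem s vKind 0 == 1, imem s 0 0 <= imem s vVertex 0, imem s vSpecial 0 == 1,
              d == 2, u < imem s 0 0 & incident s (imem s vVertex 0) u] then 1 else clamp d.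

Lemma ceval_dec1 s s' : agree fill_mods [::] s s' ->
  ceval s' dec1_c = state_dec1 s (imem s' vCurVertex 0) (imem s' vDigit 0).
Proof. by move=> A; rewrite /= -!eqn_leq; frame A. Qed.

Lemma ceval_dec2 s s' : agree fill_mods [::] s s' ->
  ceval s' dec2_c = join2 (imem s' vDigit 0).
Proof. by move=> A; rewrite /= -!eqn_leq; frame A. Qed.

Lemma ceval_dec0 s s' : agree fill_mods [::] s s' ->
  ceval s' dec0_c = state_dec0 s (imem s' vCurVertex 0) (imem s' vDigit 0).
Proof. by move=> A; rewrite /= -!eqn_leq !addn1; frame A. Qed.

End Decoders.

(** The parameters of the relaxation.  An introduced element of colour 1 is allowed
    only for positive counters; an introduced group of colour 1 raises the counter
    by one and must have a neighbour of colour 1. *)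
Definition registers_cmd : cmd :=
  put vDown (CIf (ty_is 3) (CE (Var vShared)) (CE (Cst 0))) ;;
  put vLow (CIf (BAnd (ty_is 1) (BAnd (is_elem (Var vVertex)) (Eqb (Var vSpecial) (Cst 1))))
            (CE (Cst 1)) (CE (Cst 0))) ;;
  put vUp (CIf (BAnd (ty_is 1) (BAnd (is_group (Var vVertex)) (Eqb (Var vSpecial) (Cst 1))))
            (CE (Cst 1)) (CE (Cst 0))) ;;
  put vValid (CIf (BAnd (Eqb (Var vUp) (Cst 1)) (Eqb (Var vHasNbh) (Cst 0)))
            (CE (Cst 0)) (CE (Var vValid))) ;;
  If (BAnd (ty_is 1) (BAnd (is_elem (Var vVertex))
        (BAnd (ILe (Cst 1) (Var vSpecial)) (ILe (Var vSpecial) (Cst 2)))))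
    (RSet rGain (Cst 0) (RMul (RGet rSignal (Var vVertex)) (RGet rSignal (Var vVertex))))
    (RSet rGain (Cst 0) RZero).

Lemma registers_cmdP (R : realType) (s : state R)
    (intro := imem s vKind 0 == 1) (n := imem s 0 0) (v := imem s vVertex 0)
    (dv := imem s vSpecial 0) (up := [&& intro, n <= v & dv == 1]) :
  run registers_cmd s (fun s' =>
    [/\ imem s' vDown 0 = (if imem s vKind 0 == 3 then imem s vShared 0 else 0),
        imem s' vLow 0 = [&& intro, v < n & dv == 1],
        imem s' vUp 0 = up,
        imem s' vValid 0 = (if up && (imem s vHasNbh 0 == 0) then 0 else imem s vValid 0)
      & rmem s' rGain 0 = (if [&& intro, v < n & 0 < dv <= 2]
                          then (rmem s rSignal v * rmem s rSignal v)%E else 0%E)]) 0.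
Proof.
apply: run_put => s1 e1 A1; apply: run_put => s2 e2 A2.
apply: run_put => s3 e3 A3; apply: run_put => s4 e4 A4.
rewrite /= in e1 e2 e3 e4; move: e1 e2 e3 e4; rewrite -!eqn_leq !addn1; frames => e1 e2 e3 e4.
have iE (b : bool) : (if b then 1 else 0) = b by case: b.
have bE (b : bool) : (nat_of_bool b == 1) = b by case: b.
have up3 : imem s3 vUp 0 = up by rewrite e3 iE.
rewrite up3 bE in e4.
by apply: run_if; rewrite /= !addn1 -!eqn_leq; frames => hb; apply: run_rset;
  rewrite /= /upd /=; frames; rewrite ?hb ?(negPf hb); split=> //; frames;
  rewrite ?e1 ?e2 ?iE.
Qed.

Definition prep_cmd : cmd :=
  scan_cmd ;;
  fill_cmd dec2_c ;; SetVar vCell2 (IAdd (Var vBlock2) (Var vCode)) ;;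
  fill_cmd dec1_c ;; SetVar vCell1 (IAdd (Var vBlock1) (Var vCode)) ;;
  fill_cmd dec0_c ;; SetVar vCell0 (IAdd (Var vBlock) (Var vCode)) ;;
  flags_cmd ;; elem_cmd ;; registers_cmd.

Definition contribute_cmd : cmd :=
  When (Eqb (Var vValid) (Cst 1)) (If (ty_is 3) join_loop relax_cmd).

Section Node.
Variables (R : realType) (N M : nat) (grp : 'I_M -> {set 'I_N}) (G : nat).
Variables (x_ : 'rV[R]_N) (t : nat) (root : 'I_t) (par : 'I_t -> 'I_t).
Variables (bag : 'I_t -> {set vertex N M}).
Variable (ty : 'I_t -> node_type (vertex N M) 'I_t).
Local Notation V := (vertex N M).
Local Notation Gamma := (nbh (incidence grp)).
Implicit Types (x y : 'I_t) (c : pcol V) (u v : V) (dl : nat -> nat) (s : state R).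

Definition offset k : nat := \sum_(y < t | y < k) 3 ^ #|bag y| * G.+1.
Definition base x c : nat := offset x + G.+1 * ccode (bag x) c.

Lemma opt_cellE x i c : opt_cell G bag x i c = base x c + i.
Proof. by rewrite /opt_cell /base [G.+1 * _]mulnC. Qed.

Definition node_fields x := node_code (ty x).

(** What the loading of a node establishes and its processing preserves. *)
Record node_regs s x : Prop := NodeRegs {
  nr_views : views grp (big_bag bag ty x) s;
  nr_G : imem s 0 2 = G;
  nr_ty : imem s vKind 0 = (node_fields x).1.1.1;
  nr_v : imem s vVertex 0 = (node_fields x).1.1.2;
  nr_x : imem s vBlock 0 = offset x;
  nr_y : imem s vBlock1 0 = offset (node_fields x).1.2;
  nr_z : imem s vBlock2 0 = offset (node_fields x).2;
  nr_w : forall e : 'I_N, rmem s rSignal e = (x_ 0%R e)%:E }.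

Definition node_reads := [:: 0; 1; 7; vKind; vVertex; vBlock; vBlock1; vBlock2; vBagStart; vBagLen; aRows].

Lemma node_regs_agree I J s s' x :
  agree I J s s' -> ~~ has (mem I) node_reads -> rSignal \notin J ->
  node_regs s x -> node_regs s' x.
Proof.
move=> A /hasPn nI nJ [[n0 bl uE iE] g0 ty0 v0 x0 y0 z0 w0].
have E a j : a \in node_reads -> imem s' a j = imem s a j.
  by move=> /nI aI; apply: A.1.
split; rewrite ?(E 0) ?(E vKind) ?(E vVertex) ?(E vBlock) ?(E vBlock1) ?(E vBlock2) //.
  split; rewrite ?(E 0) /bag_len ?(E vBagLen) //.
    by move=> u uB; rewrite /vertex_at (E 7) // (E vBagStart) //; apply: uE.
  by move=> g e; rewrite /incident (E 1) // (E aRows) // (E 0) //; apply: iE.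
by move=> e; rewrite A.2 // w0.
Qed.

Section Prep.
Variable x : 'I_t.
Hypothesis nice : nice_node root par bag ty x.
Hypothesis nonleaf : ty x <> Leaf.
Local Notation B := (big_bag bag ty x).

Lemma special_in v y : ty x = Introduce v y \/ ty x = Forget v y -> v \in B.
Proof.
move=> tx; move: nice; rewrite /nice_node /big_bag.
by case: tx => -> [_ _ ->]; rewrite setU11.
Qed.

Lemma vcode_special u v : (vcode u == vcode v) = (u == v).
Proof. exact: (inj_eq (@vcode_inj N M)). Qed.

Lemma state_dec1E s u d : node_regs s x -> state_dec1 s (vcode u) d = dec1 ty x u d.
Proof.
move=> nr; rewrite /state_dec1 (nr_ty nr) (nr_v nr) /dec1 /node_fields.
by case: (ty x) nonleaf => [|v y|v y|y z] //= _; rewrite vcode_special.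
Qed.

Lemma state_dec0E s u dv d : node_regs s x ->
  (forall g y, ty x = Introduce (inr g) y -> imem s vSpecial 0 = dv) ->
  state_dec0 s (vcode u) d = dec0 grp ty x dv u d.
Proof.
move=> nr; rewrite /state_dec0 (nr_ty nr) (nr_v nr) /dec0 /node_fields.
have [n0 _ _ iE] := nr_views nr; rewrite n0.
case: (ty x) nonleaf => [|[e|g] y|v y|y z] //= _ dvE.
- by rewrite ltn_ord [N <= e]leqNgt ltn_ord; case: ifP.
- rewrite -[N + g]/(vcode (inr g : V)) vcode_special /= ltnNge leq_addr /=.
  case: eqP => //= nu; rewrite (dvE g y) // inE.
  case: u nu => [e|g'] _ /=; last by rewrite ltnNge leq_addr !andbF.
  by rewrite ltn_ord iE.
by rewrite vcode_special.
Qed.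

Definition up_of dl := if ty x is Introduce (inr _) _ then nat_of_bool (special bag ty x dl == 1) else 0.
Definition lo_of dl := if ty x is Introduce (inl _) _ then nat_of_bool (special bag ty x dl == 1) else 0.
Definition dn_of dl := if ty x is Join _ _ then
  #|fiber (colour1 bag ty x dl) c1 :&: fiber (colour2 bag ty x dl) c1 :&: groups N M|
  else 0.
Definition ok_of dl :=
  consistent grp (colour0 grp bag ty x dl) &&
  (if ty x is Introduce (inr g) _ then
     (special bag ty x dl == 1) ==>
     (fiber (colour0 grp bag ty x dl) c1 :&: Gamma (inr g) != set0)
   else true).
Definition add_of dl : \bar R :=
  if ty x is Introduce (inl e) _ then
    if (0 < special bag ty x dl <= 2) then (weight x_ e)%:E else 0%E
  else 0%E.

Lemma colour0_colouring dl : colouring (bag x) (colour0 grp bag ty x dl).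
Proof.
have lt3 u d : dec0 grp ty x (special bag ty x dl) u d < 3 \/
  exists v y, ty x = Forget v y /\ u = v.
  rewrite /dec0; case: (ty x) nonleaf => [|[e|g] y|v y|y z] // _.
  - by left; apply: clamp_lt3.
  - by left; do ![case: ifP => // _]; rewrite ?is_one_lt3 ?clamp_lt3.
  - by case: eqP => [->|_]; [right; exists v, y|left; apply: clamp_lt3].
  by left; rewrite /join0; do ![case: ifP => // _].
apply/forallP => u; rewrite ffunE; apply/eqP.
have [[v [y tx]]|nf] : (exists v y, ty x = Forget v y) \/
    (big_bag bag ty x = bag x /\ forall v y, ty x <> Forget v y).
  by rewrite /big_bag; case: (ty x) => [|v y|v y|y z]; [right|right|left; exists v, y|right].
  have := nice; rewrite /nice_node tx => -[_ vx by_].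
  rewrite {1}/big_bag tx by_ in_setU1 /dec0 tx.
  case: eqP => [->|_] /=; first by rewrite (negPf vx).
  by case: ifP => // _; rewrite isSome_colour_of clamp_lt3.
case: nf => bB nf; rewrite {1}bB; case: ifP => // ux.
rewrite isSome_colour_of.
by have [//|[v [y [tx]]]] := lt3 u (dl (bag_index (big_bag bag ty x) u)); have := nf _ _ tx.
Qed.

Lemma sub_big : bag x \subset B.
Proof.
move: nice; rewrite /nice_node /big_bag; case: (ty x) => // v y [_ _ ->].
exact: subsetUr.
Qed.

Definition y_base dl := match ty x with
  | Introduce _ y | Forget _ y | Join y _ => base y (colour1 bag ty x dl)
  | Leaf => 0 end.
Definition z_base dl := if ty x is Join _ z then base z (colour2 bag ty x dl) else 0.

Lemma y_baseE dl (g : nat -> nat) :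
  (forall u, u \in B -> colour_of (g (bag_index B u)) = colour1 bag ty x dl u) ->
  offset (node_fields x).1.2 + fill_code #|B| G g = y_base dl.
Proof.
move=> gE; rewrite /y_base /base.
have := nice; rewrite /nice_node /node_fields.
have sup y : bag y \subset B -> colouring (bag y) (colour1 bag ty x dl) ->
    offset y + fill_code #|B| G g = offset y + G.+1 * ccode (bag y) (colour1 bag ty x dl).
  by move=> yB cy; congr (_ + _); apply: fill_code_ccode.
case tx: (ty x) nonleaf => [|v y|v y|y z] //= _.
- have [_ cy] := colour1_colouring dl nice (or_introl (ex_intro _ v tx)).
  by case=> _ _ bx; apply: sup cy; rewrite /big_bag tx bx subsetUr.
- have [_ cy] := colour1_colouring dl nice (or_intror (or_introl (ex_intro _ v tx))).
  by move=> _; apply: sup cy; rewrite /big_bag tx.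
have [_ cy] := colour1_colouring dl nice (or_intror (or_intror (ex_intro _ z tx))).
by case=> _ _ bxy _; apply: sup cy; rewrite /big_bag tx bxy.
Qed.

Lemma z_baseE dl (g : nat -> nat) y z : ty x = Join V y z ->
  (forall u, u \in B -> colour_of (g (bag_index B u)) = colour2 bag ty x dl u) ->
  offset (node_fields x).2 + fill_code #|B| G g = z_base dl.
Proof.
move=> tx gE; rewrite /z_base /base /node_fields tx /=.
have := nice; rewrite /nice_node tx => -[_ _ bxy bxz].
congr (_ + _); apply: fill_code_ccode => //; first by rewrite /big_bag tx bxz.
by have [] := colour2_colouring dl nice tx.
Qed.

Lemma fiber_ones dl : (exists y z, ty x = Join V y z) ->
  fiber (colour1 bag ty x dl) c1 :&: fiber (colour2 bag ty x dl) c1 :&: groups N M =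
  [set u in B | (dl (bag_index B u) == 1) && (u \in groups N M)].
Proof.
move=> [y [z tx]]; apply/setP => u; rewrite !inE !ffunE andbA; congr (_ && _).
rewrite /dec1 tx; case: ifP => //= _.
by case: (dl _) => [|[|[|[|[|d]]]]].
Qed.

Definition prepared dl s : Prop :=
  [/\ imem s vCell0 0 = base x (colour0 grp bag ty x dl),
      imem s vCell1 0 = y_base dl, (forall y z, ty x = Join V y z -> imem s vCell2 0 = z_base dl)
    & [/\ imem s vUp 0 = up_of dl, imem s vLow 0 = lo_of dl, imem s vDown 0 = dn_of dl,
          imem s vValid 0 = ok_of dl
        & rmem s rGain 0 = add_of dl /\
          (forall y z, ty x = Join V y z -> rmem s rCorr 0 =
            (join_correction grp x_ (bag x) (colour0 grp bag ty x dl))%:E)]].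

(** Scanning, the three decodings and the flags take b iterations each, where b is
    the size of the bag; the elements take b + 1 each. *)
Lemma prep_cmdP s dl : node_regs s x ->
  (forall j, j < #|B| -> digit_at s j = dl j) ->
  run prep_cmd s (prepared dl) (5 * #|B| + N * #|B|.+1).
Proof.
move=> nr dgE; have [n0 bl uE iE] := nr_views nr.
have vw := nr_views nr.
rewrite (_ : 5 * _ + _ = #|B| + (#|B| + (#|B| + (#|B| + (#|B| +
  (N * #|B|.+1 + 0)))))); last by lia.
have usix j : j < #|B| -> exists2 u, u \in B & j = bag_index B u.
  move=> jB; have : j \in iota 0 #|B| by rewrite mem_iota.
  by rewrite -map_bag_index => /mapP[u]; rewrite mem_enum; exists u.
have us_inj i j : i < bag_len s -> j < bag_len s -> vertex_at s i = vertex_at s j -> i = j.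
  rewrite bl => /usix[u uB ->] /usix[v vB ->].
  by rewrite !uE // => /vcode_inj ->.
apply: run_seq; apply: run_use (scan_cmdP us_inj) _ _; first by rewrite bl.
move=> s1 dv A1.
have nr1 : node_regs s1 x by apply: node_regs_agree A1 _ _ nr.
have bl1 := let: And4 _ h _ _ := nr_views nr1 in h.
have uE1 := let: And4 _ _ h _ := nr_views nr1 in h.
have dg1 u : u \in B -> digit_at s1 (bag_index B u) = dl (bag_index B u).
  by move=> uB; rewrite /digit_at; frame A1; rewrite -dgE // bag_index_lt.
apply: run_seq; apply: run_use (fill_cmdP (f := fun _ => join2) _) _ _.
- exact: ceval_dec2.
- by rewrite bl1.
move=> s2 [w2 code2 A2] _; rewrite (nr_G nr1) bl1 in code2.
have nr2 : node_regs s2 x by apply: node_regs_agree A2 _ _ nr1.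
apply: run_set => s3 /= e3 A3.
rewrite code2 (nr_z nr2) in e3.
have nr3 : node_regs s3 x by apply: node_regs_agree A3 _ _ nr2.
have bl3 := let: And4 _ h _ _ := nr_views nr3 in h.
apply: run_seq; apply: run_use (fill_cmdP (f := state_dec1 s3) _) _ _.
- exact: ceval_dec1.
- by rewrite bl3.
move=> s4 [w4 code4 A4] _; rewrite (nr_G nr3) bl3 in code4.
have nr4 : node_regs s4 x by apply: node_regs_agree A4 _ _ nr3.
apply: run_set => s5 /= e5 A5; rewrite code4 (nr_y nr4) in e5.
have nr5 : node_regs s5 x by apply: node_regs_agree A5 _ _ nr4.
have bl5 := let: And4 _ h _ _ := nr_views nr5 in h.
apply: run_seq; apply: run_use (fill_cmdP (f := state_dec0 s5) _) _ _.
- exact: ceval_dec0.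
- by rewrite bl5.
move=> s6 [w6 code6 A6] _; rewrite (nr_G nr5) bl5 in code6.
have nr6 : node_regs s6 x by apply: node_regs_agree A6 _ _ nr5.
apply: run_set => s7 /= e7 A7; rewrite code6 (nr_x nr6) in e7.
have nr7 : node_regs s7 x by apply: node_regs_agree A7 _ _ nr6.
have bl7 := let: And4 _ h _ _ := nr_views nr7 in h.
have vw7 := nr_views nr7.
have dE si : imem si aDigits =1 imem s1 aDigits -> forall u, u \in B -> digit_at si (bag_index B u) = dl (bag_index B u).
  by move=> a u uB; rewrite /digit_at a -/(digit_at s1 _) dg1.
have uEi si : node_regs si x -> forall u, u \in B -> vertex_at si (bag_index B u) = vcode u.
  by move=> nri; have [] := nr_views nri.
have special5 : forall v y, ty x = Introduce v y \/ ty x = Forget v y ->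
    imem s5 vSpecial 0 = special bag ty x dl.
  move=> v y tx; have vB := special_in tx.
  have -> : imem s5 vSpecial 0 = imem s1 vSpecial 0 by frames.
  rewrite (dv (bag_index B v)) ?bl ?bag_index_lt //; last first.
    by rewrite uE // (nr_v nr) /node_fields; case: tx => ->.
  by rewrite dgE ?bag_index_lt // /special; case: tx => ->.
have w7 u : u \in B -> colour_of (colour_at s7 (bag_index B u)) = colour0 grp bag ty x dl u.
  move=> uB; rewrite ffunE uB /colour_at; frame A7; rewrite -/(colour_at s6 _) w6 ?bl5 ?bag_index_lt //.
  rewrite (uEi s5) // dE //; last by move=> j; frames.
  rewrite (@state_dec0E _ _ (special bag ty x dl)) // => g y tx.
  by apply: (special5 (inr g) y); left.
have outB u : u \notin B -> colour0 grp bag ty x dl u = None.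
  by move=> /negPf uB; rewrite ffunE uB.
have sh7 : shows B s7 (colour0 grp bag ty x dl) by [].
have CX7 : imem s7 vCell0 0 = base x (colour0 grp bag ty x dl).
  rewrite e7 /base; congr (_ + _); apply: fill_code_ccode; first exact: sub_big.
    exact: colour0_colouring.
  move=> u uB; rewrite -w7 // /colour_at; frame A7.
  by rewrite -/(colour_at s6 _) w6 ?bl5 ?bag_index_lt.
have CY7 : imem s7 vCell1 0 = y_base dl.
  have -> : imem s7 vCell1 0 = imem s5 vCell1 0 by frames.
  rewrite e5; apply: y_baseE => u uB.
  rewrite (uEi s3) // dE //; last by move=> j; frames.
  by rewrite state_dec1E // ffunE uB.
have CZ7 y z : ty x = Join V y z -> imem s7 vCell2 0 = z_base dl.
  move=> tx; have -> : imem s7 vCell2 0 = imem s3 vCell2 0 by frames.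
  rewrite e3; apply: z_baseE tx _ => u uB.
  by rewrite dg1 // ffunE uB.
apply: run_seq; apply: run_use (flags_cmdP s7) _ _; first by rewrite bl7.
move=> s8 [NE8 CT8] A8; have nr8 : node_regs s8 x by apply: node_regs_agree A8 _ _ nr7.
have sh8 : shows B s8 (colour0 grp bag ty x dl).
  by split=> // u uB; rewrite /colour_at; frame A8; apply: w7.
apply: run_seq; apply: run_use (elem_cmdP s8) _ _.
  by have [-> -> _ _] := nr_views nr8.
move=> s9 [OK9 CORR9] A9.
have nr9 : node_regs s9 x by apply: node_regs_agree A9 _ _ nr8.
have N8 : imem s8 0 0 = N by have [] := nr_views nr8.
rewrite N8 (all_ok_at (nr_views nr8) sh8) in OK9.
rewrite N8 (sum_corr_at (nr_views nr8) sh8 (nr_w nr8)) in CORR9.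
apply: run_use (registers_cmdP s9) (leqnn _) _.
have -> : imem s9 vShared 0 = imem s8 vShared 0 by frames.
have -> : imem s9 vHasNbh 0 = imem s8 vHasNbh 0 by frames.
have -> : imem s9 vSpecial 0 = imem s5 vSpecial 0 by frames.
rewrite (nr_ty nr9) (nr_v nr9) OK9 CT8 NE8.
have [-> _ _ _] := nr_views nr9.
move=> s10 [DN LO UP OK ADD] A10.
split.
- by frame A10; frame A9; frame A8.
- by frame A10; frame A9; frame A8.
- by move=> y z tx; frame A10; frame A9; frame A8; apply: CZ7 tx.
- have eb (b : bool) : (nat_of_bool b == 0) = ~~ b by case: b.
  split.
  + rewrite UP /up_of /node_fields; case tx: (ty x) => [|[e|g] y|v y|y z] //=.
      by rewrite [N <= e]leqNgt ltn_ord.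
    by rewrite leq_addr (special5 (inr g) y) //; left.
  + rewrite LO /lo_of /node_fields; case tx: (ty x) => [|[e|g] y|v y|y z] //=.
      by rewrite ltn_ord (special5 (inl e) y) //; left.
    by rewrite ltnNge leq_addr.
  + rewrite DN /dn_of /node_fields; case tx: (ty x) => [|[e|g] y|v y|y z] //=.
    rewrite fiber_ones; last by exists y, z.
    rewrite bl7 count_bag_index; congr #|pred_of_set _|; apply/setP => u; rewrite !inE.
    case uB: (u \in B) => //=; rewrite dE //; last by move=> j; frames.
    rewrite (uEi s7) //; have [-> _ _ _] := vw7.
    by case: u {uB} => [e|g] /=; rewrite ?leq_addr // leqNgt ltn_ord.
  + rewrite OK /ok_of /node_fields; case tx: (ty x) => [|[e|g] y|v y|y z] //=;
      rewrite ?andbT //.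
      by rewrite [N <= e]leqNgt ltn_ord.
    rewrite leq_addr (special5 (inr g) y) //; last by left.
    have -> : imem s7 vVertex 0 = N + g by rewrite (nr_v nr7) /node_fields tx.
    rewrite (has_chosen_nbh vw7 sh7) eb.
    case: (special bag ty x dl == 1) => /=; rewrite ?andbT //.
    by case: (fiber _ c1 :&: _ == set0); rewrite /= ?andbT ?andbF.
  split.
    rewrite ADD /add_of /node_fields; case tx: (ty x) => [|[e|g] y|v y|y z] //=.
      rewrite ltn_ord (special5 (inl e) y) //; last by left.
      by rewrite (nr_w nr9); case: ifP => // _; rewrite /weight GRing.expr2.
    by rewrite ltnNge leq_addr.
  by move=> y z tx; frame A10; rewrite CORR9 /big_bag tx.
Qed.

End Prep.
End Node.

(** * Disjoint cells *)

Lemma positional_lt b s : all (fun d => d < b) s -> positional b s < b ^ size s.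
Proof. by elim: s => [|d s IH] //= /andP[db /IH]; rewrite expnS; nia. Qed.

Lemma euclid_inj b d d' a a' :
  d < b -> d' < b -> d + b * a = d' + b * a' -> d = d' /\ a = a'.
Proof.
move=> db db'; rewrite ![_ + b * _]addnC ![b * _]mulnC => /(congr1 (edivn^~ b)) /=.
by rewrite !edivn_eq // => -[].
Qed.

Lemma positional_inj b s s' : size s = size s' ->
  all (fun d => d < b) s -> all (fun d => d < b) s' -> positional b s = positional b s' -> s = s'.
Proof.
elim: s s' => [|d s IH] [|d' s'] //= [sz] /andP[db sb] /andP[db' sb'].
by move=> /(euclid_inj db db')[-> e]; rewrite (IH s').
Qed.

Lemma digit_lt3 o : digit o < 3.
Proof. by case: o => [[[|[|[|]]]]|]. Qed.

Lemma ccode_lt N M (B : {set vertex N M}) c : ccode B c < 3 ^ #|B|.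
Proof.
rewrite ccode_positional cardE -(size_map (fun u => digit (c u))); apply: positional_lt.
by apply/allP => _ /mapP[u _ ->]; apply: digit_lt3.
Qed.

Lemma ccode_inj N M (B : {set vertex N M}) c c' :
  colouring B c -> colouring B c' -> ccode B c = ccode B c' -> c = c'.
Proof.
move=> cc cc'; rewrite !ccode_positional => e.
have all3 c0 : all (fun d => d < 3) [seq digit (c0 u) | u <- enum B].
  by apply/allP => _ /mapP[u _ ->]; apply: digit_lt3.
have {}e := positional_inj (etrans (size_map _ _) (esym (size_map _ _))) (all3 c) (all3 c') e.
apply/ffunP => u; have [uB|uB] := boolP (u \in B); last first.
  by rewrite (colouring_none cc uB) (colouring_none cc' uB).
have [k ck] := colouring_ex cc uB; have [k' ck'] := colouring_ex cc' uB.
have : digit (c u) = digit (c' u).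
  by move/eq_in_map: e; apply; rewrite mem_enum.
by rewrite ck ck' /= => /val_inj ->.
Qed.

Lemma sum_lt_succ t (F : 'I_t -> nat) (x : 'I_t) :
  \sum_(y < t | y < x.+1) F y = \sum_(y < t | y < x) F y + F x.
Proof.
rewrite (bigD1 x) ?ltnSn //= addnC; congr (_ + _); apply: eq_bigl => y.
by rewrite ltnS ltn_neqAle andbC.
Qed.

Section Cells.
Variables (N M G t : nat) (bag : 'I_t -> {set vertex N M}).
Implicit Types (x y : 'I_t) (c : pcol (vertex N M)).

Local Notation offsetG := (offset G bag).
Local Notation bases := (base G bag).

Lemma offset_succ x : offsetG x.+1 = offsetG x + 3 ^ #|bag x| * G.+1.
Proof. exact: sum_lt_succ. Qed.

Lemma offset_mono k k' : k <= k' -> offsetG k <= offsetG k'.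
Proof.
move=> kk; rewrite /offset [leqRHS](bigID (fun y : 'I_t => y < k)) /=.
rewrite (eq_bigl (fun y : 'I_t => (y < k') && (y < k))) ?leq_addr // => y.
by rewrite andb_idl // => /leq_trans; apply.
Qed.

Definition in_block x a := offsetG x <= a < offsetG x.+1.

Lemma cell_in_block x c i : i <= G -> in_block x (bases x c + i).
Proof.
move=> iG; rewrite /in_block offset_succ /base; have := ccode_lt (bag x) c.
move: (ccode _ _) (3 ^ _) => k K kK.
by have := leq_mul kK (leqnn G.+1); lia.
Qed.

(** Nodes own disjoint intervals of the table, so that a node is solved without
    disturbing its children. *)
Lemma block_disjoint x y a : in_block x a -> in_block y a -> x = y.
Proof.
move=> /andP[x1 x2] /andP[y1 y2]; apply: val_inj.
have [xy|yx|//] := ltngtP x y.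
  by have := offset_mono xy; lia.
by have := offset_mono yx; lia.
Qed.

Lemma base_inj x c c' i i' : colouring (bag x) c -> colouring (bag x) c' ->
  i <= G -> i' <= G -> bases x c + i = bases x c' + i' -> c = c'.
Proof.
move=> cc cc' iG iG'; rewrite /base => e; apply: (ccode_inj cc cc').
move: (ccode _ c) (ccode _ c') e => k k' e.
have {}e : i + G.+1 * k = i' + G.+1 * k' by lia.
by have [] := euclid_inj (b := G.+1) iG iG' e.
Qed.
End Cells.

(** * Contributing one digit vector *)

Section Body.
Variables (R : realType) (N M : nat) (grp : 'I_M -> {set 'I_N}) (G : nat).
Variables (x_ : 'rV[R]_N) (t : nat) (root : 'I_t) (par : 'I_t -> 'I_t).
Variables (bag : 'I_t -> {set vertex N M}).
Variable (ty : 'I_t -> node_type (vertex N M) 'I_t).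
Local Notation V := (vertex N M).
Implicit Types (x y : 'I_t) (c : pcol V) (u v : V) (dl : nat -> nat) (s : state R).
Local Notation regs := (node_regs grp G x_ bag ty).
Local Notation offsetG := (offset G bag).

Definition table s : dp_table R N M 'I_t :=
  fun y i c => rmem s rTable (opt_cell G bag y i c).

Variable x : 'I_t.
Hypothesis nice : nice_node root par bag ty x.
Hypothesis nonleaf : ty x <> Leaf.
Hypothesis child_neq : forall y, y \in children root par x -> y != x.

Definition body_cmd : cmd := prep_cmd ;; contribute_cmd.

Definition updates dl s s' : Prop :=
  (forall c i z, colouring (bag x) c -> i <= G ->
     (table s' x i c <= z)%E <-> (table s x i c <= z)%E /\
       forall val, contrib grp G x_ bag ty (table s) x dl c i val -> (val <= z)%E) /\
  (forall a, ~~ in_block G bag x a -> rmem s' rTable a = rmem s rTable a).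

Lemma y_baseP dl : exists y c, y != x /\ y_base G bag ty x dl = base G bag y c.
Proof.
have := nice; rewrite /nice_node /y_base.
case: (ty x) nonleaf => [|v y|v y|y z] // _ [].
- by move=> ch _ _; exists y, (colour1 bag ty x dl); rewrite child_neq // ch set11.
- by move=> ch _ _; exists y, (colour1 bag ty x dl); rewrite child_neq // ch set11.
by move=> _ ch _ _; exists y, (colour1 bag ty x dl); rewrite child_neq // ch set21.
Qed.

Lemma z_baseP dl y z : ty x = Join V y z ->
  exists z c, z != x /\ z_base G bag ty x dl = base G bag z c.
Proof.
move=> tx; have := nice; rewrite /nice_node /z_base tx => -[_ ch _ _].
by exists z, (colour2 bag ty x dl); rewrite child_neq // ch set22.
Qed.

Lemma cells_apart c y c' i i' : y != x -> i <= G -> i' <= G ->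
  base G bag x c + i != base G bag y c' + i'.
Proof.
move=> yx iG iG'; apply: contraNneq yx => e; apply/eqP.
apply: (block_disjoint (cell_in_block bag y c' iG')).
by rewrite -e; apply: cell_in_block.
Qed.

(** [contrib] in the form in which the relaxation computes it: with addresses in
    place of colourings, and the cases of the recursion encoded in the parameters. *)
Definition raw_contrib dl s i (val : \bar R) : Prop :=
  ok_of grp bag ty x dl /\
  if ty x is Join _ _ then exists i1 i2, [/\ i1 <= G, i2 <= G,
      i1 + i2 = i + dn_of bag ty x dl
    & val = (rmem s rTable (y_base G bag ty x dl + i1) +
        (rmem s rTable (z_base G bag ty x dl + i2) -
          (join_correction grp x_ (bag x) (colour0 grp bag ty x dl))%:E))%E]
  else exists i1, [/\ i1 <= G, i1 + up_of bag ty x dl = i, lo_of bag ty x dl <= i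
    & val = (rmem s rTable (y_base G bag ty x dl + i1) + add_of x_ bag ty x dl)%E].

Lemma contribute_cmdP s dl (C0 := base G bag x (colour0 grp bag ty x dl)) :
  regs s x -> prepared grp G x_ bag ty x dl s ->
  run contribute_cmd s (fun s' =>
    (forall i z, i <= G -> (rmem s' rTable (C0 + i) <= z)%E <->
       (rmem s rTable (C0 + i) <= z)%E /\
       forall val, raw_contrib dl s i val -> (val <= z)%E) /\
    (forall a, ~~ (C0 <= a <= C0 + G) -> rmem s' rTable a = rmem s rTable a))
   (G.+1 * G.+2).
Proof.
move=> nr [CX CY CZ [UP LO DN OK [ADD CORR]]].
have disY i i' : i <= G -> i' <= G -> C0 + i != y_base G bag ty x dl + i'.
  by have [y [c [yx ->]]] := y_baseP dl; apply: cells_apart.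
apply: run_if; rewrite [beval _ _]/= -eqn_leq OK => ok; last first.
  apply: run_conseq (run_skip _) _ _; [|exact: leq0n|by move=> s'; exact].
  split=> // i z _; split=> [|[]//]; split=> // val [ok'].
  by rewrite ok' in ok.
have {}ok : ok_of grp bag ty x dl by case: (ok_of _ _ _ _ _) ok.
apply: run_if; rewrite [beval _ _]/= -eqn_leq (nr_ty nr) /node_fields => tj.
- have [y [z tx]] : exists y z, ty x = Join V y z.
    by case: (ty x) tj => [|v y|v y|y z] //= _; exists y, z.
  have := @join_loopP _ s; rewrite CX CY (CZ _ _ tx) (nr_G nr) DN LO (CORR _ _ tx).
  rewrite /lo_of tx => /(_ disY) H; apply: run_use (H _) (leqnn _) _.
    by move=> i i' iG iG'; have [z' [c [zx ->]]] := z_baseP dl tx; apply: cells_apart.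
  move=> s' [H1 H2] _; split=> // i z' iG; rewrite H1 //.
  split=> -[ha hb]; split=> //.
    move=> val [_]; rewrite tx => -[i1 [i2 [i1G i2G e ->]]].
    by apply: hb => //; rewrite e.
  move=> i1 i2 i1G i2G e _; apply: hb; split=> //; rewrite tx.
  by exists i1, i2.
have nj : ~ exists y z, ty x = Join V y z by case=> y [z tx]; rewrite tx in tj.
have := @relax_cmdP _ s; rewrite CX CY (nr_G nr) DN LO UP ADD => /(_ disY) H.
apply: run_use H _ _; first by rewrite leq_pmulr.
have dn0 : dn_of bag ty x dl = 0.
  by rewrite /dn_of; case: (ty x) nj => [|v y|v y|y z] // []; exists y, z.
move=> s' [H1 H2] _; split=> // i z' iG; rewrite H1 // dn0 addn0.
have rawE val : raw_contrib dl s i val <-> exists i1, [/\ i1 <= G,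
    i1 + up_of bag ty x dl = i, lo_of bag ty x dl <= i
    & val = (rmem s rTable (y_base G bag ty x dl + i1) + add_of x_ bag ty x dl)%E].
  rewrite /raw_contrib; case: (ty x) nj => [||v y|y z] nj; try tauto.
  by case: nj; exists y, z.
split=> -[ha hb]; split=> //.
  by move=> val /rawE[i1 [i1G e lo ->]]; apply: hb.
by move=> i1 i1G e lo; apply: hb; apply/rawE; exists i1.
Qed.

Lemma raw_contribE dl s i val (c := colour0 grp bag ty x dl) : i <= G ->
  raw_contrib dl s i val <-> contrib grp G x_ bag ty (table s) x dl c i val.
Proof.
move=> iG; have := nice; rewrite /nice_node /raw_contrib /contrib /table.
case tx: (ty x) nonleaf => [|[e|g] y|v y|y z] // _ _;
  rewrite /ok_of /up_of /lo_of /dn_of /add_of /y_base /z_base tx -/c.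
- have -> : c (inl e) = colour_of (clamp (special bag ty x dl)).
    rewrite /c ffunE (special_in nice (v := inl e) (y := y)); last by left.
    by rewrite /dec0 tx /special tx.
  move: (special _ _ _ _) => d; rewrite andbT.
  have E : ((d == 1 : nat) <= i) = (~~ (d == 1) || (0 < i)).
    by case: (d == 1); rewrite ?leq0n.
  split=> [[cons [i1 [_ e1 lo ->]]]|[_ cons [lo ->]]].
    rewrite addn0 in e1; split=> //; rewrite opt_cellE e1; split.
      by move: lo; rewrite E; case: d {E} => [|[|[|d]]] //= _ /(congr1 digit).
    by case: d {E lo} => [|[|[|d]]].
  split=> //; exists i; rewrite addn0 opt_cellE; split=> //.
    by rewrite E; case: d {E} lo => [|[|[|d]]] //=; apply.
  by case: d {E lo} => [|[|[|d]]].
- have -> : c (inr g) = colour_of (is_one (special bag ty x dl)).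
    rewrite /c ffunE (special_in nice (v := inr g) (y := y)); last by left.
    by rewrite /dec0 tx eqxx /special tx.
  move: (special _ _ _ _) => d; rewrite /is_one; case: (d == 1) => /=.
    split=> [[/andP[cons ne] [i1 [_ e1 _ ->]]]|[_ cons [ne i0 ->]]].
      by split=> //; split=> //; [lia|rewrite opt_cellE -e1 addn1].
    split; first by rewrite cons.
    by exists i.-1; split=> //; [lia|lia|rewrite opt_cellE].
  rewrite andbT; split=> [[cons [i1 [_ e1 _ ->]]]|[_ cons ->]].
    by split=> //; rewrite opt_cellE -e1 addn0.
  by split=> //; exists i; rewrite addn0 opt_cellE.
- rewrite andbT; split=> [[cons [i1 [_ e1 _ ->]]]|[_ cons ->]].
    by split=> //; rewrite opt_cellE -e1 addn0.
  by split=> //; exists i; rewrite addn0 opt_cellE.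
rewrite andbT; split=> [[cons [i1 [i2 [i1G i2G e ->]]]]|[_ cons [i1 [i2 [i1G i2G e ->]]]]].
  by split=> //; exists i1, i2; rewrite !opt_cellE.
by split=> //; exists i1, i2; rewrite !opt_cellE.
Qed.

Lemma body_cmdP s dl (b := #|big_bag bag ty x|) : regs s x ->
  (forall j, j < b -> digit_at s j = dl j) ->
  run body_cmd s (updates dl s) (5 * b + N * b.+1 + G.+1 * G.+2).
Proof.
move=> nr dgE; apply: run_seq.
apply: run_use (prep_cmdP nice nonleaf nr dgE) (leqnn _) _ => s1 P1 A1.
have nr1 : regs s1 x by apply: node_regs_agree A1 _ _ nr.
apply: run_use (contribute_cmdP nr1 P1) (leqnn _) _ => s2 [H1 H2] _.
have T1 : rmem s1 rTable = rmem s rTable.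
  by apply: functional_extensionality => a; frames.
have rawE i val : raw_contrib dl s1 i val <-> raw_contrib dl s i val.
  by rewrite /raw_contrib T1.
split=> [c i z cc iG|a na]; last first.
  rewrite H2 ?T1 //; apply: contra na => /andP[a1 a2].
  have -> : a = base G bag x (colour0 grp bag ty x dl) +
                (a - base G bag x (colour0 grp bag ty x dl)) by lia.
  by apply: cell_in_block; lia.
have c0c := colour0_colouring grp nice nonleaf dl.
rewrite /table opt_cellE; have [->|nc] := eqVneq c (colour0 grp bag ty x dl).
  rewrite H1 // T1; split=> -[ha hb]; split=> // val hv; apply: hb.
    by apply/rawE/raw_contribE.
  by apply/raw_contribE => //; apply/rawE.
rewrite H2 ?T1; last first.
  apply: contra nc => /andP[a1 a2]; apply/eqP.
  apply: (base_inj cc c0c iG (i' := base G bag x c + i -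
     base G bag x (colour0 grp bag ty x dl))); lia.
by split=> [ha|[]//]; split=> // val [ce]; rewrite ce eqxx in nc.
Qed.

End Body.

(** * Enumerating the digit vectors of a node *)

(** An odometer.  Without division, the digits are kept in an array and incremented
    with carry instead of being read off the counter. *)
Definition inc_cmd : cmd :=
  SetVar vCarry (Cst 1) ;;
  For vPos (Var vBagLen)
    (When (Eqb (Var vCarry) (Cst 1))
      (If (ILe (IGet aDigits (Var vPos)) (Cst 3))
        (ISet aDigits (Var vPos) (IAdd (IGet aDigits (Var vPos)) (Cst 1)) ;; SetVar vCarry (Cst 0))
        (ISet aDigits (Var vPos) (Cst 0)))).

Definition number (b : nat) (d : nat -> nat) : nat := \sum_(j < b) d j * 5 ^ j.

Lemma number_succ b d : number b.+1 d = number b d + d b * 5 ^ b.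
Proof. by rewrite /number big_ord_recr. Qed.

Lemma number_lt b d : (forall j, j < b -> d j < 5) -> number b d < 5 ^ b.
Proof.
elim: b => [|b IH] d5; first by rewrite /number big_ord0.
rewrite number_succ expnS; have := IH (fun j jb => d5 j (ltnW jb)); have := d5 b (ltnSn b).
by move: (5 ^ b) => p; nia.
Qed.

Lemma number_inj b d d' : (forall j, j < b -> d j < 5) -> (forall j, j < b -> d' j < 5) ->
  number b d = number b d' -> forall j, j < b -> d j = d' j.
Proof.
move=> d5 d5'; rewrite /number -!positional_sum => e.
have all5 d0 : (forall j, j < b -> d0 j < 5) -> all (fun d => d < 5) [seq d0 j | j <- iota 0 b].
  by move=> h; apply/allP => _ /mapP[j jb ->]; apply: h; rewrite mem_iota in jb.
have {}e := positional_inj (etrans (size_map _ _) (esym (size_map _ _))) (all5 _ d5) (all5 _ d5') e.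
by move=> j jb; move/eq_in_map: e; apply; rewrite mem_iota.
Qed.

(** The weighted sum of the digits processed so far, plus the carry at the current
    place, exceeds the old sum by one. *)
Lemma inc_cmdP (R : realType) (s : state R) :
  (forall j, j < bag_len s -> digit_at s j < 5) ->
  run inc_cmd s (fun s' => (forall j, j < bag_len s -> digit_at s' j < 5) /\
    (number (bag_len s) (digit_at s) + 1 < 5 ^ bag_len s ->
     number (bag_len s) (digit_at s') = number (bag_len s) (digit_at s) + 1)) (bag_len s).
Proof.
move=> d5; apply: run_set => s0 e0 A0; rewrite -[X in run _ _ _ X]muln1.
pose Inv k (s' : state R) := [/\ forall j, k <= j -> digit_at s' j = digit_at s j,
   (forall j, j < k -> digit_at s' j < 5), imem s' vCarry 0 <= 1
 & number k (digit_at s') + imem s' vCarry 0 * 5 ^ k = number k (digit_at s) + 1].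
apply: (@run_conseq _ _ _ (Inv (bag_len s)) _ (bag_len s * 1)) => //; last first.
  move=> s' [_ H c1 e]; split=> // lt.
  by case: (imem s' vCarry 0) c1 e => [|[|]] //= _; lia.
apply: (run_for (Inv := Inv)) => //.
- by rewrite /=; frames.
- split=> [j _|//||]; rewrite /digit_at /= /upd /=; frames => //; rewrite ?e0 //.
  by rewrite /number !big_ord0.
move=> j s1 jb A1 j1 [I1 I2 I3 I4].
have dj : imem s1 aDigits j = digit_at s j by rewrite -I1.
have sameN s' : (forall i, i != j -> digit_at s' i = digit_at s1 i) ->
    number j (digit_at s') = number j (digit_at s1).
  move=> h; apply: eq_bigr => i _; rewrite h // neq_ltn ltn_ord //.
have num s' : (forall i, i != j -> digit_at s' i = digit_at s1 i) -> imem s' vCarry 0 <= 1 -> digit_at s' j < 5 ->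
   digit_at s' j + 5 * imem s' vCarry 0 = digit_at s j + imem s1 vCarry 0 -> Inv j.+1 s'.
  move=> h h1 h5 e; split=> // [i ij|i|].
  - by rewrite h ?I1 //; lia.
  - rewrite ltnS leq_eqVlt => /orP[/eqP -> //|ij]; rewrite h ?I2 //; lia.
  rewrite !number_succ sameN // expnS; move: I4; move: (5 ^ j) => p; nia.
apply: run_if; rewrite [beval _ _]/= -eqn_leq => hc.
  apply: run_if; rewrite [beval _ _]/= j1 dj => hd.
    apply: run_straight => //; apply: num; rewrite /digit_at /= /upd /= ?j1 ?dj ?eqxx.
    + by move=> i /negPf ->.
    + by [].
    + by lia.
    by rewrite (eqP hc) -/(digit_at s j); lia.
  apply: run_straight => //; apply: num; rewrite /digit_at /= /upd /= ?j1 ?eqxx.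
  + by move=> i /negPf ->.
  + by [].
  + by [].
  by rewrite (eqP hc); have := d5 j jb; rewrite -/(digit_at s j); lia.
apply: run_skip; apply: num; rewrite /digit_at /= /upd /=; rewrite ?dj //.
- exact: d5.
have -> : imem s1 vCarry 0 = 0 by lia.
by rewrite muln0 !addn0.
Qed.

Definition node_load : cmd :=
  SetVar vKind (IGet 2 (Var vNode)) ;; SetVar vVertex (IGet 3 (Var vNode)) ;;
  SetVar vChild1 (IGet 4 (Var vNode)) ;; SetVar vChild2 (IGet 5 (Var vNode)) ;;
  SetVar vBlock (IGet aOffsets (Var vNode)) ;; SetVar vBlock1 (IGet aOffsets (Var vChild1)) ;;
  SetVar vBlock2 (IGet aOffsets (Var vChild2)) ;;
  put vBigNode (CIf (ty_is 2) (CE (Var vChild1)) (CE (Var vNode))) ;;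
  SetVar vBagStart (IGet 6 (Var vBigNode)) ;;
  SetVar vBagLen (ISub (IGet 6 (IAdd (Var vBigNode) (Cst 1))) (Var vBagStart)).

Definition node_clear : cmd :=
  For vIter (ISub (IGet aOffsets (IAdd (Var vNode) (Cst 1))) (Var vBlock))
    (RSet rTable (IAdd (Var vBlock) (Var vIter)) RNinf).

Definition node_digits : cmd :=
  SetVar vPower (Cst 1) ;;
  For vPos (Var vBagLen)
    (SetVar vPower (IAdd (Var vPower) (IAdd (IAdd (Var vPower) (Var vPower)) (IAdd (Var vPower) (Var vPower)))) ;;
     ISet aDigits (Var vPos) (Cst 0)).

Definition node_cmd : cmd :=
  node_load ;; node_clear ;;
  If (ty_is 0)
    (RSet rTable (Var vBlock) RZero)
    (node_digits ;; For vIter (Var vPower) (body_cmd ;; inc_cmd)).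

Lemma node_digitsP (R : realType) (s : state R) (b := bag_len s) :
  run node_digits s (fun s' => imem s' vPower 0 = 5 ^ b /\
    forall j, j < b -> digit_at s' j = 0) b.
Proof.
apply: run_set => s0 e0 A0; rewrite -[X in run _ _ _ X]muln1.
apply: (run_for (Inv := fun k s' => imem s' vPower 0 = 5 ^ k /\
    forall j, j < k -> digit_at s' j = 0)) => //.
- by rewrite /=; frames.
move=> j s1 jb A1 j1 [I1 I2]; apply: run_straight => //.
rewrite /digit_at /= /upd /= j1 I1 expnS; split; first by lia.
move=> i; rewrite ltnS leq_eqVlt; case: eqP => //= ni ij; exact: I2.
Qed.

Lemma node_clearP (R : realType) (s : state R) (a := imem s vBlock 0)
    (n := imem s aOffsets (imem s vNode 0 + 1) - a) :
  run node_clear s (fun s' =>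
    (forall i, i < n -> rmem s' rTable (a + i) = -oo%E) /\
    (forall k, ~~ (a <= k < a + n) -> rmem s' rTable k = rmem s rTable k)) n.
Proof.
rewrite -[X in run _ _ _ X]muln1.
apply: (run_for (Inv := fun k s' =>
    (forall i, i < k -> rmem s' rTable (a + i) = -oo%E) /\
    (forall k, ~~ (a <= k < a + n) -> rmem s' rTable k = rmem s rTable k))) => //.
move=> j s1 jn A1 j1 [I1 I2]; apply: run_straight => //.
rewrite /= /upd /= j1; frame A1; rewrite -/a; split=> [i ij|k nk].
  case: eqP => // ne; apply: I1; lia.
by case: eqP => [e|_]; [move: nk; rewrite e; lia|apply: I2].
Qed.

(** * Solving a node *)

Section NodeStep.
Variables (R : realType) (N M : nat) (grp : 'I_M -> {set 'I_N}) (G : nat).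
Variables (x_ : 'rV[R]_N) (t : nat) (root : 'I_t) (par : 'I_t -> 'I_t).
Variables (bag : 'I_t -> {set vertex N M}).
Variable (ty : 'I_t -> node_type (vertex N M) 'I_t).
Local Notation V := (vertex N M).
Implicit Types (x y : 'I_t) (c : pcol V) (u v : V) (dl : nat -> nat) (s : state R).
Local Notation regs := (node_regs grp G x_ bag ty).
Local Notation opt := (OPT grp G x_ bag ty).
Local Notation big := (big_bag bag ty).

(** The input arrays, and the precomputed products that replace multiplication when
    the incidence matrix and the table are addressed. *)
Record inputs s : Prop := Inputs {
  in_N : imem s 0 0 = N; in_G : imem s 0 2 = G;
  in_inc : forall (g : 'I_M) (e : 'I_N),
    (0 < imem s 1 (imem s aRows g + e)) = (e \in grp g);
  in_ty : forall x, imem s 2 x = (node_fields ty x).1.1.1;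
  in_v : forall x, imem s 3 x = (node_fields ty x).1.1.2;
  in_y : forall x, imem s 4 x = (node_fields ty x).1.2;
  in_z : forall x, imem s 5 x = (node_fields ty x).2;
  in_start : forall x, imem s 6 (x + 1) = imem s 6 x + #|bag x|;
  in_bag : forall x u, u \in bag x -> imem s 7 (imem s 6 x + bag_index (bag x) u) = vcode u;
  in_w : forall e : 'I_N, rmem s rSignal e = (x_ 0%R e)%:E;
  in_off : forall k, k <= t -> imem s aOffsets k = offset G bag k }.

Lemma inputs_agree I J s s' : agree I J s s' ->
  ~~ has (mem I) [:: 0; 1; 2; 3; 4; 5; 6; 7; aRows; aOffsets] -> rSignal \notin J ->
  inputs s -> inputs s'.
Proof.
move=> A /hasPn nI nJ [h0 h1 h2 h3 h4 h5 h6 h7 h8 h9 h10].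
have E a j : a \in [:: 0; 1; 2; 3; 4; 5; 6; 7; aRows; aOffsets] ->
  imem s' a j = imem s a j by move=> /nI aI; apply: A.1.
split=> *; rewrite ?(E 0) ?(E 1) ?(E 2) ?(E 3) ?(E 4) ?(E 5) ?(E 6) ?(E 7) ?(E aRows)
  ?(E aOffsets) ?A.2 //; eauto.
Qed.

Lemma node_loadP s x : nice_node root par bag ty x ->
  inputs s -> imem s vNode 0 = x -> run node_load s (fun s' => regs s' x) 0.
Proof.
move=> nice inp sx.
apply: run_set => s1 e1 A1; apply: run_set => s2 e2 A2.
apply: run_set => s3 e3 A3; apply: run_set => s4 e4 A4.
apply: run_set => s5 e5 A5; apply: run_set => s6 e6 A6.
apply: run_set => s7 e7 A7; apply: run_put => s8 e8 A8.
apply: run_set => s9 e9 A9; apply: (run_put_last (a := vBagLen) (c := CE _)) => s10 e10 A10.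
have i1 := inputs_agree A1 isT isT inp; have i2 := inputs_agree A2 isT isT i1.
have i3 := inputs_agree A3 isT isT i2; have i4 := inputs_agree A4 isT isT i3.
have i5 := inputs_agree A5 isT isT i4; have i6 := inputs_agree A6 isT isT i5.
have i7 := inputs_agree A7 isT isT i6; have i8 := inputs_agree A8 isT isT i7.
have i9 := inputs_agree A9 isT isT i8; have i10 := inputs_agree A10 isT isT i9.
rewrite /= in e1 e2 e3 e4 e5 e6 e7 e9 e10.
have x1 : imem s1 vNode 0 = x by frames.
have x2 : imem s2 vNode 0 = x by frames.
have x3 : imem s3 vNode 0 = x by frames.
have x4 : imem s4 vNode 0 = x by frames.
have x7 : imem s7 vNode 0 = x by frames.
rewrite sx (in_ty inp) in e1; rewrite x1 (in_v i1) in e2.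
rewrite x2 (in_y i2) in e3; rewrite x3 (in_z i3) in e4.
have ylt : (node_fields ty x).1.2 <= t.
  by rewrite /node_fields; case: (ty x) => [|v y|v y|y z] //=; apply: ltnW.
have zlt : (node_fields ty x).2 <= t.
  by rewrite /node_fields; case: (ty x) => [|v y|v y|y z] //=; apply: ltnW.
rewrite x4 (in_off i4) ?(ltnW (ltn_ord x)) // in e5.
have y5 : imem s5 vChild1 0 = (node_fields ty x).1.2 by frame A5; frame A4; rewrite e3.
rewrite y5 (in_off i5) // in e6.
have z6 : imem s6 vChild2 0 = (node_fields ty x).2 by frame A6; frame A5; rewrite e4.
rewrite z6 (in_off i6) // in e7.
have ty7 : imem s7 vKind 0 = (node_fields ty x).1.1.1.
  by frame A7; frame A6; frame A5; frame A4; frame A3; frame A2; rewrite e1.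
have y7 : imem s7 vChild1 0 = (node_fields ty x).1.2 by frame A7; frame A6; rewrite y5.
have [w bw e8'] : exists2 w : 'I_t, big x = bag w & imem s8 vBigNode 0 = w.
  rewrite e8 /= -eqn_leq ty7 x7 y7 /node_fields /big_bag.
  by case: (ty x) => [|v y|v y|y z] /=; [exists x|exists x|exists y|exists x].
have w9 : imem s9 vBigNode 0 = w by frame A9.
have s69 : imem s9 6 w = imem s8 6 w by frame A9.
rewrite e8' in e9; rewrite w9 (in_start i9) e9 s69 addKn in e10.
have b10 : imem s10 vBagStart 0 = imem s10 6 w by frame A10; rewrite e9 s69.
split.
- split; [exact: in_N i10|by rewrite bw -e10| |].
    by move=> u; rewrite bw => uB; rewrite /vertex_at b10 (in_bag i10).
  by move=> g e; rewrite /incident (in_N i10) addKn (in_inc i10).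
- exact: in_G i10.
- by frame A10; frame A9; frame A8.
- by frame A10; frame A9; frame A8; frame A7; frame A6; frame A5; frame A4; frame A3.
- by frame A10; frame A9; frame A8; frame A7; frame A6.
- by frame A10; frame A9; frame A8; frame A7.
- by frame A10; frame A9; frame A8.
exact: in_w i10.
Qed.

(** The contributions read the children only, at colourings of their bags: hence the
    table in memory may be replaced by the true values. *)
Lemma contrib_children (f g : dp_table R N M 'I_t) x dl c i val :
  nice_node root par bag ty x ->
  (forall y i c, y \in children root par x -> colouring (bag y) c -> i <= G ->
     f y i c = g y i c) -> i <= G ->
  contrib grp G x_ bag ty f x dl c i val -> contrib grp G x_ bag ty g x dl c i val.
Proof.
move=> nice fg iG; rewrite /contrib => -[cE cons H]; split=> //.
have c1x y := colour1_colouring (y := y) dl nice.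
case tx: (ty x) H => [|[e|h] y|v y|y z] //.
- have [ch cy] := c1x y (or_introl (ex_intro _ _ tx)).
  by rewrite fg.
- have [ch cy] := c1x y (or_introl (ex_intro _ _ tx)).
  by rewrite !fg //; lia.
- have [ch cy] := c1x y (or_intror (or_introl (ex_intro _ _ tx))).
  by rewrite fg.
have [ch cy] := c1x y (or_intror (or_intror (ex_intro _ _ tx))).
have [chz cz] := colour2_colouring dl nice tx.
move=> [i1 [i2 [i1G i2G e ->]]]; exists i1, i2; split=> //.
by rewrite !fg.
Qed.

Lemma contrib_digits (f : dp_table R N M 'I_t) x dl dl' c i val :
  nice_node root par bag ty x ->
  (forall j, j < #|big x| -> dl j = dl' j) ->
  contrib grp G x_ bag ty f x dl c i val -> contrib grp G x_ bag ty f x dl' c i val.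
Proof.
move=> nice e; have eB u : u \in big x -> dl (bag_index (big x) u) = dl' (bag_index (big x) u).
  by move=> uB; apply/e/bag_index_lt.
have sE : special bag ty x dl = special bag ty x dl'.
  rewrite /special; have sp := special_in nice.
  by case tx: (ty x) sp => [|v y|v y|y z] sp //; apply: eB; apply: (sp v y); tauto.
have -> : contrib grp G x_ bag ty f x dl c i val =
   contrib grp G x_ bag ty f x dl' c i val; last by [].
rewrite /contrib; have -> : colour0 grp bag ty x dl = colour0 grp bag ty x dl'.
  by apply/ffunP => u; rewrite !ffunE sE; case: ifP => // uB; rewrite eB.
have -> : colour1 bag ty x dl = colour1 bag ty x dl'.
  by apply/ffunP => u; rewrite !ffunE; case: ifP => // uB; rewrite eB.
have -> : colour2 bag ty x dl = colour2 bag ty x dl'.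
  by apply/ffunP => u; rewrite !ffunE; case: ifP => // uB; rewrite eB.
by [].
Qed.

Hypothesis ntd : nice_tree_decomposition (incidence grp) root par bag ty.

Lemma opt_inconsistent y i c : ~~ consistent grp c -> opt y i c = -oo%E.
Proof. by move=> ic; rewrite (OPT_rec _ _ ntd) /dp_step ic. Qed.

(** Otherwise x would be its own parent and could not reach the root. *)
Lemma child_neq x y : y \in children root par x -> y != x.
Proof.
have [[[pr reach] _ _ _] _] := ntd.
rewrite inE => /andP[yr /eqP px]; apply/eqP => yx; rewrite -yx in px.
have := reach y; rewrite (_ : fconnect par y root = (y == root)).
  by rewrite (negPf yr).
apply/idP/eqP => [/iter_findex <-|->]; last exact: connect0.
by elim: (findex _ _ _) => //= n <-.
Qed.

Definition node_cost x :=
  3 ^ #|bag x| * G.+1 +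
  (#|big x| + 5 ^ #|big x| *
    (5 * #|big x| + N * #|big x|.+1 + G.+1 * G.+2 + #|big x|).+1).

Definition solved s y : Prop := forall i c, i <= G -> colouring (bag y) c ->
  table G bag s y i c = opt y i c.

(** After m digit vectors, the upper bounds of a cell of x are those of the
    contributions of the vectors whose number is less than m. *)
Lemma node_cmdP s x : inputs s -> imem s vNode 0 = x ->
  (forall y, y \in children root par x -> solved s y) ->
  run node_cmd s (fun s' => solved s' x /\
    forall a, ~~ in_block G bag x a -> rmem s' rTable a = rmem s rTable a) (node_cost x).
Proof.
move=> inp sx kids; have nice := ntd.2 x.
rewrite -[node_cost x]add0n; apply: run_seq.
apply: run_use (node_loadP nice inp sx) (leqnn _) _ => s1 nr1 A1.
have inp1 : inputs s1 by apply: inputs_agree A1 _ _ inp.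
have x1 : imem s1 vNode 0 = x by frame A1.
have T1 : rmem s1 rTable = rmem s rTable by apply: functional_extensionality => a; frame A1.
have offS : imem s1 aOffsets (x + 1) - imem s1 vBlock 0 = 3 ^ #|bag x| * G.+1.
  by rewrite (in_off inp1) ?addn1 // (nr_x nr1) offset_succ addKn.
have xb1 := nr_x nr1.
apply: run_seq; apply: run_use (node_clearP s1) _ _; first by rewrite x1 offS.
rewrite x1 offS xb1 => s2 [C1 C2] A2.
have nr2 : regs s2 x by apply: node_regs_agree A2 _ _ nr1.
have out2 a : ~~ in_block G bag x a -> rmem s2 rTable a = rmem s rTable a.
  by move=> na; rewrite C2 ?T1 // -offset_succ.
have clear2 i c : i <= G -> table G bag s2 x i c = -oo%E.
  move=> iG; rewrite /table opt_cellE.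
  have /andP[l1 l2] := cell_in_block bag x c iG.
  by rewrite (_ : _ + i = offset G bag x + (base G bag x c + i - offset G bag x)) ?C1 //;
    move: l2; rewrite offset_succ; lia.
apply: run_if; rewrite [beval _ _]/= -eqn_leq (nr_ty nr2) => tl.
  have tx : ty x = Leaf.
    by move: tl; rewrite /node_fields; case: (ty x).
  have [_ bx] : children root par x = set0 /\ bag x = set0.
    by move: nice; rewrite /nice_node tx.
  apply: run_straight => //; split=> [i c iG cc|a na]; last first.
    rewrite /= /upd /= (nr_x nr2); case: eqP => [e|_]; last exact: out2.
    by move: na; rewrite e /in_block leqnn offset_succ -[X in X < _]addn0 ltn_add2l muln_gt0 expn_gt0.
  have cons : consistent grp c.
    by apply/consistentP => g e; rewrite (colouring_none cc) // bx inE.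
  rewrite (OPT_rec _ _ ntd) /dp_step cons tx /=.
  rewrite /table opt_cellE /= /upd /= (nr_x nr2).
  have cc0 : ccode (bag x) c = 0.
    by have := ccode_lt (bag x) c; rewrite [in 3 ^ _]bx cards0; lia.
  rewrite /base cc0 muln0 addn0 -[X in _ == X]addn0 eqn_add2l.
  case: eqP => // ni; have := clear2 i c iG; rewrite /table opt_cellE /base cc0.
  by rewrite muln0 addn0.
have nonleaf : ty x <> Leaf by move=> tx; rewrite /node_fields tx in tl.
set b := #|big x|.
have bl2 : bag_len s2 = b by have [] := nr_views nr2.
apply: run_seq; apply: run_use (node_digitsP s2) _ _; first by rewrite bl2.
rewrite bl2 => s3 [pw3 D3] A3.
have nr3 : regs s3 x by apply: node_regs_agree A3 _ _ nr2.
have T3 : rmem s3 rTable = rmem s2 rTable by apply: functional_extensionality => a; frame A3.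
pose Inv m s' := [/\ forall c i z, colouring (bag x) c -> i <= G ->
      (table G bag s' x i c <= z)%E <->
      (forall dl val, (forall j, dl j < 5) -> number b dl < m ->
         contrib grp G x_ bag ty opt x dl c i val -> (val <= z)%E),
    forall a, ~~ in_block G bag x a -> rmem s' rTable a = rmem s rTable a,
    forall j, j < b -> digit_at s' j < 5
  & m < 5 ^ b -> number b (digit_at s') = m].
apply: (@run_conseq _ _ _ (Inv (5 ^ b)) _ _ _ _ (leqnn _)); last first.
  move=> s' [H1 H2 _ _]; split=> // i c iG cc.
  have same z : (table G bag s' x i c <= z)%E <-> (opt x i c <= z)%E.
    rewrite H1 // (OPT_rec _ _ ntd).
    rewrite -(contribs_dp_step x_ nice opt_inconsistent z nonleaf cc iG).
    split=> H dl val d5; last by move=> _; apply: H.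
    by apply: H => //; apply: number_lt.
  by apply/eqP; rewrite eq_le; apply/andP; split; [apply/same|apply/same].
apply: (run_for (Inv := Inv)) => //.
- split=> [c i z cc iG|a na|j jb|_].
  + by rewrite /table /= T3 -/(table G bag s2 x i c) clear2 // leNye; split.
  + by rewrite /= T3 out2.
  + by rewrite /digit_at /= /upd /= -/(digit_at s3 j) D3.
  by rewrite /number big1 // => j _; rewrite /digit_at /= /upd /= -/(digit_at s3 j) D3.
move=> m s4 mb A4 m4 [I1 I2 I3 I4].
have nr4 : regs s4 x by apply: node_regs_agree A4 _ _ nr3.
pose dl0 j := if j < b then digit_at s4 j else 0.
have dl0E j : j < b -> digit_at s4 j = dl0 j by rewrite /dl0 => ->.
have dl05 j : dl0 j < 5 by rewrite /dl0; case: ifP => // /I3.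
have num0 : number b dl0 = m.
  by rewrite -(I4 mb); apply: eq_bigr => j _; rewrite dl0E.
have table4 y i c : y \in children root par x -> colouring (bag y) c -> i <= G ->
    table G bag s4 y i c = opt y i c.
  move=> ch cc iG; rewrite -kids // /table I2 // opt_cellE.
  apply: contra (child_neq ch) => inx; apply/eqP.
  by apply: (block_disjoint _ inx); apply: cell_in_block.
apply: run_seq.
apply: run_use (body_cmdP nice nonleaf (@child_neq x) nr4 dl0E) (leqnn _) _.
move=> s5 [U1 U2] A5.
have nr5 : regs s5 x by apply: node_regs_agree A5 _ _ nr4.
have bl5 : bag_len s5 = b by have [] := nr_views nr5.
have D5 j : digit_at s5 j = digit_at s4 j by rewrite /digit_at; frame A5.
apply: run_use (inc_cmdP _) _ _; [by move=> j; rewrite bl5 D5; apply: I3|by rewrite bl5|].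
rewrite bl5 => s6 [J1 J2] A6.
have num5 : number b (digit_at s5) = m.
  by rewrite -(I4 mb); apply: eq_bigr => j _; rewrite D5.
have T6 : rmem s6 rTable = rmem s5 rTable by apply: functional_extensionality => a; frame A6.
split=> [c i z cc iG|a na|j jb|mb'].
- rewrite /table /= T6 -/(table G bag s5 x i c) U1 // I1 //.
  split=> [[ha hb] dl val d5|H].
    rewrite ltnS leq_eqVlt => /orP[/eqP nm|nm]; last exact: ha.
    move=> cv; apply: hb; apply: (contrib_children nice (f := opt)) => //.
      by move=> *; rewrite table4.
    apply: contrib_digits cv => //.
    by apply: number_inj; [move=> *; apply: d5|move=> *; apply: dl05|rewrite nm num0].
  split=> [dl val d5 nm|val cv]; first by apply: H => //; apply: ltnW.
  apply: (H dl0) => //; first by rewrite num0.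
  exact: (contrib_children nice table4).
- by rewrite /= T6 U2 // I2.
- exact: J1.
by rewrite /= num5 addn1 in J2; apply: J2.
Qed.

End NodeStep.

(** * The whole program *)

Definition rows_cmd : cmd :=
  ISet aRows (Cst 0) (Cst 0) ;;
  For vIter eM (ISet aRows (IAdd (Var vIter) (Cst 1)) (IAdd (IGet aRows (Var vIter)) eN)).

Lemma rows_cmdP (R : realType) (s : state R) :
  run rows_cmd s (fun s' => forall g, g <= imem s 0 1 ->
    imem s' aRows g = g * imem s 0 0) (imem s 0 1).
Proof.
apply: run_head => // s0 e0 A0; rewrite -[X in run _ _ _ X]muln1.
apply: (run_for (Inv := fun k s' => forall g, g <= k ->
    imem s' aRows g = g * imem s 0 0)) => //.
- by rewrite /=; frames.
- by rewrite e0 => g; rewrite leqn0 => /eqP ->.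
move=> j s1 jm A1 j1 I1; apply: run_straight => // g gj.
rewrite /= /upd /= j1 addn1; case: eqP => [->|ne]; last by apply: I1; lia.
by rewrite I1 //; frames; rewrite mulSn addnC.
Qed.

Definition bag_size h := ISub (IGet 6 (IAdd h (Cst 1))) (IGet 6 h).
Definition triple_pw := SetVar vPower (IAdd (Var vPower) (IAdd (Var vPower) (Var vPower))).

Lemma triple_loopP (R : realType) (s : state R) h (b := ieval s (bag_size (Var h))) :
  h \notin [:: vPos; vPower] ->
  run (For vPos (bag_size (Var h)) triple_pw) s (fun s' =>
    imem s' vPower 0 = 3 ^ b * imem s vPower 0) b.
Proof.
move=> hJ; rewrite -[X in run _ _ _ X]muln1.
apply: (run_for (Inv := fun k s' => imem s' vPower 0 = 3 ^ k * imem s vPower 0)) => //.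
- by rewrite /= !inE; move: hJ; rewrite !inE !negb_or => /andP[/negPf -> /negPf ->].
- by rewrite mul1n.
move=> j s1 jb A1 j1 I1; apply: run_straight => //.
by rewrite /= /upd /= I1 expnS; lia.
Qed.

Definition offsets_cmd : cmd :=
  ISet aOffsets (Cst 0) (Cst 0) ;;
  For vNodeIdx (IGet 0 (Cst 3))
    (SetVar vPower eG1 ;; For vPos (bag_size (Var vNodeIdx)) triple_pw ;;
     ISet aOffsets (IAdd (Var vNodeIdx) (Cst 1)) (IAdd (IGet aOffsets (Var vNodeIdx)) (Var vPower))).

(** Breadth-first search: each node is appended to the queue when its parent is at
    the head. *)
Definition order_cmd : cmd :=
  ISet aQueue (Cst 0) (IGet 0 (Cst 4)) ;; SetVar vTail (Cst 1) ;;
  For vNodeIdx (IGet 0 (Cst 3))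
    (SetVar vNode (IGet aQueue (Var vNodeIdx)) ;; SetVar vKind (IGet 2 (Var vNode)) ;;
     When (ILe (Cst 1) (Var vKind))
       (ISet aQueue (Var vTail) (IGet 4 (Var vNode)) ;; SetVar vTail (IAdd (Var vTail) (Cst 1))) ;;
     When (ILe (Cst 3) (Var vKind))
       (ISet aQueue (Var vTail) (IGet 5 (Var vNode)) ;; SetVar vTail (IAdd (Var vTail) (Cst 1)))).

Definition nodes_cmd : cmd :=
  For vNodeIdx (IGet 0 (Cst 3))
    (SetVar vNode (IGet aQueue (ISub (IGet 0 (Cst 3)) (IAdd (Var vNodeIdx) (Cst 1)))) ;; node_cmd).

Definition out_cmd : cmd :=
  SetVar vNode (IGet 0 (Cst 4)) ;; SetVar vPower (Cst 1) ;;
  For vPos (bag_size (Var vNode)) triple_pw ;;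
  SetVar vPtr (IAdd (IGet aOffsets (Var vNode)) eG) ;;
  RSet rOutput (Cst 0) RNinf ;;
  For vIter (Var vPower)
    (When (RLe (RVar rOutput) (RGet rTable (Var vPtr)))
       (RSet rOutput (Cst 0) (RGet rTable (Var vPtr))) ;;
     SetVar vPtr (IAdd (Var vPtr) eG1)).

Definition main_cmd : cmd :=
  rows_cmd ;; offsets_cmd ;; order_cmd ;; nodes_cmd ;; out_cmd.

Lemma out_loopP (R : realType) (s : state R) (n := imem s vPower 0)
    (p := imem s vPtr 0) (G := imem s 0 2) :
  rmem s rOutput 0 = -oo%E ->
  run (For vIter (Var vPower)
    (When (RLe (RVar rOutput) (RGet rTable (Var vPtr)))
       (RSet rOutput (Cst 0) (RGet rTable (Var vPtr))) ;;
     SetVar vPtr (IAdd (Var vPtr) eG1))) s (fun s' =>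
    forall z, (rmem s' rOutput 0 <= z)%E <->
      forall k, k < n -> (rmem s rTable (p + k * G.+1) <= z)%E) n.
Proof.
move=> o0.
apply: (@run_conseq _ _ _ (fun s' => (forall z, (rmem s' rOutput 0 <= z)%E <->
      forall k, k < n -> (rmem s rTable (p + k * G.+1) <= z)%E) /\
      imem s' vPtr 0 = p + n * G.+1) _ (n * 1)); [|by rewrite muln1|by move=> s' []].
apply: (run_for (Inv := fun j s' => (forall z, (rmem s' rOutput 0 <= z)%E <->
      forall k, k < j -> (rmem s rTable (p + k * G.+1) <= z)%E) /\
      imem s' vPtr 0 = p + j * G.+1)) => //.
- by split=> [z|]; [rewrite /= o0 leNye; split|rewrite mul0n addn0].
move=> j s1 jn A1 j1 [I1 I2]; apply: run_straight => //.
have ext z : (forall k, k < j.+1 -> (rmem s rTable (p + k * G.+1) <= z)%E) <->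
    (forall k, k < j -> (rmem s rTable (p + k * G.+1) <= z)%E) /\
    (rmem s rTable (p + j * G.+1) <= z)%E.
  split=> [H|[H1 H2] k]; first by split=> [k kj|]; apply: H; rewrite // ltnW.
  by rewrite ltnS leq_eqVlt => /orP[/eqP ->|]; [|apply: H1].
rewrite /= I2; have -> : rmem s1 rTable = rmem s rTable.
  by apply: functional_extensionality => a; frame A1.
case: ifP => le; rewrite /= /upd /= I2; (split; last by frame A1; rewrite -/G; lia).
  move=> z; rewrite ext; split=> [h|[]//]; split=> //.
  by apply/I1; apply: le_trans h.
move=> z; rewrite ext -I1; split=> [h|[]//]; split=> //.
by apply: le_trans h; rewrite ltW // ltNge le.
Qed.

Lemma positional_surj b n k : 0 < b -> k < b ^ n ->
  exists s, [/\ size s = n, all (fun d => d < b) s & positional b s = k].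
Proof.
move=> b0; elim: n k => [|n IH] k.
  by rewrite expn0 ltnS leqn0 => /eqP ->; exists [::].
rewrite expnS => kn; have [s [sz sb sv]] := IH (k %/ b) ltac:(by rewrite ltn_divLR // mulnC).
exists (k %% b :: s); split; rewrite /= ?sz ?ltn_mod ?b0 //.
by rewrite sv [RHS](divn_eq k b) addnC mulnC.
Qed.

(** Lets the output loop run through all codes of the root without decoding them:
    none of them is idle. *)
Lemma ccode_surj N M (B : {set vertex N M}) k : k < 3 ^ #|B| ->
  exists2 c, colouring B c & ccode B c = k.
Proof.
move=> /(positional_surj (isT : 0 < 3))[s [sz sb <-]].
exists (pcol_of B (fun u => nth 0 s (bag_index B u))).
  apply/forallP => u; rewrite ffunE; case: ifP => // uB.
  by rewrite isSome_colour_of (allP sb) // mem_nth // sz bag_index_lt.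
rewrite ccode_positional; congr (positional _).
apply: (@eq_from_nth _ 0); rewrite size_map -cardE ?sz // => i iB.
have /card_gt0P [u0 _] : 0 < #|B| by apply: leq_ltn_trans iB.
have inB : nth u0 (enum B) i \in B by rewrite -mem_enum mem_nth // -cardE.
rewrite (nth_map u0) -?cardE // ffunE inB /bag_index index_uniq ?enum_uniq -?cardE //.
by rewrite digit_colour_of // (allP sb) // mem_nth // sz.
Qed.

Section Main.
Variables (R : realType) (N M : nat) (grp : 'I_M -> {set 'I_N}) (G : nat).
Variables (x_ : 'rV[R]_N) (t : nat) (root : 'I_t) (par : 'I_t -> 'I_t).
Variables (bag : 'I_t -> {set vertex N M}).
Variable (ty : 'I_t -> node_type (vertex N M) 'I_t).
Local Notation V := (vertex N M).
Implicit Types (x y : 'I_t) (c : pcol V) (s : state R).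
Local Notation opt := (OPT grp G x_ bag ty).
Hypothesis ntd : nice_tree_decomposition (incidence grp) root par bag ty.

(** * Order of processing *)

Definition kids x : seq 'I_t := match ty x with
  | Leaf => [::] | Introduce _ y | Forget _ y => [:: y] | Join y z => [:: y; z] end.

Lemma kidsP x : uniq (kids x) /\ kids x =i children root par x.
Proof.
have := ntd.2 x; rewrite /nice_node /kids; case: (ty x) => [|v y|v y|y z].
- by case=> -> _; split=> // y; rewrite inE.
- by case=> -> _ _; split=> // z; rewrite !inE.
- by case=> -> _ _; split=> // z; rewrite !inE.
by case=> yz -> _ _; split=> [|w]; rewrite /= ?inE ?yz.
Qed.

Lemma closed_all (q : seq 'I_t) : root \in q ->
  (forall y, y != root -> par y \in q -> y \in q) -> forall y, y \in q.
Proof.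
move=> rq cl y; have [[[_ reach] _ _ _] _] := ntd.
have /iter_findex := reach y; move: (findex _ _ _) => n.
elim: n y => [|n IH] y /=; first by move=> ->.
rewrite -iterS iterSr => /IH pq; have [-> //|yr] := eqVneq y root.
exact: cl.
Qed.

(** The nodes before position h have been expanded.  The last field gives the order of
    processing, and also that no node is appended twice: the parent of a queued node
    has been expanded already, unlike the node at the head. *)
Record queue (q : seq 'I_t) h s : Prop := Queue {
  q_uniq : uniq q; q_root : root \in q; q_tail : imem s vTail 0 = size q;
  q_cells : forall x, x \in q -> imem s aQueue (index x q) = x;
  q_le : h <= size q;
  q_closed : forall y, y != root -> par y \in take h q -> y \in q;
  q_parent : forall y, y \in q -> y != root ->
    index (par y) q < h /\ index (par y) q < index y q }.

(** The search does not run dry: a queue that has been expanded completely contains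
    the root and is closed under children, so it contains all t nodes. *)
Lemma queue_lt q h s : queue q h s -> h < t -> h < size q.
Proof.
move=> Q ht; rewrite ltn_neqAle (q_le Q) andbT; apply: contraTneq ht => hq.
have all_q : forall y, y \in q.
  apply: closed_all (q_root Q) _ => y yr pq; apply: (q_closed Q) => //.
  by rewrite hq take_size.
rewrite -leqNgt -[t]card_ord hq -(card_uniqP (q_uniq Q)); apply: subset_leq_card.
by apply/subsetP => y _; apply: all_q.
Qed.

Lemma order_cmdP s : imem s 0 3 = t -> imem s 0 4 = root ->
  (forall x, [/\ imem s 2 x = (node_fields ty x).1.1.1, imem s 4 x = (node_fields ty x).1.2
      & imem s 5 x = (node_fields ty x).2]) ->
  run order_cmd s (fun s' => exists q, queue q t s') t.
Proof.
move=> t3 r4 tyE; apply: run_head => // s0 e0 A0; apply: run_set => s1 e1 A1.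
rewrite -[X in run _ _ _ X]muln1.
apply: (run_for (Inv := fun h s' => exists q, queue q h s')) => //.
- by rewrite /=; frames.
- exists [:: root]; split=> //=; rewrite ?inE //.
  + move=> x; rewrite inE => /eqP ->; rewrite eqxx /upd /=; frames.
    by rewrite e0 /= /upd /= r4.
  + by move=> y; rewrite inE => /eqP ->; rewrite eqxx.
move=> h s2 ht A2 h2 [q Q]; have hq := queue_lt Q ht.
pose x := nth root q h.
have xq : x \in q by rewrite mem_nth.
have ixq : index x q = h by rewrite index_uniq // (q_uniq Q).
apply: run_set => s3 e3 A3; apply: run_set => s4 e4 A4.
have x3 : imem s3 vNode 0 = x by rewrite e3 /= h2 -ixq (q_cells Q).
have [ty0 y0 z0] := tyE x.
have ty4 : imem s4 vKind 0 = (node_fields ty x).1.1.1 by rewrite e4 /= x3; frames.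
have x4 : imem s4 vNode 0 = x by frame A4.
have tl4 : imem s4 vTail 0 = size q by frame A4; frame A3; apply: q_tail Q.
have y4 : imem s4 4 x = (node_fields ty x).1.2 by frames.
have z4 : imem s4 5 x = (node_fields ty x).2 by frames.
have q4 : imem s4 aQueue =1 imem s2 aQueue by move=> j; frame A4; frame A3.
have ext s' : imem s' vTail 0 = size q + size (kids x) ->
    (forall j, j < size q -> imem s' aQueue j = imem s2 aQueue j) ->
    (forall y, y \in kids x -> imem s' aQueue (size q + index y (kids x)) = y) ->
    queue (q ++ kids x) h.+1 s'.
  move=> tl' old new; have [uk mk] := kidsP x.
  have kq y : y \in kids x -> [/\ y \notin q, y != root & par y = x].
    rewrite mk inE => /andP[yr /eqP py]; split=> //.
    by apply/negP => yq; have [] := q_parent Q yq yr; rewrite py ixq ltnn.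
  have tk : take h.+1 (q ++ kids x) = take h.+1 q by rewrite takel_cat.
  split=> //.
  - rewrite cat_uniq (q_uniq Q) uk andbT /=; apply/hasPn => y /kq[] //.
  - by rewrite mem_cat (q_root Q).
  - by rewrite size_cat.
  - move=> y; rewrite mem_cat index_cat; case: ifP => [yq _|_ /= yk].
      by rewrite old ?index_mem // (q_cells Q).
    exact: new.
  - by rewrite size_cat ltn_addr.
  - move=> y yr; rewrite tk (take_nth root hq) mem_rcons inE mem_cat.
    case/orP=> [/eqP py|pq]; last by rewrite (q_closed Q).
    by rewrite mk inE yr py eqxx orbT.
  move=> y; rewrite mem_cat => yq' yr; rewrite !index_cat.
  case: (boolP (y \in q)) yq' => [yq _|yq /= yk].
    have [p1 p2] := q_parent Q yq yr.
    have -> : par y \in q by rewrite -index_mem; apply: ltn_trans p2 _; rewrite index_mem.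
    by rewrite ltnS (ltnW p1).
  by have [_ _ ->] := kq y yk; rewrite xq ixq ltnSn ltn_addr.
have {}ext s' k1 k2 k3 : exists q', queue q' h.+1 s' := ex_intro _ _ (ext s' k1 k2 k3).
have bl : beval s4 (ILe (Cst 1) (Var vKind)) = (1 <= (node_fields ty x).1.1.1) by rewrite /= ty4.
have qsz j : j < size q -> (j == size q) = false by move=> js; apply: ltn_eqF.
rewrite -[0]addn0; apply: run_seq; apply: run_if; rewrite bl => h1; last first.
  apply: run_skip; apply: run_if => h3; rewrite /= ty4 in h3; first by lia.
  apply: run_skip; apply: ext; rewrite /= /upd /=.
  - by move: h1; rewrite tl4 /node_fields /kids; case: (ty x) => //= *; rewrite ?addn0.
  - by move=> j _; rewrite q4.
  by move: h1; rewrite /node_fields /kids; case: (ty x).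
apply: run_straight => //; apply: run_if; rewrite [beval _ _]/= /upd /= ty4 => h3.
  apply: run_straight => //; apply: ext; rewrite /= /upd /= ?tl4 ?x4.
  - by move: h3; rewrite /node_fields /kids; case: (ty x) => [|v y|v y|y z] //= _; lia.
  - by move=> j jq; do 2 (case: eqP => [?|_]; first by lia); apply: q4.
  move=> y; frame A4; frame A3; frame A2; frame A1; frame A0; rewrite y0 z0.
  move: h3 (kidsP x).1; rewrite /node_fields /kids; case: (ty x) => [|v y'|v y'|y' z] //= _.
  rewrite andbT !inE => yz /orP[/eqP ->|/eqP ->]; rewrite eqxx ?addn0 ?eqxx.
    by rewrite (_ : _ == _ + 1 = false) //; apply/eqP; lia.
  by rewrite (negPf yz) eqxx.
apply: run_skip; apply: ext; rewrite /= /upd /= ?tl4 ?x4.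
- by move: h1 h3; rewrite /node_fields /kids; case: (ty x) => [|v y|v y|y z].
- by move=> j jq; rewrite qsz // q4.
move=> y; frame A4; frame A3; frame A2; frame A1; frame A0; rewrite y0.
move: h1 h3; rewrite /node_fields /kids; case: (ty x) => [|v y'|v y'|y' z] //= _ _.
  by rewrite inE => /eqP ->; rewrite eqxx addn0 eqxx.
by rewrite inE => /eqP ->; rewrite eqxx addn0 eqxx.
Qed.

Lemma offsets_cmdP s (w : nat) : imem s 0 3 = t -> imem s 0 2 = G ->
  (forall x, imem s 6 (x + 1) = imem s 6 x + #|bag x|) ->
  (forall x, #|bag x| <= w) ->
  run offsets_cmd s (fun s' => forall k, k <= t -> imem s' aOffsets k = offset G bag k) (t * w.+1).
Proof.
move=> t3 g2 startE bw; apply: run_head => // s0 e0 A0.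
apply: (run_for (Inv := fun h s' => forall k, k <= h -> imem s' aOffsets k = offset G bag k)) => //.
- by rewrite /=; frames.
- move=> k; rewrite leqn0 => /eqP ->; by rewrite e0 /= /upd /= /offset big_pred0.
move=> h s1 ht A1 h1 I1; pose x := Ordinal ht.
apply: run_set => s2 e2 A2; rewrite -[w]addn0; apply: run_seq.
have bE : ieval s2 (bag_size (Var vNodeIdx)) = #|bag x|.
  by rewrite /= ; frames; rewrite h1 (startE x) addKn.
apply: run_use (triple_loopP (h := vNodeIdx) s2 isT) _ _; first by rewrite bE bw.
rewrite bE => s3 e3 A3; apply: run_straight => // k kh.
rewrite /= /upd /=; frame A3; frame A2; rewrite h1 addn1.
case: eqP => [->|ne]; last by frame A3; frame A2; apply: I1; lia.
rewrite e3 e2 /= I1 //; frames; rewrite g2 addn1.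
by rewrite (offset_succ G bag x).
Qed.

Lemma nodes_cmdP s q K : imem s 0 3 = t -> inputs grp G x_ bag ty s -> queue q t s ->
  (forall x, node_cost G bag ty x <= K) ->
  run nodes_cmd s (fun s' => forall x, solved grp G x_ bag ty s' x) (t * K.+1).
Proof.
move=> t3 inp Q nK.
have szq : size q = t.
  apply/eqP; rewrite eqn_leq (q_le Q) andbT -[leqRHS]card_ord -(card_uniqP (q_uniq Q)).
  exact: max_card.
have qall x : x \in q.
  have sub : {subset q <= enum 'I_t} by move=> y _; rewrite mem_enum.
  have [_ ->] := uniq_min_size (q_uniq Q) sub ltac:(by rewrite size_enum_ord szq).
  by rewrite mem_enum.
apply: (run_use (n := t * K.+1) (P := fun s' => forall x, t - t <= index x q ->
   solved grp G x_ bag ty s' x)) => //; last first.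
  by move=> s' H _ x; apply: H; rewrite subnn.
apply: (run_for (Inv := fun h s' => forall x, t - h <= index x q ->
   solved grp G x_ bag ty s' x)) => //.
- by move=> x; have := qall x; rewrite -index_mem szq; lia.
move=> h s1 ht A1 h1 I1.
have lt : t - h.+1 < size q by rewrite szq; lia.
pose x := nth root q (t - h.+1).
have ixq : index x q = t - h.+1 by rewrite index_uniq // (q_uniq Q).
have inp1 : inputs grp G x_ bag ty s1 by apply: inputs_agree A1 _ _ inp.
apply: run_set => s2 e2 A2.
have inp2 : inputs grp G x_ bag ty s2 by apply: inputs_agree A2 _ _ inp1.
have x2 : imem s2 vNode 0 = x.
  by rewrite e2 /= h1; frame A1; rewrite t3 addn1 -ixq (q_cells Q).
have T2 : rmem s2 rTable = rmem s1 rTable.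
  by apply: functional_extensionality => a; frame A2.
have kids_solved y : y \in children root par x -> solved grp G x_ bag ty s2 y.
  rewrite inE => /andP[yr /eqP py].
  have [_] := q_parent Q (qall y) yr; rewrite py ixq => lt'.
  by move=> i c iG cc; rewrite /table T2; apply: (I1 y) => //; lia.
apply: run_use (node_cmdP ntd inp2 x2 kids_solved) (nK x) _ => s3 [S3 O3] A3 y.
have [->|yx] := eqVneq y x; first by move=> _ i c; apply: S3.
move=> hy i c iG cc; rewrite /table /= O3.
  rewrite T2; apply: (I1 y) => //; move: hy; rewrite leq_eqVlt => /orP[/eqP e|]; last by lia.
  by case/eqP: yx; rewrite -[y](nth_index root (qall y)) -e.
rewrite opt_cellE; apply: contra yx => inx; apply/eqP.
by apply: (block_disjoint _ inx); apply: cell_in_block.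
Qed.

Lemma out_cmdP s (b := #|bag root|) : imem s 0 4 = root -> inputs grp G x_ bag ty s ->
  (forall x, solved grp G x_ bag ty s x) ->
  run out_cmd s (fun s' => rmem s' rOutput 0 = OPT_root grp G x_ root bag ty) (b + 3 ^ b).
Proof.
move=> r4 inp sol; apply: run_set => s1 e1 A1; apply: run_set => s2 e2 A2.
have inp1 : inputs grp G x_ bag ty s1 by apply: inputs_agree A1 _ _ inp.
have inp2 : inputs grp G x_ bag ty s2 by apply: inputs_agree A2 _ _ inp1.
rewrite /= r4 in e1.
have x2 : imem s2 vNode 0 = root by frame A2.
have bE : ieval s2 (bag_size (Var vNode)) = b.
  by rewrite /= x2 (in_start inp2) addKn.
apply: run_seq; apply: run_use (triple_loopP (h := vNode) s2 isT) _ _; first by rewrite bE.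
rewrite bE e2 muln1 => s3 e3 A3.
have inp3 : inputs grp G x_ bag ty s3 by apply: inputs_agree A3 _ _ inp2.
have x3 : imem s3 vNode 0 = root by frame A3.
apply: run_set => s4 e4 A4.
rewrite /= x3 (in_off inp3) ?(ltnW (ltn_ord _)) // (in_G inp3) in e4.
apply: run_head => // s5 e5 A5.
have o5 : rmem s5 rOutput 0 = -oo%E by rewrite e5 /= /upd.
have T5 a : rmem s5 rTable a = rmem s rTable a by frames.
have pw5 : imem s5 vPower 0 = 3 ^ b by frame A5; frame A4.
have pos5 : imem s5 vPtr 0 = offset G bag root + G by frame A5.
have G5 : imem s5 0 2 = G by frame A5; frame A4; apply: in_G inp3.
have := out_loopP o5; rewrite pw5 pos5 G5 => H; apply: run_use H (leqnn _) _.
move=> s6 O6 _.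
have same z : (rmem s6 rOutput 0 <= z)%E <-> (OPT_root grp G x_ root bag ty <= z)%E.
  rewrite O6 /OPT_root bigmaxe_leP; split=> [H c cc|H k kb].
    rewrite -(sol root) // /table opt_cellE /base -T5 -addnA [_ + G]addnC addnA [_.+1 * _]mulnC.
    by apply: H; apply: ccode_lt.
  have [c cc ck] := ccode_surj kb.
  have := H c cc; rewrite -(sol root) // /table opt_cellE /base ck -T5.
  by rewrite -addnA [_ + G]addnC addnA [_.+1 * _]mulnC.
by apply/eqP; rewrite eq_le; apply/andP; split; [apply/same|apply/same].
Qed.

End Main.

(** * Input layout *)

Lemma nth_flatten_take (T : Type) (x0 : T) ss k j : k < size ss ->
  j < size (nth [::] ss k) ->
  nth x0 (flatten ss) (sumn (take k (shape ss)) + j) = nth x0 (nth [::] ss k) j.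
Proof.
elim: ss k => [|a ss IH] [|k] //= kss jk; rewrite nth_cat.
  by rewrite jk.
by rewrite -addnA ltnNge leq_addr /= addKn IH.
Qed.

Lemma sumn_take_ord t (f : 'I_t -> nat) k : k <= t ->
  sumn (take k [seq f y | y <- enum 'I_t]) = \sum_(y < t | y < k) f y.
Proof.
elim: k => [|k IH] kt; first by rewrite take0 big1.
rewrite (take_nth 0); last by rewrite size_map size_enum_ord.
rewrite sumn_rcons IH ?(ltnW kt) //.
rewrite (sum_lt_succ f (Ordinal kt)); congr (_ + _).
by rewrite (nth_map (Ordinal kt)) ?size_enum_ord // (nth_ord_enum _ (Ordinal kt)).
Qed.

Section Layout.
Variables (R : realType) (N M : nat) (grp : 'I_M -> {set 'I_N}) (G : nat).
Variables (x_ : 'rV[R]_N) (t : nat) (root : 'I_t).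
Variables (bag : 'I_t -> {set vertex N M}).
Variable (ty : 'I_t -> node_type (vertex N M) 'I_t).
Local Notation s0 := (input_state grp G x_ root bag ty).

Lemma input_map (T : Type) x0 (f : 'I_t -> T) (x : 'I_t) :
  nth x0 [seq f y | y <- enum 'I_t] x = f x.
Proof. by rewrite (nth_map x) ?size_enum_ord // nth_ord_enum. Qed.

Lemma input_incidence (g : 'I_M) (e : 'I_N) :
  imem s0 1 (g * N + e) = (e \in grp g).
Proof.
rewrite /=; set row := fun h : 'I_M => [seq nat_of_bool (e0 \in grp h) | e0 <- enum 'I_N].
have rowsz : shape [seq row h | h <- enum 'I_M] = [seq N | h <- enum 'I_M].
  by rewrite /shape -map_comp; apply: eq_map => h; rewrite /= size_map size_enum_ord.
have -> : g * N = sumn (take g (shape [seq row h | h <- enum 'I_M])).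
  rewrite rowsz (sumn_take_ord (fun=> N)) ?(ltnW (ltn_ord g)) //.
  by rewrite -(big_ord_widen _ (fun=> N)) ?(ltnW (ltn_ord g)) // sum_nat_const card_ord.
have rowg : nth [::] [seq row h | h <- enum 'I_M] g = row g.
  by rewrite (nth_map g) ?size_enum_ord // nth_ord_enum.
rewrite nth_flatten_take; last 2 first.
- by rewrite size_map size_enum_ord.
- by rewrite rowg size_map size_enum_ord.
by rewrite rowg (nth_map e) ?size_enum_ord // nth_ord_enum.
Qed.

Lemma input_start k : k <= t -> imem s0 6 k = \sum_(y < t | y < k) #|bag y|.
Proof.
move=> kt; rewrite -[LHS]/(nth 0 [seq \sum_(y < t | y < j) #|bag y| | j <- iota 0 t.+1] k).
by rewrite (nth_map 0) ?size_iota ?nth_iota.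
Qed.

Lemma input_start_succ (x : 'I_t) : imem s0 6 (x + 1) = imem s0 6 x + #|bag x|.
Proof.
by rewrite addn1 !input_start ?(ltnW (ltn_ord x)) // (sum_lt_succ (fun y => #|bag y|)).
Qed.

Lemma input_bag (x : 'I_t) u : u \in bag x ->
  imem s0 7 (imem s0 6 x + bag_index (bag x) u) = vcode u.
Proof.
move=> ux; rewrite input_start ?(ltnW (ltn_ord x)) //=.
pose list y := [seq vcode v | v <- enum (bag y)].
have szE : shape [seq list y | y <- enum 'I_t] = [seq #|bag y| | y <- enum 'I_t].
  by rewrite /shape -map_comp; apply: eq_map => y; rewrite /= size_map -cardE.
rewrite -(sumn_take_ord (fun y => #|bag y|)) ?(ltnW (ltn_ord x)) // -szE.
have lx : nth [::] [seq list y | y <- enum 'I_t] x = list x.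
  by rewrite (nth_map x) ?size_enum_ord // nth_ord_enum.
rewrite nth_flatten_take; last 2 first.
- by rewrite size_map size_enum_ord.
- by rewrite lx size_map -cardE bag_index_lt.
by rewrite lx (nth_map u) ?nth_index ?index_mem ?mem_enum.
Qed.

Lemma input_weight (e : 'I_N) : rmem s0 rSignal e = (x_ 0%R e)%:E.
Proof. by rewrite /= (nth_map e) ?size_enum_ord // nth_ord_enum. Qed.

Lemma inputs_of s : agree [:: aRows; aOffsets; vIter; vPos; vPower; vNodeIdx] [::] s0 s ->
  (forall g, g <= M -> imem s aRows g = g * N) ->
  (forall k, k <= t -> imem s aOffsets k = offset G bag k) ->
  inputs grp G x_ bag ty s.
Proof.
move=> A rowE offE; split=> *; frame A => //.
- by rewrite rowE ?(ltnW (ltn_ord _)) // input_incidence; case: (_ \in _).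
- exact: input_map.
- exact: input_map.
- exact: input_map.
- exact: input_map.
- exact: input_start_succ.
- exact: input_bag.
- exact: input_weight.
exact: offE.
Qed.

End Layout.

(** * Counting iterations *)

Section Counting.
Variables (N M : nat) (grp : 'I_M -> {set 'I_N}) (G t : nat) (root : 'I_t).
Variables (par : 'I_t -> 'I_t) (bag : 'I_t -> {set vertex N M}).
Variable (ty : 'I_t -> node_type (vertex N M) 'I_t).
Hypothesis ntd : nice_tree_decomposition (incidence grp) root par bag ty.

(** Some group contains the first element, and both lie in a common bag.  If the
    width were 0, the bound on the running time would vanish. *)
Lemma width_pos : 0 < N -> group_model grp -> 0 < width bag.
Proof.
move=> N0 [_ cov]; pose e := Ordinal N0.
have /bigcupP[g _ eg] : e \in \bigcup_(S : 'I_M) grp S by rewrite cov inE.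
have [[_ _ _ edge] _] := ntd.
have [x /andP[ux vx]] := edge (inl e) (inr g) eg.
suff : 1 < \max_(y : 'I_t) #|bag y| by rewrite /width; case: (\max_(_ | _) _) => [|[]].
apply: leq_trans _ (leq_bigmax (F := fun y => #|bag y|) x).
have <- : #|[set inl e; inr g : vertex N M]| = 2 by rewrite cards2.
by apply/subset_leq_card/subsetP => u; rewrite !inE => /orP[/eqP ->|/eqP ->].
Qed.

Lemma bag_le_width x : 0 < width bag -> #|bag x| <= (width bag).+1.
Proof.
move=> w0; apply: leq_trans (leq_bigmax (F := fun y => #|bag y|) x) _.
by move: w0; rewrite /width; case: (\max_(_ | _) _).
Qed.

Lemma groups_le : 0 < width bag -> M <= t * (width bag).+1.
Proof.
move=> w0; have [[_ cov _ _] _] := ntd.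
have -> : t * (width bag).+1 = \sum_(x < t) (width bag).+1.
  by rewrite sum_nat_const card_ord.
apply: leq_trans (_ : #|[set: vertex N M]| <= _).
  by rewrite cardsT card_sum !card_ord leq_addl.
rewrite -cov; apply: (@leq_trans (\sum_(x < t) #|bag x|)); last first.
  by apply: leq_sum => x _; apply: bag_le_width.
elim/big_ind2: _ => [|A a B b Aa Bb|//]; first by rewrite cards0.
by apply: leq_trans (leq_add Aa Bb); rewrite cardsU leq_subr.
Qed.

Lemma node_cost_le x w : (forall y, #|bag y| <= w) ->
  node_cost G bag ty x <=
  3 ^ w * G.+1 + (w + 5 ^ w * (5 * w + N * w.+1 + G.+1 * G.+2 + w).+1).
Proof.
move=> bw; have Bw : #|big_bag bag ty x| <= w by rewrite /big_bag; case: (ty x).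
rewrite /node_cost; apply: leq_add.
  by rewrite leq_mul2r leq_exp2l ?bw ?orbT.
apply: leq_add => //; apply: leq_mul; first by rewrite leq_exp2l.
by rewrite ltnS !leq_add // leq_mul2l ?ltnS Bw orbT.
Qed.

End Counting.

(** Each summand is at most a constant times w 5 ^ w G ^ 2 N t.  The strict inequality
    leaves room for the additional one in the cost of a run. *)
Lemma total_cost (N M G t w : nat) (K := 3 ^ w.+1 * G.+1 + (w.+1 + 5 ^ w.+1 *
    (5 * w.+1 + N * w.+2 + G.+1 * G.+2 + w.+1).+1)) :
  0 < N -> 0 < G -> 0 < w -> 0 < t -> M <= t * w.+1 ->
  M + (t * w.+2 + (t + (t * K.+1 + (w.+1 + 3 ^ w.+1)))) < 200 * (w * 5 ^ w * G ^ 2 * N * t).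
Proof.
move=> N0 G0 w0 t0 Mt.
have p3 : 3 ^ w.+1 <= 5 * 5 ^ w by rewrite -expnS leq_exp2r.
have P0 : 0 < 5 ^ w by rewrite expn_gt0.
rewrite -mulnn; set X := w * 5 ^ w * (G * G) * N.
set P := 5 ^ w in p3 P0 *.
have X_ge a r : 0 < r -> X = a * r -> a <= X by move=> r0 ->; apply: leq_pmulr.
have GG0 : 0 < G * G by rewrite muln_gt0 G0.
have XPw : P * w <= X by apply: (X_ge _ (G * G * N)); [rewrite muln_gt0 GG0|rewrite /X; lia].
have XPwN : P * w * N <= X by apply: (X_ge _ (G * G)); [|rewrite /X; lia].
have XPGG : P * (G * G) <= X by apply: (X_ge _ (w * N)); [rewrite muln_gt0 w0|rewrite /X; lia].
have XPG : P * G <= X by apply: leq_trans XPGG; rewrite leq_mul2l leq_pmulr ?orbT.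
have XP : P <= X by apply: leq_trans XPw; rewrite leq_pmulr.
have Xw : w <= X by apply: leq_trans XPw; rewrite leq_pmull.
have X0 : 0 < X by apply: leq_trans XP.
have inner : 5 ^ w.+1 * (5 * w.+1 + N * w.+2 + G.+1 * G.+2 + w.+1).+1 <= 110 * X.
  have i1 : (5 * w.+1 + N * w.+2 + G.+1 * G.+2 + w.+1).+1 <=
      12 * w + 3 * (w * N) + 6 * (G * G) + 1.
    have : N * w.+2 <= 3 * (w * N) by rewrite mulnC mulnA leq_mul2r; lia.
    have : G.+1 * G.+2 <= 6 * (G * G).
      by apply: leq_trans (leq_mul (_ : _ <= 2 * G) (_ : _ <= 3 * G)) _; lia.
    lia.
  rewrite expnS -/P; apply: leq_trans (leq_mul (leqnn _) i1) _; lia.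
have cells : 3 ^ w.+1 * G.+1 <= 10 * X.
  apply: leq_trans (leq_mul p3 (_ : G.+1 <= 2 * G)) _; lia.
have KX : K <= 122 * X by rewrite /K; lia.
have p3X : 3 ^ w.+1 <= 5 * X by lia.
have all_t : M + (t * w.+2 + (t + (t * K.+1 + (w.+1 + 3 ^ w.+1)))) <=
    t * (w.+1 + (w.+2 + (1 + (K.+1 + (w.+1 + 3 ^ w.+1))))).
  by have := leq_pmull (w.+1 + 3 ^ w.+1) t0; move: K {KX cells inner} => K; lia.
apply: leq_ltn_trans all_t _; rewrite mulnA [_ * t]mulnC ltn_mul2l t0 /=; lia.
Qed.

Theorem theorem11 (R : realType) :
  exists (p : cmd) (C : nat),
    forall (N M : nat) (grp : 'I_M -> {set 'I_N}) (G : nat) (x : 'rV[R]_N)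
           (t : nat) (root : 'I_t) (par : 'I_t -> 'I_t)
           (bag : 'I_t -> {set vertex N M})
           (ty : 'I_t -> node_type (vertex N M) 'I_t),
      0 < N -> group_model grp -> 0 < G <= M ->
      nice_tree_decomposition (incidence grp) root par bag ty ->
      exists (s : state R) (k : nat),
        [/\ exec p (input_state grp G x root bag ty) s k,
            k <= C * (width bag * 5 ^ width bag * G ^ 2 * N * t)
          & dp_output grp G x root bag ty s].
Proof.
exists main_cmd, (csize main_cmd * 200).
move=> N M grp G x t root par bag ty N0 gm /andP[G0 _] ntd.
set s0 := input_state _ _ _ _ _ _; set w := width bag.
have w0 : 0 < w by apply: width_pos ntd N0 gm.
have bw y : #|bag y| <= w.+1 by apply: bag_le_width.
have t0 : 0 < t by apply: leq_ltn_trans (ltn_ord root).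
pose K := 3 ^ w.+1 * G.+1 + (w.+1 + 5 ^ w.+1 *
    (5 * w.+1 + N * w.+2 + G.+1 * G.+2 + w.+1).+1).
have [s [k [m [ex km mn out]]]] : run main_cmd s0 (dp_output grp G x root bag ty)
    (M + (t * w.+2 + (t + (t * K.+1 + (w.+1 + 3 ^ w.+1))))).
  apply: run_seq; apply: run_use (rows_cmdP s0) _ _; first exact: leqnn.
  move=> s1 rows A1; apply: run_seq.
  have inE a : a < 8 -> imem s1 a =1 imem s0 a.
    by move=> a8; apply: A1.1; do 8 (case: a a8 => [//|a] a8).
  apply: run_use (offsets_cmdP (w := w.+1) (G := G) (s := s1) _ _ _ bw) (leqnn _) _.
  - by rewrite inE.
  - by rewrite inE.
  - by move=> y; rewrite !inE //; apply: input_start_succ.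
  move=> s2 offsetG A2.
  have inp2 : inputs grp G x bag ty s2.
    apply: inputs_of offsetG; last first.
      by move=> g gM; frame A2; rewrite rows.
    apply: (agree_trans (s2 := s1)); first exact: agree_widen A1.
    exact: agree_widen A2.
  apply: run_seq; apply: run_use (order_cmdP ntd (s := s2) _ _ _) (leqnn _) _.
  - by frame A2; rewrite inE.
  - by frame A2; rewrite inE.
  - by move=> y; split; [apply: in_ty|apply: in_y|apply: in_z]; apply: inp2.
  move=> s3 [q Q] A3.
  have inp3 : inputs grp G x bag ty s3 by apply: inputs_agree A3 _ _ inp2.
  have t3 : imem s3 0 3 = t by frame A3; frame A2; rewrite inE.
  apply: run_seq; apply: run_use (nodes_cmdP ntd t3 inp3 Q (K := K) _) (leqnn _) _.
    by move=> y; apply: node_cost_le.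
  move=> s4 sol A4.
  have inp4 : inputs grp G x bag ty s4 by apply: inputs_agree A4 _ _ inp3.
  have r4 : imem s4 0 4 = root by frame A4; frame A3; frame A2; rewrite inE.
  apply: run_use (out_cmdP r4 inp4 sol) _ _.
    by apply: leq_add => //; rewrite leq_exp2l.
  move=> s5 outE A5; split=> // y i c iG cc.
  by rewrite A5.2 //; apply: sol.
exists s, k; split=> //; apply: leq_trans km _.
rewrite -mulnA leq_mul2l; apply/orP; right; apply: leq_ltn_trans mn _.
by apply: total_cost => //; apply: groups_le ntd w0.
Qed.
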